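(* Up to isomorphism (as quadratic Lie algebras, i.e. isometric isomorphism), the indecomposable quadratic nilpotent real Lie algebras of type $1$, or of type $2$ and nilpotent index $\leq5$, or of type $3$ and nilpotent index $\leq3$, are the following (all forms are symmetric; products not determined by the listed ones through antisymmetry are zero): (i) The quadratic Lie algebras $(\mathfrak{n}_{1,1},\pm\phi)$, $(\mathfrak{n}_{2,3},\pm\varphi)$, $(\mathfrak{n}_{2,5}^1,\pm\varphi_1)$, $(\mathfrak{n}_{2,5}^2,\pm\varphi_2)$, $(\mathfrak{n}_{3,3}^1,\pm\psi_1)$, $(\mathfrak{n}_{3,3}^2,\pm\psi_2)$ and $(\mathfrak{n}_{3,2},\psi)$ (defined in the context, over $\mathbb{R}$). (ii) The $8$-dimensional Lie algebra $(\mathfrak{n}_{2,5}^3,\varphi_3)$ with basis $\{a_i\}_{i=1}^8$ and products $[a_2,a_1]=a_3$, $[a_3,a_1]=a_4$, $[a_4,a_1]=a_6$, $[a_6,a_1]=a_7$, $[a_3,a_2]=a_5$, $[a_5,a_2]=-a_6$, $[a_6,a_2]=a_8$, $[a_4,a_3]=-a_8$, $[a_5,a_3]=-a_7$, where $\varphi_3(a_i,a_j)=(-1)^i$ for $i\le j$, $i=1,2,3$, $i+j=9$, $\varphi_3(a_4,a_4)=1=-\varphi_3(a_5,a_5)$, and $\varphi_3(a_i,a_j)=0$ for all other $i\le j$. (iii) The $8$-dimensional Lie algebra $(\mathfrak{n}_{3,3}^3,\psi_3)$ with basis $\{a_i\}_{i=1}^8$ and products $[a_2,a_1]=a_4$,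 $[a_3,a_1]=a_5$, $[a_4,a_1]=a_6$, $[a_5,a_1]=a_8$, $[a_4,a_2]=a_7$, $[a_5,a_3]=-a_7$, where $\psi_3(a_4,a_4)=-\psi_3(a_5,a_5)=1$, $\psi_3(a_1,a_7)=1=-\psi_3(a_2,a_6)=\psi_3(a_3,a_8)$, and $\psi_3(a_i,a_j)=0$ for all other $i\le j$. (iv) The $9$-dimensional quadratic Lie algebras $(\mathfrak{n}_{3,3}^4,\pm\psi_4)$ with basis $\{a_i\}_{i=1}^9$ and products $[a_2,a_1]=a_4$, $[a_3,a_1]=a_5$, $[a_4,a_1]=a_7$, $[a_5,a_1]=a_9$, $[a_3,a_2]=a_6$, $[a_4,a_2]=a_8$, $[a_6,a_2]=-a_9$, $[a_5,a_3]=a_8$, $[a_6,a_3]=a_7$, where $\psi_4(a_4,a_4)=\psi_4(a_5,a_5)=1=-\psi_4(a_6,a_6)$, $\psi_4(a_1,a_8)=1=-\psi_4(a_2,a_7)=-\psi_4(a_3,a_9)$, and $\psi_4(a_i,a_j)=0$ for all other $i\le j$. Any nonabelian nilpotent quadratic real Lie algebra of type $\leq2$ is indecomposable. The nonabelian decomposable nilpotent quadratic real Lie algebras of type $3$ and nilpotent index $\leq3$ are the orthogonal sums $(\mathfrak{n}_{1,1},\phi)\oplus L$ where $L$ is a quadratic Lie algebra as in items (ii), (iii) or (iv).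
   Context: For a Lie algebra $\mathfrak{n}$ put $\mathfrak{n}^1=\mathfrak{n}$, $\mathfrak{n}^i=[\mathfrak{n}^{i-1},\mathfrak{n}]$. A nilpotent $\mathfrak{n}$ has nilpotent index (nilindex) $t$ if $\mathfrak{n}^{t+1}=0$, $\mathfrak{n}^t\ne0$; its type is $\dim\mathfrak{n}/\mathfrak{n}^2$. A quadratic Lie algebra is a pair $(\mathfrak{n},B)$ with $B$ a nondegenerate symmetric bilinear form that is invariant: $B([x,y],z)=B(x,[y,z])$. Isometric isomorphisms are Lie algebra isomorphisms preserving the forms. A quadratic Lie algebra is decomposable if it contains a proper nonzero ideal on which the form is nondegenerate; otherwise indecomposable. The algebras of item (i), over $\mathbb{R}$ (only nonzero products up to antisymmetry, and nonzero values of the symmetric forms for $i\le j$, are listed): $(\mathfrak{n}_{1,1},\phi)$: basis $a_1$, abelian, $\phi(a_1,a_1)=1$. $(\mathfrak{n}_{2,3},\varphi)$: basis $a_1,\dots,a_5$; $[a_2,a_1]=a_3$, $[a_3,a_1]=a_4$, $[a_3,a_2]=a_5$; $\varphi(a_i,a_j)=(-1)^{i-1}$ for $i\le j$, $i+j=6$. $(\mathfrak{n}_{2,5}^1,\varphi_1)$: basis $a_1,\dots,a_7$; $[a_2,a_1]=a_3$, $[a_3,a_1]=a_4$, $[a_4,a_1]=a_5$, $[a_5,a_1]=a_6$, $[a_5,a_2]=a_7$, $[a_3,a_4]=a_7$; $\varphi_1(a_i,a_j)=(-1)^i$ for $i\le j$, $i+j=8$. $(\mathfrak{n}_{2,5}^2,\varphi_2)$: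 basis $a_1,\dots,a_8$; $[a_2,a_1]=a_3$, $[a_3,a_1]=a_4$, $[a_3,a_2]=a_5$, $[a_4,a_1]=a_6$, $[a_6,a_1]=a_7$, $[a_6,a_2]=a_8$, $[a_2,a_5]=-a_6$, $[a_4,a_3]=-a_8$, $[a_5,a_3]=a_7$; $\varphi_2(a_i,a_j)=(-1)^i$ for $1\le i\le3$, $i+j=9$, $\varphi_2(a_4,a_4)=\varphi_2(a_5,a_5)=1$. $(\mathfrak{n}_{3,2},\psi)$: basis $a_1,\dots,a_6$; $[a_2,a_1]=a_4$, $[a_3,a_1]=a_5$, $[a_3,a_2]=a_6$; $\psi(a_i,a_j)=(-1)^{i-1}$ for $i\le j$, $i+j=7$. $(\mathfrak{n}_{3,3}^1,\psi_1)$: basis $a_1,\dots,a_8$; $[a_2,a_1]=a_4$, $[a_3,a_1]=a_5$, $[a_4,a_1]=a_6$, $[a_4,a_2]=a_7$, $[a_5,a_1]=a_8$, $[a_5,a_3]=a_7$; $\psi_1(a_4,a_4)=\psi_1(a_5,a_5)=1$, $\psi_1(a_1,a_7)=1$, $\psi_1(a_2,a_6)=\psi_1(a_3,a_8)=-1$. $(\mathfrak{n}_{3,3}^2,\psi_2)$: basis $a_1,\dots,a_9$; $[a_2,a_1]=a_4$, $[a_3,a_1]=a_5$, $[a_3,a_2]=a_6$, $[a_4,a_1]=a_7$, $[a_4,a_2]=a_8$, $[a_5,a_1]=a_9$, $[a_5,a_3]=a_8$, $[a_6,a_3]=-a_7$, $[a_6,a_2]=a_9$; $\psi_2(a_4,a_4)=\psi_2(a_5,a_5)=\psi_2(a_6,a_6)=1$,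 $\psi_2(a_1,a_8)=1$, $\psi_2(a_2,a_7)=\psi_2(a_3,a_9)=-1$.
   Formalization: The last sentence is false as printed: sums with (ii) have nilpotent index 5, those with (iii), (iv) have type 4, and (n_{1,1},φ)⊕(n_{2,3},φ) is missed. It is corrected to: exactly the orthogonal sums (n_{1,1},±φ)⊕(n_{2,3},±φ). *)

(* Defs.v *)
From HB Require Import structures.
From mathcomp Require Import all_boot all_order all_algebra.
From mathcomp Require Import sesquilinear ring.
From mathcomp Require Import reals.

Set Implicit Arguments.
Unset Strict Implicit.
Unset Printing Implicit Defensive.

Import GRing.Theory.
Local Open Scope ring_scope.

Record lieAlgebra (F : fieldType) := LieAlgebra {
  lie_space :> vectType F;
  lie_br : lie_space -> lie_space -> lie_space;
  lie_br_bilinear : bilinear_for *:%R *:%R lie_br;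
  lie_brxx : forall x, lie_br x x = 0;
  lie_jacobi : forall x y z,
    lie_br (lie_br x y) z + lie_br (lie_br y z) x + lie_br (lie_br z x) y = 0
}.

HB.instance Definition _ (F : fieldType) (L : lieAlgebra F) :=
  bilinear_isBilinear.Build F L L L *:%R *:%R (@lie_br F L)
    (lie_br_bilinear L).

Definition nondegenerate_on (F : fieldType) (V : vectType F)
    (B : V -> V -> F) (U : {vspace V}) : Prop :=
  forall x, x \in U -> (forall y, y \in U -> B x y = 0) -> x = 0.

Record quadLie (F : fieldType) := QuadLie {
  quad_lie :> lieAlgebra F;
  qform : quad_lie -> quad_lie -> F;
  qform_bilinear : bilinear_for *%R *%R qform;
  qformC : forall x y, qform x y = qform y x;
  qform_invariant : forall x y z,
    qform (lie_br x y) z = qform x (lie_br y z);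
  qform_nondegenerate : nondegenerate_on qform fullv
}.

HB.instance Definition _ (F : fieldType) (L : quadLie F) :=
  bilinear_isBilinear.Build F L L F *%R *%R (@qform F L)
    (qform_bilinear L).

Section LowerCentralSeries.
Variables (F : fieldType) (L : lieAlgebra F).

(* [U, W]; by bilinearity, brackets of basis vectors suffice, see lie_prodP. *)
Definition lie_prod (U W : {vspace L}) : {vspace L} :=
  <<[seq lie_br u w | u <- vbasis U, w <- vbasis W]>>%VS.

Lemma lie_prodP (U W X : {vspace L}) :
  reflect (forall u w, u \in U -> w \in W -> lie_br u w \in X)
          (lie_prod U W <= X)%VS.
Proof.
apply: (iffP span_subvP) => [sub u w Uu Ww|sub _ /allpairsP[[u w] [Uu Ww ->]]].
  rewrite (coord_vbasis Uu) (coord_vbasis Ww).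
  rewrite linear_sumlz rpred_sum // => i _; rewrite linear_sumr.
  apply: rpred_sum => j _; rewrite linearZl_LR linearZr_LR !rpredZ //.
  by apply: sub; apply: allpairs_f; rewrite mem_nth ?size_tuple.
by apply: sub; apply: vbasis_mem.
Qed.

(* Indexed as n^1 = n, n^2 = [n, n], ...; index 0 also gives n. *)
Definition lcs (i : nat) : {vspace L} :=
  iter i.-1 (fun U => lie_prod U fullv) fullv.

Definition lie_nilpotent : Prop := exists t, lcs t.+1 = 0%VS.

Definition nilindex (t : nat) : Prop := lcs t.+1 = 0%VS /\ lcs t <> 0%VS.

Definition lie_type : nat := (\dim {:L} - \dim (lcs 2))%N.

Definition lie_abelian : Prop := forall x y : L, lie_br x y = 0.

Definition lie_ideal (I : {vspace L}) : Prop :=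
  forall x y, x \in I -> lie_br x y \in I.

End LowerCentralSeries.

Definition decomposable (F : fieldType) (L : quadLie F) : Prop :=
  exists I : {vspace L},
    [/\ lie_ideal I, I <> 0%VS, I <> fullv & nondegenerate_on (@qform F L) I].

Definition indecomposable (F : fieldType) (L : quadLie F) : Prop :=
  ~ decomposable L.

Definition isometric (F : fieldType) (L M : quadLie F) : Prop :=
  exists f : {linear L -> M},
    [/\ bijective f, forall x y, f (lie_br x y) = lie_br (f x) (f y)
      & forall x y, qform (f x) (f y) = qform x y].

Section Opposite.
Variables (F : fieldType) (L : quadLie F).

Definition opp_form (x y : L) : F := - qform x y.

Fact opp_form_bilinear : bilinear_for *%R *%R opp_form.
Proof.
by split=> [y a u v | x a u v]; rewrite /opp_form ?linearPl ?linearPr /=; ring.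
Qed.

Fact opp_formC x y : opp_form x y = opp_form y x.
Proof. by rewrite /opp_form qformC. Qed.

Fact opp_form_invariant x y z :
  opp_form (lie_br x y) z = opp_form x (lie_br y z).
Proof. by rewrite /opp_form qform_invariant. Qed.

Fact opp_form_nondegenerate : nondegenerate_on opp_form fullv.
Proof.
move=> x Ux Bx0; apply: (qform_nondegenerate Ux) => y Uy.
by apply/eqP; rewrite -oppr_eq0; apply/eqP; apply: Bx0.
Qed.

Definition quad_opp : quadLie F :=
  QuadLie opp_form_bilinear opp_formC opp_form_invariant
          opp_form_nondegenerate.

Definition quad_sign (b : bool) : quadLie F := if b then quad_opp else L.

End Opposite.

Section OrthogonalSum.
Variables (F : fieldType) (L M : quadLie F).

Definition sum_br (x y : L * M) : L * M :=
  (lie_br x.1 y.1, lie_br x.2 y.2).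
Definition sum_form (x y : L * M) : F := qform x.1 y.1 + qform x.2 y.2.

Fact sum_br_bilinear : bilinear_for *:%R *:%R sum_br.
Proof.
by split=> [y a u v | x a u v]; rewrite /sum_br /= ?linearPl ?linearPr.
Qed.

Fact sum_brxx x : sum_br x x = 0.
Proof. by rewrite /sum_br !lie_brxx. Qed.

Fact sum_jacobi x y z :
  sum_br (sum_br x y) z + sum_br (sum_br y z) x + sum_br (sum_br z x) y = 0.
Proof. by congr (_, _); apply: lie_jacobi. Qed.

Definition sum_lie : lieAlgebra F :=
  LieAlgebra sum_br_bilinear sum_brxx sum_jacobi.

Fact sum_form_bilinear : bilinear_for *%R *%R sum_form.
Proof.
by split=> [y a u v | x a u v]; rewrite /sum_form /= ?linearPl ?linearPr /=;
  ring.
Qed.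

Fact sum_formC x y : sum_form x y = sum_form y x.
Proof. by rewrite /sum_form (qformC x.1) (qformC x.2). Qed.

Fact sum_form_invariant (x y z : sum_lie) :
  sum_form (lie_br x y) z = sum_form x (lie_br y z).
Proof. by rewrite /sum_form /= !qform_invariant. Qed.

Fact sum_form_nondegenerate : nondegenerate_on sum_form fullv.
Proof.
move=> [x1 x2] _ B0; congr (_, _);
  apply: (@qform_nondegenerate _ _ _ (memvf _)).
  move=> y _; have := B0 (y, 0) (memvf _).
  by rewrite /sum_form /= linear0r addr0.
move=> y _; have := B0 (0, y) (memvf _).
by rewrite /sum_form /= linear0r add0r.
Qed.

Definition quad_sum : quadLie F :=
  @QuadLie F sum_lie sum_form sum_form_bilinear sum_formC sum_form_invariant
           sum_form_nondegenerate.

End OrthogonalSum.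

(* Quadratic Lie algebras on F^n, with canonical basis a_1, ..., a_n, given by *)
(* tables. An entry (i, j, c, k) of a product table stands for [a_i, a_j] =    *)
(* c a_k and [a_j, a_i] = - c a_k; an entry (i, j, c) of a form table stands   *)
(* for B(a_i, a_j) = B(a_j, a_i) = c. Unlisted values are 0.                   *)
Definition prod_table := seq (nat * nat * int * nat).
Definition form_table := seq (nat * nat * int).

Section Tables.
Variables (F : fieldType) (n : nat).
Local Notation V := 'rV[F]_n.+1.
Implicit Types (T : prod_table) (S : form_table) (x y z : V).

Definition avec (i : nat) : V := delta_mx 0 (inord i.-1).
Definition acoord (x : V) (i : nat) : F := x 0 (inord i.-1).

Definition table_br T x y : V :=
  \sum_(e <- T) let: (i, j, c, k) := e in
    (c%:~R * (acoord x i * acoord y j - acoord x j * acoord y i)) *: avec k.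

Definition table_form S x y : F :=
  \sum_(e <- S) let: (i, j, c) := e in
    c%:~R * (if i == j then acoord x i * acoord y i
             else acoord x i * acoord y j + acoord x j * acoord y i).

Definition table_jacobi_at T x y z : Prop :=
  table_br T (table_br T x y) z + table_br T (table_br T y z) x
  + table_br T (table_br T z x) y = 0.

Lemma acoordD x y i : acoord (x + y) i = acoord x i + acoord y i.
Proof. by rewrite /acoord mxE. Qed.

Lemma acoordP a x y i : acoord (a *: x + y) i = a * acoord x i + acoord y i.
Proof. by rewrite /acoord !mxE. Qed.

Lemma acoord0 i : acoord 0 i = 0.
Proof. by rewrite /acoord mxE. Qed.

Lemma acoord_inj x y :
  (forall i, i < n.+1 -> acoord x i.+1 = acoord y i.+1)%N -> x = y.
Proof.
move=> xy; apply/rowP=> i.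
by have := xy i (ltn_ord i); rewrite /acoord /= inord_val.
Qed.

Lemma acoord_avec i j : (i.-1 < n.+1)%N -> (j.-1 < n.+1)%N ->
  acoord (avec i) j = (i.-1 == j.-1)%:R.
Proof.
move=> lti ltj; rewrite /acoord mxE eqxx /= -val_eqE /= !inordK //.
by rewrite eq_sym.
Qed.

Lemma acoord_table_br T x y k :
    all (fun e => e.2.-1 < n.+1)%N T -> (k.-1 < n.+1)%N ->
  acoord (table_br T x y) k =
    \sum_(e <- T) let: (i, j, c, l) := e in
      if l.-1 == k.-1
      then c%:~R * (acoord x i * acoord y j - acoord x j * acoord y i) else 0.
Proof.
move=> + ltk; rewrite /table_br.
elim: T => [|[[[i j] c] l] T IH] /=; first by rewrite !big_nil acoord0.
case/andP=> ltl /IH; rewrite !big_cons acoordP => ->; congr (_ + _).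
by rewrite acoord_avec //; case: eqP; rewrite ?mulr1 ?mulr0.
Qed.

Fact table_br_bilinear T : bilinear_for *:%R *:%R (table_br T).
Proof.
split=> [y a u v | x a u v]; rewrite /table_br /= scaler_sumr -big_split /=;
  apply: eq_bigr => -[[[i j] c] k] _; rewrite !acoordP scalerA -scalerDl;
  by congr (_ *: _); ring.
Qed.

Fact table_brxx T x : table_br T x x = 0.
Proof.
rewrite /table_br big1_seq // => -[[[i j] c] k] _.
by rewrite [_ * acoord x i]mulrC subrr mulr0 scale0r.
Qed.

Fact table_form_bilinear S : bilinear_for *%R *%R (table_form S).
Proof.
split=> [y a u v | x a u v]; rewrite /table_form /= mulr_sumr -big_split /=;
  by apply: eq_bigr => -[[i j] c] _; rewrite !acoordP; case: ifP => _; ring.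
Qed.

Fact table_formC S x y : table_form S x y = table_form S y x.
Proof.
by apply: eq_bigr => -[[i j] c] _; case: ifP => _; ring.
Qed.

Definition partners S (p : nat) : seq (nat * int) :=
  [seq (if e.1.1 == p then e.1.2 else e.1.1, e.2)
  | e <- S & (e.1.1 == p) || (e.1.2 == p)].

Lemma table_form_avec S x p :
    all (fun e => (0 < e.1.1 <= n.+1) && (0 < e.1.2 <= n.+1))%N S ->
    (0 < p <= n.+1)%N ->
  table_form S x (avec p) =
    \sum_(e <- partners S p) e.2%:~R * acoord x e.1.
Proof.
move=> + lep; rewrite /table_form /partners big_map.
have avecE i : (0 < i <= n.+1)%N -> acoord (avec p) i = (i == p)%:R.
  by case: i p lep => [|i] [|p] // ? ?; rewrite acoord_avec //= eqSS eq_sym.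
elim: S => [|[[i j] c] S IH] /=; first by rewrite !big_nil.
case/andP=> /andP[lei lej] /IH {}IH; rewrite big_cons IH !avecE //.
case: (eqVneq i j) => [->|neq_ij]; case: (eqVneq j p) => [jp|_] /=;
  rewrite ?orbT ?orbF ?big_cons /= ?jp ?eqxx ?mulr1 ?mulr0 ?add0r //.
  by rewrite -jp (negPf neq_ij) mulr0 addr0.
by case: (boolP (i == p)) => [ip|/negPf ip];
  rewrite ?big_cons /= ?ip ?mulr1 ?mulr0 ?add0r.
Qed.

Definition table_form_check S : bool :=
  all (fun e => (0 < e.1.1 <= n.+1) && (0 < e.1.2 <= n.+1))%N S &&
  all (fun k => has (fun p => partners S p \in [:: [:: (k, 1)]; [:: (k, -1)]])
                    (iota 1 n.+1)) (iota 1 n.+1).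

Lemma table_form_checkP S :
  table_form_check S -> nondegenerate_on (table_form S) fullv.
Proof.
case/andP=> range /allP pairing x _ B0; apply: acoord_inj => k ltk.
have /pairing/hasP[p]: k.+1 \in iota 1 n.+1 by rewrite mem_iota.
rewrite mem_iota add1n ltnS => lep pk; have := B0 (avec p) (memvf _).
rewrite table_form_avec // acoord0; move: pk; rewrite !inE.
case/orP=> /eqP->; rewrite big_seq1 /= ?mulr1z ?mulrN1z ?mul1r ?mulN1r //.
by move/eqP; rewrite oppr_eq0 => /eqP.
Qed.

Definition table_lie T
    (jac : forall x y z, table_jacobi_at T x y z) : lieAlgebra F :=
  LieAlgebra (table_br_bilinear T) (table_brxx T) jac.

Definition table_quad T S jac
    (inv : forall x y z,
       table_form S (table_br T x y) z = table_form S x (table_br T y z))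
    (ndg : nondegenerate_on (table_form S) fullv) : quadLie F :=
  @QuadLie F (table_lie jac) (table_form S) (table_form_bilinear S)
           (table_formC S) inv ndg.

End Tables.

Ltac table_jacobi :=
  move=> x y z; apply: acoord_inj; do 9?[case=> [_|] //];
  rewrite acoord0 !acoordD !acoord_table_br // unlock /=;
  rewrite ?acoord_table_br // ?unlock /=; ring.

Ltac table_invariant :=
  move=> x y z; rewrite /table_form unlock /=;
  rewrite ?acoord_table_br // ?unlock /=; ring.

Definition pr (i j k : nat) : nat * nat * int * nat := (i, j, 1, k).
Definition prN (i j k : nat) : nat * nat * int * nat := (i, j, -1, k).
Definition fm (i j : nat) : nat * nat * int := (i, j, 1).
Definition fmN (i j : nat) : nat * nat * int := (i, j, -1).

(* The boolean is the sign of the form: false for B, true for - B. *)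
Variant indec_index : Type :=
  | I11 of bool
  | I23 of bool
  | I25_1 of bool
  | I25_2 of bool
  | I33_1 of bool
  | I33_2 of bool
  | I32
  | I25_3
  | I33_3
  | I33_4 of bool.

Section Algebras.
Variable F : fieldType.

Definition n11_br : prod_table := [::].
Definition n11_form : form_table := [:: fm 1 1].
Fact n11_jacobi (x y z : 'rV[F]_1) : table_jacobi_at n11_br x y z.
Proof. by rewrite /table_jacobi_at; move: x y z; table_jacobi. Qed.
Fact n11_invariant (x y z : 'rV[F]_1) :
  table_form n11_form (table_br n11_br x y) z =
  table_form n11_form x (table_br n11_br y z).
Proof. by move: x y z; table_invariant. Qed.
Fact n11_nondegenerate :
  nondegenerate_on (@table_form F 0 n11_form) fullv.
Proof. exact: table_form_checkP. Qed.
Definition n11 := table_quad n11_jacobi n11_invariant n11_nondegenerate.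

Definition n23_br : prod_table := [:: pr 2 1 3; pr 3 1 4; pr 3 2 5].
Definition n23_form : form_table := [:: fm 1 5; fmN 2 4; fm 3 3].
Fact n23_jacobi (x y z : 'rV[F]_5) : table_jacobi_at n23_br x y z.
Proof. by rewrite /table_jacobi_at; move: x y z; table_jacobi. Qed.
Fact n23_invariant (x y z : 'rV[F]_5) :
  table_form n23_form (table_br n23_br x y) z =
  table_form n23_form x (table_br n23_br y z).
Proof. by move: x y z; table_invariant. Qed.
Fact n23_nondegenerate :
  nondegenerate_on (@table_form F 4 n23_form) fullv.
Proof. exact: table_form_checkP. Qed.
Definition n23 := table_quad n23_jacobi n23_invariant n23_nondegenerate.

Definition n25_1_br : prod_table :=
  [:: pr 2 1 3; pr 3 1 4; pr 4 1 5; pr 5 1 6; pr 5 2 7; pr 3 4 7].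
Definition n25_1_form : form_table := [:: fmN 1 7; fm 2 6; fmN 3 5; fm 4 4].
Fact n25_1_jacobi (x y z : 'rV[F]_7) : table_jacobi_at n25_1_br x y z.
Proof. by rewrite /table_jacobi_at; move: x y z; table_jacobi. Qed.
Fact n25_1_invariant (x y z : 'rV[F]_7) :
  table_form n25_1_form (table_br n25_1_br x y) z =
  table_form n25_1_form x (table_br n25_1_br y z).
Proof. by move: x y z; table_invariant. Qed.
Fact n25_1_nondegenerate :
  nondegenerate_on (@table_form F 6 n25_1_form) fullv.
Proof. exact: table_form_checkP. Qed.
Definition n25_1 := table_quad n25_1_jacobi n25_1_invariant n25_1_nondegenerate.

Definition n25_2_br : prod_table :=
  [:: pr 2 1 3; pr 3 1 4; pr 3 2 5; pr 4 1 6; pr 6 1 7; pr 6 2 8; prN 2 5 6;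
    prN 4 3 8; pr 5 3 7].
Definition n25_2_form : form_table :=
  [:: fmN 1 8; fm 2 7; fmN 3 6; fm 4 4; fm 5 5].
Fact n25_2_jacobi (x y z : 'rV[F]_8) : table_jacobi_at n25_2_br x y z.
Proof. by rewrite /table_jacobi_at; move: x y z; table_jacobi. Qed.
Fact n25_2_invariant (x y z : 'rV[F]_8) :
  table_form n25_2_form (table_br n25_2_br x y) z =
  table_form n25_2_form x (table_br n25_2_br y z).
Proof. by move: x y z; table_invariant. Qed.
Fact n25_2_nondegenerate :
  nondegenerate_on (@table_form F 7 n25_2_form) fullv.
Proof. exact: table_form_checkP. Qed.
Definition n25_2 := table_quad n25_2_jacobi n25_2_invariant n25_2_nondegenerate.

Definition n32_br : prod_table := [:: pr 2 1 4; pr 3 1 5; pr 3 2 6].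
Definition n32_form : form_table := [:: fm 1 6; fmN 2 5; fm 3 4].
Fact n32_jacobi (x y z : 'rV[F]_6) : table_jacobi_at n32_br x y z.
Proof. by rewrite /table_jacobi_at; move: x y z; table_jacobi. Qed.
Fact n32_invariant (x y z : 'rV[F]_6) :
  table_form n32_form (table_br n32_br x y) z =
  table_form n32_form x (table_br n32_br y z).
Proof. by move: x y z; table_invariant. Qed.
Fact n32_nondegenerate :
  nondegenerate_on (@table_form F 5 n32_form) fullv.
Proof. exact: table_form_checkP. Qed.
Definition n32 := table_quad n32_jacobi n32_invariant n32_nondegenerate.

Definition n33_1_br : prod_table :=
  [:: pr 2 1 4; pr 3 1 5; pr 4 1 6; pr 4 2 7; pr 5 1 8; pr 5 3 7].
Definition n33_1_form : form_table :=
  [:: fm 4 4; fm 5 5; fm 1 7; fmN 2 6; fmN 3 8].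
Fact n33_1_jacobi (x y z : 'rV[F]_8) : table_jacobi_at n33_1_br x y z.
Proof. by rewrite /table_jacobi_at; move: x y z; table_jacobi. Qed.
Fact n33_1_invariant (x y z : 'rV[F]_8) :
  table_form n33_1_form (table_br n33_1_br x y) z =
  table_form n33_1_form x (table_br n33_1_br y z).
Proof. by move: x y z; table_invariant. Qed.
Fact n33_1_nondegenerate :
  nondegenerate_on (@table_form F 7 n33_1_form) fullv.
Proof. exact: table_form_checkP. Qed.
Definition n33_1 := table_quad n33_1_jacobi n33_1_invariant n33_1_nondegenerate.

Definition n33_2_br : prod_table :=
  [:: pr 2 1 4; pr 3 1 5; pr 3 2 6; pr 4 1 7; pr 4 2 8; pr 5 1 9; pr 5 3 8;
    prN 6 3 7; pr 6 2 9].
Definition n33_2_form : form_table :=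
  [:: fm 4 4; fm 5 5; fm 6 6; fm 1 8; fmN 2 7; fmN 3 9].
Fact n33_2_jacobi (x y z : 'rV[F]_9) : table_jacobi_at n33_2_br x y z.
Proof. by rewrite /table_jacobi_at; move: x y z; table_jacobi. Qed.
Fact n33_2_invariant (x y z : 'rV[F]_9) :
  table_form n33_2_form (table_br n33_2_br x y) z =
  table_form n33_2_form x (table_br n33_2_br y z).
Proof. by move: x y z; table_invariant. Qed.
Fact n33_2_nondegenerate :
  nondegenerate_on (@table_form F 8 n33_2_form) fullv.
Proof. exact: table_form_checkP. Qed.
Definition n33_2 := table_quad n33_2_jacobi n33_2_invariant n33_2_nondegenerate.

Definition n25_3_br : prod_table :=
  [:: pr 2 1 3; pr 3 1 4; pr 4 1 6; pr 6 1 7; pr 3 2 5; prN 5 2 6; pr 6 2 8;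
    prN 4 3 8; prN 5 3 7].
Definition n25_3_form : form_table :=
  [:: fmN 1 8; fm 2 7; fmN 3 6; fm 4 4; fmN 5 5].
Fact n25_3_jacobi (x y z : 'rV[F]_8) : table_jacobi_at n25_3_br x y z.
Proof. by rewrite /table_jacobi_at; move: x y z; table_jacobi. Qed.
Fact n25_3_invariant (x y z : 'rV[F]_8) :
  table_form n25_3_form (table_br n25_3_br x y) z =
  table_form n25_3_form x (table_br n25_3_br y z).
Proof. by move: x y z; table_invariant. Qed.
Fact n25_3_nondegenerate :
  nondegenerate_on (@table_form F 7 n25_3_form) fullv.
Proof. exact: table_form_checkP. Qed.
Definition n25_3 := table_quad n25_3_jacobi n25_3_invariant n25_3_nondegenerate.

Definition n33_3_br : prod_table :=
  [:: pr 2 1 4; pr 3 1 5; pr 4 1 6; pr 5 1 8; pr 4 2 7; prN 5 3 7].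
Definition n33_3_form : form_table :=
  [:: fm 4 4; fmN 5 5; fm 1 7; fmN 2 6; fm 3 8].
Fact n33_3_jacobi (x y z : 'rV[F]_8) : table_jacobi_at n33_3_br x y z.
Proof. by rewrite /table_jacobi_at; move: x y z; table_jacobi. Qed.
Fact n33_3_invariant (x y z : 'rV[F]_8) :
  table_form n33_3_form (table_br n33_3_br x y) z =
  table_form n33_3_form x (table_br n33_3_br y z).
Proof. by move: x y z; table_invariant. Qed.
Fact n33_3_nondegenerate :
  nondegenerate_on (@table_form F 7 n33_3_form) fullv.
Proof. exact: table_form_checkP. Qed.
Definition n33_3 := table_quad n33_3_jacobi n33_3_invariant n33_3_nondegenerate.

Definition n33_4_br : prod_table :=
  [:: pr 2 1 4; pr 3 1 5; pr 4 1 7; pr 5 1 9; pr 3 2 6; pr 4 2 8; prN 6 2 9;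
    pr 5 3 8; pr 6 3 7].
Definition n33_4_form : form_table :=
  [:: fm 4 4; fm 5 5; fmN 6 6; fm 1 8; fmN 2 7; fmN 3 9].
Fact n33_4_jacobi (x y z : 'rV[F]_9) : table_jacobi_at n33_4_br x y z.
Proof. by rewrite /table_jacobi_at; move: x y z; table_jacobi. Qed.
Fact n33_4_invariant (x y z : 'rV[F]_9) :
  table_form n33_4_form (table_br n33_4_br x y) z =
  table_form n33_4_form x (table_br n33_4_br y z).
Proof. by move: x y z; table_invariant. Qed.
Fact n33_4_nondegenerate :
  nondegenerate_on (@table_form F 8 n33_4_form) fullv.
Proof. exact: table_form_checkP. Qed.
Definition n33_4 := table_quad n33_4_jacobi n33_4_invariant n33_4_nondegenerate.

Definition indecomposable_list (i : indec_index) : quadLie F :=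
  match i with
  | I11 s => quad_sign n11 s
  | I23 s => quad_sign n23 s
  | I25_1 s => quad_sign n25_1 s
  | I25_2 s => quad_sign n25_2 s
  | I33_1 s => quad_sign n33_1 s
  | I33_2 s => quad_sign n33_2 s
  | I32 => n32
  | I25_3 => n25_3
  | I33_3 => n33_3
  | I33_4 s => quad_sign n33_4 s
  end.

End Algebras.

(* Main.v *)
(* A quadratic Lie algebra generated by x_1, ..., x_d is determined up to      *)
(* isometry by the numbers B(w, x_k), w a left-normed bracket of generators:   *)
(* invariance turns them into the Gram matrix of all such brackets, and        *)
(* nondegeneracy makes the correspondence of brackets a well-defined map.      *)
(* For two generators and nilindex at most 5, put w = [x_1, x_0]; besides the  *)
(* B(x_i, x_j) only c = B(w, w) and q_ij = B([w, x_i], [w, x_j]) survive. A    *)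
(* change of generators diagonalises q, higher terms remove c when q is not 0, *)
(* and central elements of n^2 make the generators isotropic.                  *)
(* For three generators and nilindex at most 3, what survives besides the      *)
(* B(x_i, x_j) is the volume B([x_1, x_2], x_0) and the Gram matrix of         *)
(* [x_1, x_2], [x_2, x_0], [x_0, x_1]. Once this matrix is diagonalised, its   *)
(* signature up to order determines the algebra: rank 0 gives n_{3,2}, rank 1  *)
(* the orthogonal sums with a line, ranks 2 and 3 the algebras n_{3,3}^i.      *)
(* A decomposable algebra of type at most 3 has an anisotropic central line,   *)
(* which the listed algebras of type 2 and 3 do not have. They are told apart  *)
(* by dimension, type and the signs taken by the form on the lower central     *)
(* series.                                                                     *)

From HB Require Import structures.
Require Import Defs.
From mathcomp Require Import all_boot all_order all_algebra.
From mathcomp Require Import zify ring.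
From mathcomp Require Import boolp reals.

Set Implicit Arguments.
Unset Strict Implicit.
Unset Printing Implicit Defensive.

Import Order.TTheory GRing.Theory Num.Theory.

(** * Generators of nilpotent Lie algebras *)

(** A nilpotent Lie algebra is generated by any lift of a basis of n/n^2, and the left-normed
    brackets of these generators span it. Invariance moves brackets across the form, so the numbers
    B(word, generator) fix the form on all words. Nondegeneracy then makes the correspondence
    between equal words an isometry ([isometric_words]). Only finitely many of these numbers survive
    in low nilindex; [isometric2] and [isometric3] list them.

    The surviving numbers are normalised over the reals by changing generators. Linear changes
    diagonalise a Gram matrix of brackets and rescale its entries to their signs, corrections in n^2
    remove B(w, w) or the volume, and central corrections remove the products of the generators.
    [rank2_normal_form] and [rank3_normal_form] list the outcomes; each is realised by a listed
    algebra or by a sum of a line with n_{2,3}.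

    For nilpotent algebras of type at most 3 and dimension above one, decomposability amounts to
    having an anisotropic central vector ([decomposable_splits_line], [splits_line_decomposable]).
    The centre is orthogonal to n^2, so such a vector would serve as a generator;
    [type2_not_splits_line], [diag3_not_splits_line] and [volume_not_splits_line] exclude this.
    Dimension, type and the signs of B(x, x) on terms of the lower central series tell the listed
    algebras apart ([listed_inj]). *)

Section LieTheory.
Local Open Scope ring_scope.
Variables (F : fieldType) (L : lieAlgebra F).
Implicit Types (x y z u v : L) (U V W S : {vspace L}) (X : seq L).

Lemma brDl x y z : lie_br (x + y) z = lie_br x z + lie_br y z.
Proof. exact: linearDl. Qed.
Lemma brDr z x y : lie_br z (x + y) = lie_br z x + lie_br z y.
Proof. exact: linearDr. Qed.
Lemma brZl a x z : lie_br (a *: x) z = a *: lie_br x z.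
Proof. exact: linearZl_LR. Qed.
Lemma brZr z a x : lie_br z (a *: x) = a *: lie_br z x.
Proof. exact: linearZr_LR. Qed.
Lemma brNl x z : lie_br (- x) z = - lie_br x z.
Proof. exact: linearNl. Qed.
Lemma brNr z x : lie_br z (- x) = - lie_br z x.
Proof. exact: linearNr. Qed.
Lemma br0l z : lie_br 0 z = 0 :> L.
Proof. exact: linear0l. Qed.
Lemma br0r z : lie_br z 0 = 0 :> L.
Proof. exact: linear0r. Qed.

Lemma br_anti x y : lie_br x y = - lie_br y x.
Proof.
apply/eqP; rewrite -subr_eq0 opprK; apply/eqP.
by have := lie_brxx (x + y); rewrite brDl !brDr !lie_brxx add0r addr0.
Qed.

(** Jacobi in the form that turns a right-nested bracket into left-normed ones. *)
Lemma br_brr u x y :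
  lie_br u (lie_br x y) = lie_br (lie_br u x) y - lie_br (lie_br u y) x.
Proof.
have /eqP := lie_jacobi u x y.
rewrite (br_anti (lie_br x y) u) (br_anti y u) brNl -addrA addr_eq0 => /eqP ->.
by rewrite opprD !opprK addrK.
Qed.

Definition lie_central z := forall u, lie_br z u = 0.

Lemma lcsS k : lcs L k.+2 = lie_prod (lcs L k.+1) fullv.
Proof. by []. Qed.

Lemma mem_lie_prod U W u w : u \in U -> w \in W -> lie_br u w \in lie_prod U W.
Proof. by apply/lie_prodP; apply: subvv. Qed.

Lemma lie_prodS U1 U2 W1 W2 :
  (U1 <= U2)%VS -> (W1 <= W2)%VS -> (lie_prod U1 W1 <= lie_prod U2 W2)%VS.
Proof.
move=> /subvP sU /subvP sW; apply/lie_prodP => u w /sU Uu /sW Ww.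
exact: mem_lie_prod.
Qed.

Lemma mem_lcs k u x : u \in lcs L k.+1 -> lie_br u x \in lcs L k.+2.
Proof. by move=> uk; apply: mem_lie_prod => //; apply: memvf. Qed.

Lemma mem_lcs_r k u x : u \in lcs L k.+1 -> lie_br x u \in lcs L k.+2.
Proof. by move=> uk; rewrite br_anti memvN mem_lcs. Qed.

Lemma lcs_decS k : (lcs L k.+1 <= lcs L k)%VS.
Proof.
case: k => [|k]; first exact: subvf.
elim: k => [|k IH]; first exact: subvf.
by rewrite !lcsS; apply: lie_prodS.
Qed.

Lemma lcs_dec j k : (j <= k)%N -> (lcs L k <= lcs L j)%VS.
Proof.
elim: k => [|k IH]; first by rewrite leqn0 => /eqP->.
rewrite leq_eqVlt => /orP[/eqP-> //|]; rewrite ltnS => /IH.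
exact: (subv_trans (lcs_decS k)).
Qed.

Lemma lcs0_ge j k : lcs L j = 0%VS -> (j <= k)%N -> lcs L k = 0%VS.
Proof. by move=> j0 /lcs_dec; rewrite j0 subv0 => /eqP. Qed.

Definition linear_pred (P : L -> Prop) :=
  forall a u v, P u -> P v -> P (a *: u + v).

Lemma span_ind (P : L -> Prop) X :
  P 0 -> linear_pred P -> {in X, forall x, P x} ->
  forall u, u \in <<X>>%VS -> P u.
Proof.
move=> P0 PD PX u Xu; rewrite (coord_span (X := in_tuple X) Xu).
elim/big_ind: _ => // [x y Px Py|i _].
  by rewrite -[x]scale1r; apply: PD.
by rewrite -[_ *: _]addr0; apply: PD => //; apply/PX/mem_nth.
Qed.

Lemma lie_prod_ind (P : L -> Prop) U W :
  P 0 -> linear_pred P ->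
  (forall u w, u \in U -> w \in W -> P (lie_br u w)) ->
  forall u, u \in lie_prod U W -> P u.
Proof.
move=> P0 PD PX; apply: span_ind => // _ /allpairsP[[u w] [Uu Ww ->]].
by apply: PX; apply: vbasis_mem.
Qed.

(** Generation modulo n^2. For nilpotent algebras this is generation as a Lie algebra, which is the
    content of [nilpotent_ind]. *)
Definition lie_gens X : Prop := (<<X>> + lcs L 2)%VS = fullv.

Lemma lie_gensP X : lie_gens X <-> forall v, v \in (<<X>> + lcs L 2)%VS.
Proof.
split=> [-> v|all]; first exact: memvf.
by apply/vspaceP => v; rewrite all memvf.
Qed.

Lemma lie_gens_sub X Y :
  lie_gens X -> {in X, forall x, x \in (<<Y>> + lcs L 2)%VS} -> lie_gens Y.
Proof.
move=> gX XY; apply/eqP; rewrite eqEsubv subvf -gX subv_add addvSr andbT.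
by apply/span_subvP.
Qed.

Lemma lie_gens_exists d :
  lie_type L = d -> exists2 X : seq L, size X = d & lie_gens X.
Proof.
move=> <-; exists (vbasis ((lcs L 2)^C)%VS).
  by rewrite size_tuple dimv_compl.
by rewrite /lie_gens (span_basis (vbasisP _)) addvC addv_complf.
Qed.

Lemma lie_gens_type X : lie_gens X -> (lie_type L <= size X)%N.
Proof.
move=> gX; rewrite /lie_type leq_subLR -gX.
apply: leq_trans (dimv_add_leqif _ _) _.
by rewrite addnC leq_add2l dim_span.
Qed.

Lemma nilpotent_ind (P : L -> Prop) X :
  lie_nilpotent L -> lie_gens X ->
  P 0 -> linear_pred P -> {in X, forall x, P x} ->
  (forall u v, P u -> P v -> P (lie_br u v)) -> forall u, P u.
Proof.
move=> [t t0] gX P0 PD PX Pbr.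
(* Each u is approximated modulo n^(k+1) by an element satisfying [P]; at k = t the error is
   zero. *)
suff H k u : exists2 s, P s & u - s \in lcs L k.+1.
  move=> u; have [s Ps] := H t u.
  by rewrite t0 memv0 subr_eq0 => /eqP->.
elim: k u => [|k IH] u; first by exists 0; rewrite ?memvf.
have /memv_addP[x Xx [v v2 ->]] : u \in (<<X>> + lcs L 2)%VS.
  by rewrite (gX : _ = _) memvf.
have Px : P x by apply: span_ind Xx.
suff [s Ps vs] : exists2 s, P s & v - s \in lcs L k.+2.
  exists (x + s); first by rewrite -[x]scale1r; apply: PD.
  by rewrite opprD addrACA subrr add0r.
move: v v2; apply: lie_prod_ind => [|a v w [s Ps vs] [r Pr wr]|v w _ _].
- by exists 0; rewrite ?subr0 ?mem0v.
- exists (a *: s + r); first exact: PD.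
  by rewrite opprD addrACA -scalerBr memvD // memvZ.
have [s Ps vs] := IH v; have [r Pr wr] := IH w.
exists (lie_br s r); first exact: Pbr.
(* Here [v, w] - [s, r] = [v - s, w] + [s, w - r], and both terms lie one step deeper than the
   errors of v and w. *)
rewrite -[v](subrK s) brDl -addrA memvD ?mem_lcs //.
by rewrite -brNr -brDr mem_lcs_r.
Qed.

(* The word (i, s) stands for [...[[x_i, x_s0], x_s1], ...]. *)
Definition word X i (s : seq nat) : L :=
  foldl (fun u j => lie_br u X`_j) X`_i s.

Lemma word_rcons X i s j : word X i (rcons s j) = lie_br (word X i s) X`_j.
Proof. by rewrite /word -cats1 foldl_cat. Qed.

Inductive word_span X : L -> Prop :=
| WordSpan0 : word_span X 0
| WordSpanP a u v : word_span X u -> word_span X v -> word_span X (a *: u + v)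
| WordSpan i s : word_span X (word X i s).

(** The span of the words is closed under brackets: the right factor is unfolded letter by letter
    with [br_brr] until only right brackets with generators remain. *)
Lemma word_span_full X :
  lie_nilpotent L -> lie_gens X -> forall u, word_span X u.
Proof.
move=> nilL gX.
have brX j u : word_span X u -> word_span X (lie_br u X`_j).
  elim=> [|a v w _ IHv _ IHw|i s]; first by rewrite br0l; apply: WordSpan0.
    by rewrite brDl brZl; apply: WordSpanP.
  by rewrite -word_rcons; apply: WordSpan.
have wD u v : word_span X u -> word_span X v -> word_span X (u + v).
  by move=> uX vX; rewrite -[u]scale1r; apply: WordSpanP.
have wN u : word_span X u -> word_span X (- u).
  move=> uX; rewrite -scaleN1r -[_ *: _]addr0.
  by apply: WordSpanP => //; apply: WordSpan0.
apply: (nilpotent_ind nilL gX) => [||x Xx|u v uX vX].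
- exact: WordSpan0.
- exact: WordSpanP.
- by rewrite -(nth_index 0 Xx); apply: (WordSpan X _ [::]).
elim: vX u uX => {v} [|a v w _ IHv _ IHw|i s] u uX.
- by rewrite br0r; apply: WordSpan0.
- by rewrite brDr brZr; apply: WordSpanP; [apply: IHv | apply: IHw].
elim/last_ind: s u uX => [|s j IH] u uX; first exact: brX.
rewrite word_rcons br_brr; apply: wD; first by apply/brX/IH.
by apply/wN/IH/brX.
Qed.

End LieTheory.

(** * Invariant forms, the lower central series and the centre *)

Section QuadTheory.
Local Open Scope ring_scope.
Variable F : fieldType.

Section OneAlgebra.
Variable L : quadLie F.
Implicit Types (x y z u v : L) (X : seq L).

Lemma qDl x y z : qform (x + y) z = qform x z + qform y z.
Proof. exact: linearDl. Qed.
Lemma qDr z x y : qform z (x + y) = qform z x + qform z y.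
Proof. exact: linearDr. Qed.
Lemma qZl a x z : qform (a *: x) z = a * qform x z.
Proof. exact: linearZl_LR. Qed.
Lemma qZr z a x : qform z (a *: x) = a * qform z x.
Proof. exact: linearZr_LR. Qed.
Lemma qNl x z : qform (- x) z = - qform x z.
Proof. exact: linearNl. Qed.
Lemma qNr z x : qform z (- x) = - qform z x.
Proof. exact: linearNr. Qed.
Lemma q0l z : qform 0 z = 0 :> F.
Proof. exact: linear0l. Qed.
Lemma q0r z : qform z 0 = 0 :> F.
Proof. exact: linear0r. Qed.

(** Bracketing with x is skew for the form, so the last letter of the right argument can be moved to
    the left one. *)
Lemma q_brr u v x : qform u (lie_br v x) = - qform (lie_br u x) v.
Proof. by rewrite qform_invariant -qNr -br_anti. Qed.

Lemma q_brx x y : qform (lie_br x y) y = 0.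
Proof. by rewrite qform_invariant lie_brxx q0r. Qed.

Lemma qform_ndg u : (forall v, qform u v = 0) -> u = 0.
Proof.
by move=> u0; apply: (qform_nondegenerate (memvf u)) => v _; apply: u0.
Qed.

(** Brackets are moved from the right argument to the left one until the latter lies in a vanishing
    term. *)
Lemma qform_lcs i j u v : lcs L (i + j).+1 = 0%VS ->
  u \in lcs L i.+1 -> v \in lcs L j.+1 -> qform u v = 0.
Proof.
elim: j i u v => [|j IH] i u v L0 ui.
  by move: ui; rewrite addn0 in L0; rewrite L0 memv0 => /eqP->; rewrite q0l.
move: v; apply: lie_prod_ind => [|a v w uv uw|v w vj _]; first exact: q0r.
  by rewrite qDr qZr uv uw mulr0 addr0.
rewrite q_brr (IH i.+1) ?oppr0 //; first by rewrite addSn -addnS.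
exact: mem_lcs.
Qed.

Lemma central_orth z v : lie_central z -> v \in lcs L 2 -> qform z v = 0.
Proof.
move=> cz; move: v; apply: lie_prod_ind => [|a v w zv zw|v w _ _].
- exact: q0r.
- by rewrite qDr qZr zv zw mulr0 addr0.
by rewrite q_brr cz q0l oppr0.
Qed.

(** The centraliser of z is a subalgebra, so it suffices that it contains the generators. *)
Lemma central_gens z X :
  lie_nilpotent L -> lie_gens X -> {in X, forall x, lie_br z x = 0} ->
  lie_central z.
Proof.
move=> nilL gX zX; apply: (nilpotent_ind nilL gX) => // [|a u v zu zv|u v zu zv].
- exact: br0r.
- by rewrite brDr brZr zu zv scaler0 addr0.
- by rewrite br_brr zu zv !br0l subr0.
Qed.

(** A central element is already orthogonal to n^2; only its products with the generators are
    left. *)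
Lemma central_orth0 z X :
  lie_gens X -> lie_central z -> {in X, forall x, qform z x = 0} -> z = 0.
Proof.
move=> gX cz zX; apply: qform_ndg => v.
have /memv_addP[x Xx [w w2 ->]] : v \in (<<X>> + lcs L 2)%VS.
  by rewrite (gX : _ = _) memvf.
rewrite qDr (central_orth cz w2) addr0.
move: x Xx; apply: span_ind => // [|a u w' zu zw]; first exact: q0r.
by rewrite qDr qZr zu zw mulr0 addr0.
Qed.

End OneAlgebra.

(** * Isometries from matching words *)

Section Isometry.
Variables L M : quadLie F.

Section Words.
Variables (X : seq L) (Y : seq M).
Hypotheses (nilL : lie_nilpotent L) (nilM : lie_nilpotent M).
Hypotheses (gX : lie_gens X) (gY : lie_gens Y).
Hypothesis XY : forall i s k,
  qform (word X i s) X`_k = qform (word Y i s) Y`_k.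

(** The linear relation spanned by pairs of equal words. It is the graph of a map only by
    nondegeneracy. An index past the end of a list stands for the letter 0. *)
Inductive word_graph : L -> M -> Prop :=
| WordGraph0 : word_graph 0 0
| WordGraphP a u v u' v' : word_graph u u' -> word_graph v v' ->
    word_graph (a *: u + v) (a *: u' + v')
| WordGraph i s : word_graph (word X i s) (word Y i s).

Lemma word_graph_br j u u' :
  word_graph u u' -> word_graph (lie_br u X`_j) (lie_br u' Y`_j).
Proof.
elim=> [|a v w v' w' _ IHv _ IHw|i s]; first by rewrite !br0l; apply: WordGraph0.
  by rewrite !brDl !brZl; apply: WordGraphP.
by rewrite -!word_rcons; apply: WordGraph.
Qed.

(** The letters of the right word are moved one by one to the left argument, until products of words
    with a single generator remain; these agree by [XY]. *)
Lemma word_graph_form u u' v v' :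
  word_graph u u' -> word_graph v v' -> qform u v = qform u' v'.
Proof.
move=> uu' vv'; elim: vv' u u' uu' => {v v'}
  [|a v w v' w' _ IHv _ IHw|i s] u u' uu'; first by rewrite !q0r.
  by rewrite !qDr !qZr (IHv u u') // (IHw u u').
elim/last_ind: s u u' uu' => [|s j IH] u u' uu'; last first.
  by rewrite !word_rcons !q_brr (IH _ (lie_br u' Y`_j)) //; apply: word_graph_br.
elim: uu' => [|a v w v' w' _ IHv _ IHw|{}i' s].
- by rewrite !q0l.
- by rewrite !qDl !qZl IHv IHw.
exact: XY.
Qed.

Lemma word_graph_total u : exists u', word_graph u u'.
Proof.
elim: (word_span_full nilL gX u) => [|a v w _ [v' vv'] _ [w' ww']|i s].
- by exists 0; apply: WordGraph0.
- by exists (a *: v' + w'); apply: WordGraphP.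
- by exists (word Y i s); apply: WordGraph.
Qed.

Lemma word_graph_surj u' : exists u, word_graph u u'.
Proof.
elim: (word_span_full nilM gY u') => [|a v w _ [v' vv'] _ [w' ww']|i s].
- by exists 0; apply: WordGraph0.
- by exists (a *: v' + w'); apply: WordGraphP.
- by exists (word X i s); apply: WordGraph.
Qed.

Lemma word_graphB u u' v v' :
  word_graph u u' -> word_graph v v' -> word_graph (u - v) (u' - v').
Proof.
move=> uu' vv'; rewrite [u - v]addrC [u' - v']addrC -[v]scale1r -[v']scale1r.
by rewrite -!scaleNr; apply: WordGraphP.
Qed.

(** The difference of two images is related to 0, hence orthogonal to everything that is related to
    some element, which is all of [M]. *)
Lemma word_graph_fun u u' v' : word_graph u u' -> word_graph u v' -> u' = v'.
Proof.
move=> uu' uv'; apply/eqP; rewrite -subr_eq0; apply/eqP/qform_ndg => w'.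
have [w ww'] := word_graph_surj w'.
by rewrite -(word_graph_form (word_graphB uu' uv') ww') subrr q0l.
Qed.

Lemma word_graph_inj u v u' : word_graph u u' -> word_graph v u' -> u = v.
Proof.
move=> uu' vu'; apply/eqP; rewrite -subr_eq0; apply/eqP/qform_ndg => w.
have [w' ww'] := word_graph_total w.
by rewrite (word_graph_form (word_graphB uu' vu') ww') subrr q0l.
Qed.

Theorem isometric_words : isometric L M.
Proof.
pose f u := projT1 (cid (word_graph_total u)).
have fP u : word_graph u (f u) by rewrite /f; case: cid.
pose g u := projT1 (cid (word_graph_surj u)).
have gP u : word_graph (g u) u by rewrite /g; case: cid.
have linf : linear f.
  move=> a u v; apply: (word_graph_fun (fP _)).
  by apply: WordGraphP.
pose fm := GRing.isLinear.Build F L M *:%R f linf.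
pose fl : {linear L -> M} := HB.pack f fm.
exists fl; split.
- exists g => u; first exact: word_graph_inj (gP _) (fP _).
  exact: word_graph_fun (fP _) (gP _).
(* Multiplicativity holds when the second factor is a generator, and Jacobi carries it over to
   brackets of second factors. *)
- move=> u v; rewrite /=; move: v u; pose P v :=
    forall u, f (lie_br u v) = lie_br (f u) (f v).
  have lin0 : f 0 = 0 by apply: word_graph_fun (fP _) WordGraph0.
  have linD a v w : f (a *: v + w) = a *: f v + f w by apply: linf.
  apply: (nilpotent_ind (P := P) nilL gX) => [u|a v w Pv Pw u|x Xx u|v w Pv Pw u].
  + by rewrite br0r lin0 br0r.
  + by rewrite brDr brZr !linD Pv Pw brDr brZr.
  + rewrite -(nth_index 0 Xx); set j := index x X.
    have -> : f X`_j = Y`_j by apply: word_graph_fun (fP _) (WordGraph j [::]).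
    exact: word_graph_fun (fP _) (word_graph_br _ (fP u)).
  have linB r t : f (r - t) = f r - f t.
    by rewrite addrC -scaleN1r linD scaleN1r addrC.
  by rewrite Pw !br_brr linB Pw Pv Pv Pw.
- by move=> u v; rewrite /= -(word_graph_form (fP u) (fP v)).
Qed.

End Words.

End Isometry.
End QuadTheory.

(** * The words that survive in low nilindex *)

Section SmallRank.
Local Open Scope ring_scope.
Variable F : fieldType.

Lemma foldl_br_lcs (L : lieAlgebra F) (X : seq L) k u s :
  u \in lcs L k.+1 ->
  foldl (fun v j => lie_br v X`_j) u s \in lcs L (size s + k).+1.
Proof.
by elim: s u k => //= j s IH u k uk; rewrite addSnnS; apply/IH/mem_lcs.
Qed.

Lemma foldl_brZ (L : lieAlgebra F) (X : seq L) a u s :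
  foldl (fun v j => lie_br v X`_j) (a *: u) s =
  a *: foldl (fun v j => lie_br v X`_j) u s.
Proof. by elim: s u => //= j s IH u; rewrite brZl IH. Qed.

Definition eps2 (i j : nat) : F :=
  match i, j with 1, 0 => 1 | 0, 1 => -1 | _, _ => 0 end.

Lemma br_eps2 (L : lieAlgebra F) (x0 x1 : L) i j :
  lie_br [:: x0; x1]`_i [:: x0; x1]`_j = eps2 i j *: lie_br x1 x0.
Proof.
case: i => [|[|i]]; case: j => [|[|j]];
  rewrite /= ?nth_nil ?br0l ?br0r ?lie_brxx ?scale0r ?scale1r //.
by rewrite scaleN1r -br_anti.
Qed.

(** A word of length at least two is a multiple of one that starts with w. Moving its last letter
    onto x_k leaves a product with w: it is zero for [w, x_i] by skewness, an entry of q for two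
    further letters, and zero by degree for three or more. *)
Theorem isometric2 (L M : quadLie F) (x0 x1 : L) (y0 y1 : M) :
  let w := lie_br x1 x0 in let v := lie_br y1 y0 in
  lcs L 6 = 0%VS -> lcs M 6 = 0%VS ->
  lie_gens [:: x0; x1] -> lie_gens [:: y0; y1] ->
  qform x0 x0 = qform y0 y0 -> qform x0 x1 = qform y0 y1 ->
  qform x1 x1 = qform y1 y1 -> qform w w = qform v v ->
  qform (lie_br w x0) (lie_br w x0) = qform (lie_br v y0) (lie_br v y0) ->
  qform (lie_br w x0) (lie_br w x1) = qform (lie_br v y0) (lie_br v y1) ->
  qform (lie_br w x1) (lie_br w x1) = qform (lie_br v y1) (lie_br v y1) ->
  isometric L M.
Proof.
move=> w v L6 M6 gX gY G00 G01 G11 C Q00 Q01 Q11.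
have wx1 (A : quadLie F) (a b : A) : qform (lie_br a b) a = 0.
  by rewrite br_anti qNl q_brx oppr0.
apply: (isometric_words (X := [:: x0; x1]) (Y := [:: y0; y1])) => //;
  try by [exists 5].
move=> i [|j s] k.
  by case: i => [|[|i]]; case: k => [|[|k]];
    rewrite /word /= ?nth_nil ?q0l ?q0r // qformC G01 qformC.
rewrite /word /= !br_eps2 !foldl_brZ !qZl; congr (_ * _); rewrite -/w -/v.
case/lastP: s => [|s l] /=.
  by case: k => [|[|k]]; rewrite /= ?nth_nil ?q0r ?q_brx ?wx1.
rewrite -!cats1 !foldl_cat /= !qform_invariant !br_eps2 !qZr; congr (_ * _).
rewrite -/w -/v; case: s => [|m [|n [|p s]]] //=; first by rewrite !wx1.
  have wq (A : quadLie F) (r a b : A) :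
      qform (lie_br (lie_br r a) b) r = - qform (lie_br r a) (lie_br r b).
    by rewrite q_brr opprK.
  rewrite !wq; congr (- _).
  by case: m => [|[|m]]; case: n => [|[|n]];
    rewrite /= ?nth_nil ?br0r ?q0l ?q0r // qformC Q01 qformC.
(* Three or more letters after w give an element of n^5, which is orthogonal to n^2 because n^6 =
   0. *)
have deg (A : quadLie F) (a b : A) Z : lcs A 6 = 0%VS ->
    qform (foldl (fun u j => lie_br u Z`_j)
      (lie_br (lie_br (lie_br (lie_br b a) Z`_m) Z`_n) Z`_p) s) (lie_br b a) = 0.
  move=> A6; apply: (@qform_lcs _ A (size s + 4) 1).
  - by apply: lcs0_ge A6 _; rewrite -addnA -addnS leq_addl.
  - by apply: foldl_br_lcs; do 4 apply: mem_lcs; apply: memvf.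
  - by apply: mem_lcs; apply: memvf.
by rewrite !deg.
Qed.

(** The Levi-Civita symbol, with m standing for the bracket of the two other generators in cyclic
    order. *)
Definition eps3 (m i j : nat) : F :=
  match m, i, j with
  | 0, 1, 2 | 1, 2, 0 | 2, 0, 1 => 1
  | 0, 2, 1 | 1, 0, 2 | 2, 1, 0 => -1
  | _, _, _ => 0
  end.

Lemma br_eps3 (L : lieAlgebra F) (x0 x1 x2 : L) i j :
  lie_br [:: x0; x1; x2]`_i [:: x0; x1; x2]`_j =
  eps3 0 i j *: lie_br x1 x2 + eps3 1 i j *: lie_br x2 x0
  + eps3 2 i j *: lie_br x0 x1.
Proof.
case: i => [|[|[|i]]]; case: j => [|[|[|j]]]; rewrite /= ?nth_nil ?br0l ?br0r
  ?lie_brxx ?scale0r ?scale1r ?scaleN1r ?add0r ?addr0 // -br_anti //.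
Qed.

(** Products of x_k with words of length one, two and three give the Gram matrix of the generators,
    the volume, and the Gram matrix of the w_i; longer words contribute zero since n^4 = 0. *)
Theorem isometric3 (L M : quadLie F) (x0 x1 x2 : L) (y0 y1 y2 : M) :
  let w0 := lie_br x1 x2 in let w1 := lie_br x2 x0 in let w2 := lie_br x0 x1 in
  let v0 := lie_br y1 y2 in let v1 := lie_br y2 y0 in let v2 := lie_br y0 y1 in
  lcs L 4 = 0%VS -> lcs M 4 = 0%VS ->
  lie_gens [:: x0; x1; x2] -> lie_gens [:: y0; y1; y2] ->
  qform x0 x0 = qform y0 y0 -> qform x0 x1 = qform y0 y1 ->
  qform x0 x2 = qform y0 y2 -> qform x1 x1 = qform y1 y1 ->
  qform x1 x2 = qform y1 y2 -> qform x2 x2 = qform y2 y2 ->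
  qform w0 x0 = qform v0 y0 ->
  qform w0 w0 = qform v0 v0 -> qform w0 w1 = qform v0 v1 ->
  qform w0 w2 = qform v0 v2 -> qform w1 w1 = qform v1 v1 ->
  qform w1 w2 = qform v1 v2 -> qform w2 w2 = qform v2 v2 ->
  isometric L M.
Proof.
move=> w0 w1 w2 v0 v1 v2 L4 M4 gX gY G00 G01 G02 G11 G12 G22 O
  B00 B01 B02 B11 B12 B22.
have wx1 (A : quadLie F) (a b : A) : qform (lie_br a b) a = 0.
  by rewrite br_anti qNl q_brx oppr0.
have wxC (A : quadLie F) (a b c : A) :
    qform (lie_br a b) c = qform (lie_br b c) a.
  by rewrite qform_invariant qformC.
apply: (isometric_words (X := [:: x0; x1; x2]) (Y := [:: y0; y1; y2])) => //;
  try by [exists 3].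
move=> i [|j s] k.
  by case: i => [|[|[|i]]]; case: k => [|[|[|k]]];
    rewrite /word /= ?nth_nil ?q0l ?q0r //; rewrite qformC ?G01 ?G02 ?G12 qformC.
case/lastP: s => [|s l] /=.
  rewrite /word /= !br_eps3 !qDl !qZl.
  (* B([a, b], c) is invariant under cyclic permutations, so one volume fixes all three. *)
  have O1 : qform w1 x1 = qform v1 y1 by rewrite /w1 /v1 2![in LHS]wxC 2![in RHS]wxC.
  have O2 : qform w2 x2 = qform v2 y2 by rewrite /w2 /v2 [LHS]wxC [RHS]wxC.
  by case: k => [|[|[|k]]]; rewrite /= ?nth_nil ?q0r ?q_brx ?wx1 -/w0 -/w1 -/w2
    -/v0 -/v1 -/v2 ?O ?O1 ?O2.
rewrite /word /= -!cats1 !foldl_cat /= !qform_invariant.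
case: s => [|m s] /=.
  rewrite !br_eps3 -/w0 -/w1 -/w2 -/v0 -/v1 -/v2 !qDl !qDr !qZl !qZr.
  rewrite !(qformC w1 w0) !(qformC w2 w0) !(qformC w2 w1).
  rewrite !(qformC v1 v0) !(qformC v2 v0) !(qformC v2 v1).
  by rewrite B00 B01 B02 B11 B12 B22.
have deg (A : quadLie F) (a b c d e : A) Z : lcs A 4 = 0%VS ->
    qform (foldl (fun u j => lie_br u Z`_j) (lie_br (lie_br a b) c) s)
      (lie_br d e) = 0.
  move=> A4; apply: (@qform_lcs _ A (size s + 2) 1).
  - by apply: lcs0_ge A4 _; rewrite -addnA -addnS leq_addl.
  - by apply: foldl_br_lcs; do 2 apply: mem_lcs; apply: memvf.
  - by apply: mem_lcs; apply: memvf.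
by rewrite !deg.
Qed.

End SmallRank.

(** * Elementary changes of generators *)

Section Generators.
Local Open Scope ring_scope.
Variables (F : fieldType) (L : lieAlgebra F).
Implicit Types (x y : L) (X Y : seq L).

Lemma lie_gens_mem X Y : lie_gens X -> {subset X <= Y} -> lie_gens Y.
Proof.
move=> gX XY; apply: (lie_gens_sub gX) => x /XY Yx.
by rewrite -[x]addr0 memv_add ?mem0v ?memv_span.
Qed.

Lemma lie_gens_shift X Y :
  lie_gens X -> size X = size Y ->
  (forall i, Y`_i - X`_i \in lcs L 2) -> lie_gens Y.
Proof.
move=> gX sXY YX; apply: (lie_gens_sub gX) => x Xx.
have := Xx; rewrite -index_mem sXY => ltY.
rewrite -(nth_index 0 Xx); set i := index x X in ltY *.
rewrite -[X`_i](subKr Y`_i) memv_add ?memvN ?YX //.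
exact/memv_span/mem_nth.
Qed.

Lemma lie_gensZ x X c : c != 0 -> lie_gens (x :: X) -> lie_gens (c *: x :: X).
Proof.
move=> c0 gX; apply: (lie_gens_sub gX) => y yX.
apply: subvP (addvSl _ _) _ _; move: yX; rewrite inE => /orP[/eqP->|yX].
  have {1}-> : x = c^-1 *: (c *: x) by rewrite scalerA mulVf // scale1r.
  by rewrite memvZ // memv_span // mem_head.
by rewrite memv_span // inE yX orbT.
Qed.

Lemma lie_gensD x y X a :
  lie_gens (x :: y :: X) -> lie_gens (x + a *: y :: y :: X).
Proof.
move=> gX; apply: (lie_gens_sub gX) => z zX.
apply: subvP (addvSl _ _) _ _; move: zX; rewrite inE => /orP[/eqP->|zX].
  rewrite -{1}[x](addrK (a *: y)) memvB ?memvZ // memv_span //.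
    exact: mem_head.
  by rewrite inE mem_head orbT.
by rewrite memv_span // inE zX orbT.
Qed.

End Generators.

Ltac bilin := rewrite ?(brDl, brDr, brZl, brZr, brNl, brNr, br0l, br0r, lie_brxx)
  ?(qDl, qDr, qZl, qZr, qNl, qNr, q0l, q0r).

(** * Two generators *)

Section RankTwo.
Local Open Scope ring_scope.
Variable R : realType.
Implicit Types L M : quadLie R.

(** Corrections one step deeper do not affect a product of leading terms: each cross term vanishes
    by degree. *)
Lemma qformDlcs L i j u v r s : lcs L (i + j).+2 = 0%VS ->
  u \in lcs L i.+1 -> v \in lcs L j.+1 ->
  r \in lcs L i.+2 -> s \in lcs L j.+2 ->
  qform (u + r) (v + s) = qform u v :> R.
Proof.
move=> L0 ui vj ri sj; rewrite !qDl !qDr.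
rewrite (qform_lcs _ ui sj) ?addnS // (qform_lcs _ ri vj) ?addSn //.
rewrite (qform_lcs _ ri sj) ?addr0 //.
by apply: lcs0_ge L0 _; rewrite addnS addSn !ltnS leqnSn.
Qed.

Definition diag2 L (x0 x1 : L) (e0 e1 : R) :=
  let w := lie_br x1 x0 in
  [/\ lie_gens [:: x0; x1], qform (lie_br w x0) (lie_br w x0) = e0,
      qform (lie_br w x0) (lie_br w x1) = 0
    & qform (lie_br w x1) (lie_br w x1) = e1].

(** When n^6 = 0 the three parameters determine the algebra, by [isometric2]. *)
Definition normal2 L (c e0 e1 : R) := exists x0 x1 : L,
  [/\ diag2 x0 x1 e0 e1, qform (lie_br x1 x0) (lie_br x1 x0) = c,
      qform x0 x0 = 0, qform x0 x1 = 0 & qform x1 x1 = 0].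

Lemma normal2_isometric L M c e0 e1 :
  lcs L 6 = 0%VS -> lcs M 6 = 0%VS ->
  normal2 L c e0 e1 -> normal2 M c e0 e1 -> isometric L M.
Proof.
move=> L6 M6 [x0 [x1 [[gX a00 a01 a11] ac A00 A01 A11]]].
move=> [y0 [y1 [[gY b00 b01 b11] bc B00 B01 B11]]].
by apply: (@isometric2 _ _ _ x0 x1 y0 y1); rewrite // ?(a01, b01); congruence.
Qed.

Lemma diag2_swap L (x0 x1 : L) e0 e1 : diag2 x0 x1 e0 e1 -> diag2 x1 x0 e1 e0.
Proof.
move=> [gX a00 a01 a11]; split; rewrite 1?(br_anti x0 x1); bilin;
  rewrite ?opprK // 1?qformC //.
by apply: lie_gens_mem gX _ => v; rewrite !inE orbC.
Qed.

Lemma diag2_scale L (x0 x1 : L) e0 e1 t0 t1 : t0 != 0 -> t1 != 0 ->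
  diag2 x0 x1 e0 e1 ->
  diag2 (t0 *: x0) (t1 *: x1) (t0 ^+ 4 * t1 ^+ 2 * e0) (t0 ^+ 2 * t1 ^+ 4 * e1).
Proof.
move=> t00 t10 [gX a00 a01 a11]; split; bilin; rewrite ?a00 ?a01 ?a11; try ring.
apply: lie_gensZ => //; have /(lie_gensZ t10) gX' : lie_gens [:: x1; x0].
  by apply: lie_gens_mem gX _ => v; rewrite !inE orbC.
by apply: lie_gens_mem gX' _ => v; rewrite !inE orbC.
Qed.

Lemma diag2_exists L (x0 x1 : L) :
  lie_gens [:: x0; x1] -> exists y0 y1 e0 e1, @diag2 L y0 y1 e0 e1.
Proof.
have pivot (a b : L) : lie_gens [:: a; b] ->
    qform (lie_br (lie_br b a) a) (lie_br (lie_br b a) a) != 0 ->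
    exists y0 y1 e0 e1, @diag2 L y0 y1 e0 e1.
  move=> gab; set q00 := qform _ _ => q0.
  (* Adding a multiple of a to b fixes w = [b, a], so q changes as an ordinary binary form; this t
     clears its off-diagonal entry. *)
  set t := - (qform (lie_br (lie_br b a) a) (lie_br (lie_br b a) b) / q00).
  exists a, (b + t *: a), q00,
    (qform (lie_br (lie_br b a) (b + t *: a)) (lie_br (lie_br b a) (b + t *: a))).
  have e : lie_br (b + t *: a) a = lie_br b a by bilin; rewrite scaler0 addr0.
  split; rewrite ?e //; last by bilin; rewrite -/q00 /t; field.
  have /(lie_gensD t) g' : lie_gens [:: b; a].
    by apply: lie_gens_mem gab _ => v; rewrite !inE orbC.
  by apply: lie_gens_mem g' _ => v; rewrite !inE orbC.
move=> gX; set w := lie_br x1 x0.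
have [q00|] := eqVneq (qform (lie_br w x0) (lie_br w x0)) 0; last exact: pivot.
have gX' : lie_gens [:: x1; x0].
  by apply: lie_gens_mem gX _ => v; rewrite !inE orbC.
have [q11|q11] := eqVneq (qform (lie_br w x1) (lie_br w x1)) 0; last first.
  by apply: (pivot x1 x0) => //; rewrite (br_anti x0 x1); bilin; rewrite opprK.
have [q01|q01] := eqVneq (qform (lie_br w x0) (lie_br w x1)) 0.
  by exists x0, x1, 0, 0.
(* Hyperbolic case: replacing x_0 by x_0 + x_1 keeps w and gives the diagonal entry 2 q_01. *)
apply: (pivot (x0 + 1 *: x1) x1); first exact: lie_gensD.
rewrite scale1r; have -> : lie_br x1 (x0 + x1) = w by bilin; rewrite addr0.
bilin; rewrite q00 q11 [qform (lie_br w x1) _]qformC add0r addr0 -mulr2n.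
by rewrite -mulr_natr mulf_neq0 // pnatr_eq0.
Qed.

(** Intermediate value theorem for X^6 - a^-1 between 0 and a^-1 + 1. *)
Lemma root6 (a : R) : 0 < a -> exists2 t, 0 < t & t ^+ 6 * a = 1.
Proof.
move=> a0; have le0 : (0 : R) <= a^-1 + 1.
  by rewrite addr_ge0 ?ler01 // invr_ge0 ltW.
have [|t /andP[t0 _] /rootP] := @poly_ivt R ('X^6 - (a^-1)%:P) 0 (a^-1 + 1) le0.
  rewrite !hornerE expr0n /= sub0r oppr_le0 invr_ge0 (ltW a0) /=.
  have h1 : 1 <= a^-1 + 1 by rewrite lerDr invr_ge0 ltW.
  rewrite subr_ge0 exprS (le_trans _ (ler_peMr le0 (exprn_ege1 5 h1))) //.
  by rewrite lerDl ler01.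
rewrite !hornerE => /eqP; rewrite subr_eq0 => /eqP t6; exists t.
  rewrite lt_neqAle t0 andbT; apply/eqP => t00.
  by move: t6; rewrite -t00 expr0n /= => /esym/eqP; rewrite invr_eq0 gt_eqF.
by rewrite t6 mulVf // gt_eqF.
Qed.

End RankTwo.

(** * Normal forms for two generators *)

Section RankTwoNormal.
Local Open Scope ring_scope.
Variable R : realType.
Implicit Types L M : quadLie R.

(* q has weight 4 in one generator and 2 in the other, whence sixth roots. *)
Lemma scale2_unit (a b : R) : 0 < a -> 0 < b -> exists t0 t1 : R,
  [/\ t0 != 0, t1 != 0, t0 ^+ 4 * t1 ^+ 2 * a = 1 & t0 ^+ 2 * t1 ^+ 4 * b = 1].
Proof.
move=> a0 b0; have an0 := gt_eqF a0; have bn0 := gt_eqF b0.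
(* Eliminating between the two equations gives t^6 = b / a^2 and s^6 = a / b^2. The equations are
   then verified after taking sixth powers of nonnegative numbers. *)
have [t t_gt0 t6] := root6 (divr_gt0 (exprn_gt0 2 a0) b0).
have [s s_gt0 s6] := root6 (divr_gt0 (exprn_gt0 2 b0) a0).
have t6E : t ^+ 6 = b / a ^+ 2.
  apply: (@mulIf _ (a ^+ 2 / b)); first by rewrite gt_eqF // divr_gt0 ?exprn_gt0.
  by rewrite t6; field; rewrite an0 bn0.
have s6E : s ^+ 6 = a / b ^+ 2.
  apply: (@mulIf _ (b ^+ 2 / a)); first by rewrite gt_eqF // divr_gt0 ?exprn_gt0.
  by rewrite s6; field; rewrite an0 bn0.
exists t, s; split; rewrite ?gt_eqF //; apply/eqP; rewrite -(@pexpr_eq1 _ _ 6) //.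
- have -> : (t ^+ 4 * s ^+ 2 * a) ^+ 6 = (t ^+ 6) ^+ 4 * (s ^+ 6) ^+ 2 * a ^+ 6 by ring.
  rewrite t6E s6E; apply/eqP; field.
  by rewrite an0 bn0.
- by rewrite !mulr_ge0 ?exprn_ge0 // ltW.
- have -> : (t ^+ 2 * s ^+ 4 * b) ^+ 6 = (t ^+ 6) ^+ 2 * (s ^+ 6) ^+ 4 * b ^+ 6 by ring.
  rewrite t6E s6E; apply/eqP; field.
  by rewrite an0 bn0.
- by rewrite !mulr_ge0 ?exprn_ge0 // ltW.
Qed.

Lemma diag2_sign L (x0 x1 : L) e0 e1 :
  diag2 x0 x1 e0 e1 -> exists y0 y1 : L, diag2 y0 y1 (Num.sg e0) (Num.sg e1).
Proof.
move=> d.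
suff [t0 [t1 [t00 t10 E0 E1]]] : exists t0 t1 : R, [/\ t0 != 0, t1 != 0,
    t0 ^+ 4 * t1 ^+ 2 * e0 = Num.sg e0 & t0 ^+ 2 * t1 ^+ 4 * e1 = Num.sg e1].
  by exists (t0 *: x0), (t1 *: x1); rewrite -E0 -E1; apply: diag2_scale.
have sgE (r e : R) : r * `|e| = 1 -> r * e = Num.sg e.
  by move=> re; rewrite {1}[e]numEsg mulrCA re mulr1.
(* If only one entry is nonzero, a square root suffices: the generator entering with exponent 4 is
   left alone. *)
have sqrt1 (e : R) : e != 0 -> exists2 t, t != 0 & t ^+ 2 * `|e| = 1.
  move=> e0'; exists (Num.sqrt `|e|^-1).
    by rewrite gt_eqF // sqrtr_gt0 invr_gt0 normr_gt0.
  by rewrite sqr_sqrtr ?invr_ge0 // mulVf // normr_eq0.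
have [-> | n0] := eqVneq e0 0; have [-> | n1] := eqVneq e1 0.
- by exists 1, 1; rewrite !oner_eq0 sgr0 !mulr0.
- have [t tn0 te] := sqrt1 _ n1; exists t, 1; rewrite tn0 oner_eq0 sgr0 mulr0.
  by split=> //; apply: sgE; rewrite expr1n mulr1.
- have [t tn0 te] := sqrt1 _ n0; exists 1, t; rewrite tn0 oner_eq0 sgr0 mulr0.
  by split=> //; apply: sgE; rewrite expr1n mul1r.
have [||t0 [t1 [t00 t10 E0 E1]]] := @scale2_unit `|e0| `|e1|; rewrite ?normr_gt0 //.
by exists t0, t1; split=> //; apply: sgE.
Qed.

(* Central elements of n^2 dual to the generators can be added to them without
   affecting any bracket; this makes the generators span an isotropic plane. *)
Lemma isotropic2 L (x0 x1 z0 z1 : L) e0 e1 :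
  diag2 x0 x1 e0 e1 -> lie_central z0 -> lie_central z1 ->
  z0 \in lcs L 2 -> z1 \in lcs L 2 ->
  qform z0 x0 = 1 -> qform z0 x1 = 0 -> qform z1 x0 = 0 -> qform z1 x1 = 1 ->
  normal2 L (qform (lie_br x1 x0) (lie_br x1 x0)) e0 e1.
Proof.
move=> [gX a00 a01 a11] c0 c1 z02 z12 Z00 Z01 Z10 Z11.
pose y0 := x0 - ((qform x0 x0 / 2) *: z0 + qform x0 x1 *: z1).
pose y1 := x1 - (qform x1 x1 / 2) *: z1.
have y0E u : lie_br u y0 = lie_br u x0.
  by rewrite /y0; bilin; rewrite (br_anti u z0) (br_anti u z1) c0 c1; bilin;
    rewrite !(oppr0, scaler0, addr0).
have y1E u : lie_br u y1 = lie_br u x1.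
  by rewrite /y1; bilin; rewrite (br_anti u z1) c1; bilin;
    rewrite !(oppr0, scaler0, addr0).
have wE : lie_br y1 y0 = lie_br x1 x0 by rewrite y0E br_anti y1E -br_anti.
have zz u v : lie_central u -> v \in lcs L 2 -> qform u v = 0.
  exact: central_orth.
exists y0, y1; rewrite wE; split=> //; first split; rewrite ?wE ?y0E ?y1E //.
- apply: (lie_gens_shift gX) => // -[|[|i]] /=; rewrite ?nth_nil ?subrr ?mem0v //.
    by rewrite addrC addKr memvN memvD // memvZ.
  by rewrite addrC addKr memvN memvZ.
- rewrite /y0; bilin; rewrite !(qformC x0) !(qformC x1 x0).
  rewrite Z00 Z10 (zz _ _ c0 z02) (zz _ _ c1 z02) (zz _ _ c0 z12) (zz _ _ c1 z12).
  by field.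
- rewrite /y0 /y1; bilin; rewrite !(qformC x0) (qformC x1 x0) Z01 Z11 Z10.
  rewrite (zz _ _ c0 z12) (zz _ _ c1 z12).
  by ring.
- rewrite /y1; bilin; rewrite !(qformC x1) Z11 (zz _ _ c1 z12).
  by field.
Qed.

(** Replacing x_1 by x_1 + t [w, x_0] adds t p to w, and B(p, w) = - e0, B(p, p) = 0; hence t = c /
    (2 e0) cancels c. The entries of q change only by products that vanish because n^6 = 0. *)
Lemma normal2_nonzero L (x0 x1 : L) e0 e1 :
  lcs L 6 = 0%VS -> e0 != 0 -> diag2 x0 x1 e0 e1 -> normal2 L 0 e0 e1.
Proof.
move=> L6 en0 [gX a00 a01 a11].
set w := lie_br x1 x0 in a00 a01 a11.
pose p := lie_br (lie_br w x0) x0.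
have w2 : w \in lcs L 2 by apply/mem_lcs/memvf.
have p4 : p \in lcs L 4 by do 2 apply: mem_lcs.
have pw : qform p w = - e0 by rewrite -a00 [in RHS]q_brr opprK.
pose c := qform w w; pose t := c / (2 * e0).
pose y1 := x1 + t *: lie_br w x0.
have yw : lie_br y1 x0 = w + t *: p by rewrite /y1; bilin.
have d : diag2 x0 y1 e0 e1.
  have L6' : lcs L (2 + 2).+2 = 0%VS by [].
  rewrite /diag2 yw; have -> : lie_br (w + t *: p) x0 = lie_br w x0 + t *: lie_br p x0.
    by bilin.
  have -> : lie_br (w + t *: p) y1 = lie_br w x1
      + (t *: lie_br w (lie_br w x0) + t *: lie_br p y1).
    by rewrite brDl brZl {1}/y1 brDr brZr -addrA.
  have ? : t *: lie_br p x0 \in lcs L 4.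
    by apply/memvZ/(subvP (lcs_decS L 4))/mem_lcs.
  have ? : t *: lie_br w (lie_br w x0) + t *: lie_br p y1 \in lcs L 4.
    apply: memvD; apply: memvZ; first by apply/mem_lcs_r/mem_lcs.
    by apply/(subvP (lcs_decS L 4))/mem_lcs.
  have ? : lie_br w x0 \in lcs L 3 by apply: mem_lcs.
  have ? : lie_br w x1 \in lcs L 3 by apply: mem_lcs.
  split; rewrite ?(qformDlcs L6') //.
  apply: (lie_gens_shift gX) => // -[|[|i]] /=; rewrite ?nth_nil ?subrr ?mem0v //.
  by rewrite /y1 addrC addKr memvZ // (subvP (lcs_decS L 2)).
have pp : qform p p = 0.
  by apply: (@qform_lcs _ L 3 3) => //; apply: lcs0_ge L6 _.
have c0 : qform (lie_br y1 x0) (lie_br y1 x0) = 0.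
  by rewrite yw; bilin; rewrite (qformC w p) pw pp -/c /t; field.
rewrite -c0.
have p'5 u : lie_br p u \in lcs L 5 by apply: mem_lcs.
have cen u : lie_central (lie_br p u).
  by move=> v; apply/eqP; rewrite -memv0 -L6; apply/mem_lcs/p'5.
have sub2 u : lie_br p u \in lcs L 2 by apply: (subvP (lcs_dec L (isT : (2 <= 5)%N))).
have pv : qform p (lie_br y1 x0) = - e0.
  by rewrite yw; bilin; rewrite pw pp mulr0 addr0.
(* Dual elements in n^5: B([p, y1], x0) = B(p, [y1, x0]) = - e0, and the opposite sign for [p, x0]
   with y1. *)
apply: (isotropic2 (z0 := - e0^-1 *: lie_br p y1) (z1 := e0^-1 *: lie_br p x0) d);
  try by [move=> u; rewrite brZl cen scaler0 | rewrite memvZ].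
- by rewrite qZl qform_invariant pv mulrNN mulVf.
- by rewrite qZl q_brx mulr0.
- by rewrite qZl q_brx mulr0.
- by rewrite qZl qform_invariant br_anti qNr pv opprK mulVf.
Qed.

(** With q = 0, the words [w, x_i, x_j, x_k] and then [w, x_i, x_j] are central and orthogonal to
    the generators, hence zero. So each [w, x_i] is central, and c is nonzero, since otherwise
    [w, x_i] and then w would vanish too. *)
Lemma normal2_zero L (x0 x1 : L) :
  lcs L 6 = 0%VS -> ~ lie_abelian L -> diag2 x0 x1 0 0 ->
  normal2 L 1 0 0 \/ normal2 L (-1) 0 0.
Proof.
move=> L6 nab [gX a00 a01 a11].
have nilL : lie_nilpotent L by exists 5.
pose X := [:: x0; x1]; set w := lie_br x1 x0 in a00 a01 a11.
have top u v j k : u = lie_br v X`_j -> qform u X`_k = eps2 R j k * qform v w.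
  by move=> ->; rewrite qform_invariant br_eps2 qZr.
have cen u : (forall j, lie_br u X`_j = 0) -> lie_central u.
  move=> uX; apply: (central_gens nilL gX) => x xX.
  by rewrite -(nth_index 0 xX) uX.
have orth u : lie_central u -> (forall k, qform u X`_k = 0) -> u = 0.
  move=> cu uX; apply: (central_orth0 gX cu) => x xX.
  by rewrite -(nth_index 0 xX) uX.
have w2 : w \in lcs L 2 by apply/mem_lcs/memvf.
have wij i j : qform (lie_br (lie_br w X`_i) X`_j) w = 0.
  rewrite -[LHS]opprK -q_brr.
  case: i => [|[|i]]; case: j => [|[|j]];
    rewrite /= ?nth_nil ?br0r ?q0l ?q0r ?a00 ?a01 ?a11 ?oppr0 // qformC a01 oppr0 //.
have w3 i j k : lie_br (lie_br (lie_br w X`_i) X`_j) X`_k = 0.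
  apply: orth => [u|l]; last by rewrite (top _ _ _ _ erefl) wij mulr0.
  by apply/eqP; rewrite -memv0 -L6; do 4 apply: mem_lcs.
have w2' i j : lie_br (lie_br w X`_i) X`_j = 0.
  apply: orth => [|l]; first by apply: cen => k; apply: w3.
  by rewrite (top _ _ _ _ erefl) br_anti qNl q_brx oppr0 mulr0.
have w1 i : lie_central (lie_br w X`_i) by apply: cen => j; apply: w2'.
pose c := qform w w.
have cn0 : c != 0.
  apply/eqP => c0; apply: nab.
  have w0 i : lie_br w X`_i = 0.
    by apply: orth => // k; rewrite (top _ _ _ _ erefl) -/c c0 mulr0.
  have {}w0 : w = 0.
    apply: orth => [|k]; first exact: cen.
    case: k => [|[|k]]; rewrite /X /= ?nth_nil ?q0r //; first exact: q_brx.
    by rewrite /w br_anti qNl q_brx oppr0.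
  move=> u; rewrite -/(lie_central u); apply: (central_gens nilL gX) => x xX.
  rewrite br_anti; suff -> : lie_br x u = 0 by rewrite oppr0.
  move: u; apply: (central_gens nilL gX) => y yX.
  by rewrite -(nth_index 0 xX) -(nth_index 0 yX) br_eps2 -/w w0 scaler0.
(* Scaling x_0 alone by t multiplies w by t and c by t^2. *)
have [t tn0 tc] : exists2 t : R, t != 0 & t ^+ 2 * c = Num.sg c.
  exists (Num.sqrt `|c|^-1); first by rewrite gt_eqF // sqrtr_gt0 invr_gt0 normr_gt0.
  rewrite sqr_sqrtr ?invr_ge0 // {2}[c]numEsg mulrCA mulVf ?mulr1 //.
  by rewrite normr_eq0.
pose y0 := t *: x0; have yw : lie_br x1 y0 = t *: w by rewrite /y0; bilin.
have d : diag2 y0 x1 0 0.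
  split; rewrite ?yw /y0; bilin; rewrite ?a00 ?a01 ?a11 ?mulr0 //.
  exact: lie_gensZ.
have y1 i : lie_central (lie_br (t *: w) X`_i).
  by move=> u; bilin; rewrite w1 scaler0.
have sub2 i : lie_br (t *: w) X`_i \in lcs L 2.
  by apply/(subvP (lcs_decS L 2))/mem_lcs/memvZ.
have := isotropic2 (z0 := (t ^+ 2 * c)^-1 *: lie_br (t *: w) X`_1)
  (z1 := - (t ^+ 2 * c)^-1 *: lie_br (t *: w) y0) d.
have yw' : qform (t *: w) (t *: w) = Num.sg c by bilin; rewrite -/c -tc; ring.
have cy0 : lie_central (lie_br (t *: w) y0).
  by move=> u; rewrite /y0; bilin; rewrite -[x0]/(X`_0) w1 !scaler0.
rewrite yw yw' => N.
suff : normal2 L (Num.sg c) 0 0.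
  case: (ltrgt0P c) => [/gtr0_sg->|/ltr0_sg->|c0]; [by left | by right |].
  by rewrite c0 eqxx in cn0.
have txw : t ^+ 2 * c != 0 by rewrite mulf_neq0 ?expf_neq0.
apply: N.
- by move=> u; bilin; rewrite -[lie_br (lie_br _ _) _]/(lie_br (lie_br w X`_1) u) w1 !scaler0.
- by move=> u; rewrite brZl cy0 scaler0.
- by rewrite memvZ.
- by rewrite memvZ // (subvP (lcs_decS L 2)) // mem_lcs // memvZ.
- rewrite /y0; bilin; rewrite qform_invariant -/w -/c; field.
  by rewrite tn0 cn0.
- by rewrite qZl q_brx mulr0.
- by rewrite qZl q_brx mulr0.
rewrite /y0; bilin; rewrite qform_invariant (br_anti x0 x1) qNr -/w -/c; field.
by rewrite tn0 cn0.
Qed.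

Theorem rank2_normal_form L :
  lcs L 6 = 0%VS -> lie_type L = 2%N -> ~ lie_abelian L ->
  [\/ normal2 L 1 0 0 \/ normal2 L (-1) 0 0,
      normal2 L 0 1 0 \/ normal2 L 0 (-1) 0,
      normal2 L 0 1 1 \/ normal2 L 0 (-1) (-1)
    | normal2 L 0 1 (-1)].
Proof.
move=> L6 /lie_gens_exists[[|x0 [|x1 [|]]] //= _ gX] nab.
have [y0 [y1 [e0 [e1 d]]]] := diag2_exists gX.
have [u0 [u1 {}d]] := diag2_sign d.
have n1 : (-1 : R) != 0 by rewrite oppr_eq0 oner_eq0.
have d' := diag2_swap d.
case: (sgrP e0) d d' => _ d d'; case: (sgrP e1) d d' => _ d d'.
- by constructor 1; apply: normal2_zero d.
- by constructor 2; left; apply: normal2_nonzero d'; rewrite ?oner_eq0.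
- by constructor 2; right; apply: normal2_nonzero d'.
- by constructor 2; left; apply: normal2_nonzero d; rewrite ?oner_eq0.
- by constructor 3; left; apply: normal2_nonzero d; rewrite ?oner_eq0.
- by constructor 4; apply: normal2_nonzero d; rewrite ?oner_eq0.
- by constructor 2; right; apply: normal2_nonzero d.
- by constructor 4; apply: normal2_nonzero d'; rewrite ?oner_eq0.
- by constructor 3; right; apply: normal2_nonzero d.
Qed.

End RankTwoNormal.

(** * Three generators *)

Section RankThree.
Local Open Scope ring_scope.
Variable R : realType.
Implicit Types L M : quadLie R.

Definition diag3 L (x0 x1 x2 : L) (e0 e1 e2 : R) :=
  let w0 := lie_br x1 x2 in let w1 := lie_br x2 x0 in let w2 := lie_br x0 x1 in
  lie_gens [:: x0; x1; x2] /\
  [/\ qform w0 w0 = e0, qform w1 w1 = e1, qform w2 w2 = e2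
    & [/\ qform w0 w1 = 0, qform w0 w2 = 0 & qform w1 w2 = 0]].

(** Here o is the volume, and g differs from 0 only in the rank one case, where x_0 spans an
    orthogonal line. *)
Definition normal3 L (g o e0 e1 e2 : R) := exists x0 x1 x2 : L,
  [/\ diag3 x0 x1 x2 e0 e1 e2, qform (lie_br x1 x2) x0 = o,
      [/\ qform x0 x0 = g, qform x1 x1 = 0 & qform x2 x2 = 0]
    & [/\ qform x0 x1 = 0, qform x0 x2 = 0 & qform x1 x2 = 0]].

Lemma normal3_isometric L M g o e0 e1 e2 :
  lcs L 4 = 0%VS -> lcs M 4 = 0%VS ->
  normal3 L g o e0 e1 e2 -> normal3 M g o e0 e1 e2 -> isometric L M.
Proof.
move=> L4 M4 [x0 [x1 [x2 [[gX [a00 a11 a22 [a01 a02 a12]]] ao [A00 A11 A22] [A01 A02 A12]]]]].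
move=> [y0 [y1 [y2 [[gY [b00 b11 b22 [b01 b02 b12]]] bo [B00 B11 B22] [B01 B02 B12]]]]].
by apply: (@isometric3 _ _ _ x0 x1 x2 y0 y1 y2) => //;
  (eapply etrans; [eassumption | apply/esym; eassumption]).
Qed.

Lemma lie_gens_rot L (x0 x1 x2 : L) :
  lie_gens [:: x0; x1; x2] -> lie_gens [:: x1; x2; x0].
Proof.
move=> gX; apply: lie_gens_mem gX _ => v; rewrite !inE.
by case/or3P=> ->; rewrite ?orbT.
Qed.

Lemma lie_gens_swap L (x0 x1 x2 : L) :
  lie_gens [:: x0; x1; x2] -> lie_gens [:: x1; x0; x2].
Proof.
move=> gX; apply: lie_gens_mem gX _ => v; rewrite !inE.
by case/or3P=> ->; rewrite ?orbT.
Qed.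

Lemma diag3_rot L (x0 x1 x2 : L) e0 e1 e2 :
  diag3 x0 x1 x2 e0 e1 e2 -> diag3 x1 x2 x0 e1 e2 e0.
Proof.
move=> [gX [a00 a11 a22 [a01 a02 a12]]]; split; first exact: lie_gens_rot.
by split=> //; split=> //; rewrite qformC.
Qed.

Lemma diag3_swap L (x0 x1 x2 : L) e0 e1 e2 :
  diag3 x0 x1 x2 e0 e1 e2 -> diag3 x1 x0 x2 e1 e0 e2.
Proof.
move=> [gX [a00 a11 a22 [a01 a02 a12]]]; split; first exact: lie_gens_swap.
by rewrite (br_anti x0 x2) (br_anti x2 x1) (br_anti x1 x0); bilin;
  rewrite !opprK; split=> //; split=> //; rewrite qformC.
Qed.

Lemma diag3_scale L (x0 x1 x2 : L) e0 e1 e2 t0 t1 t2 :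
  t0 != 0 -> t1 != 0 -> t2 != 0 -> diag3 x0 x1 x2 e0 e1 e2 ->
  diag3 (t0 *: x0) (t1 *: x1) (t2 *: x2)
    ((t1 * t2) ^+ 2 * e0) ((t2 * t0) ^+ 2 * e1) ((t0 * t1) ^+ 2 * e2).
Proof.
move=> t00 t10 t20 [gX [a00 a11 a22 [a01 a02 a12]]]; split.
  by do 3! apply: lie_gens_rot; do 3! [apply: lie_gensZ => //; apply: lie_gens_rot].
by split; last split; bilin; rewrite ?a00 ?a11 ?a22 ?a01 ?a02 ?a12; ring.
Qed.

(** Gram-Schmidt on w_1 and w_2: replacing x_1 by x_1 + c x_2 keeps w_0 and w_1 and turns w_2 into
    w_2 - c w_1. *)
Lemma diag3_pivot2 L (x0 x1 x2 : L) :
  let w0 := lie_br x1 x2 in let w1 := lie_br x2 x0 in let w2 := lie_br x0 x1 in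
  lie_gens [:: x0; x1; x2] -> qform w0 w1 = 0 -> qform w0 w2 = 0 ->
  qform w1 w1 != 0 -> exists y0 y1 y2 e0 e1 e2, @diag3 L y0 y1 y2 e0 e1 e2.
Proof.
move=> w0 w1 w2 gX a01 a02 n11; pose c := qform w1 w2 / qform w1 w1.
pose y1 := x1 + c *: x2.
have e0 : lie_br y1 x2 = w0 by rewrite brDl brZl lie_brxx scaler0 addr0.
have e2 : lie_br x0 y1 = w2 - c *: w1.
  by rewrite brDr brZr (br_anti x0 x2) scalerN.
exists x0, y1, x2, (qform w0 w0), (qform w1 w1), (qform (w2 - c *: w1) (w2 - c *: w1)).
split; last rewrite e0 e2 -/w1; last split=> //; last split=> //.
- by apply/lie_gens_rot/lie_gens_rot/lie_gensD/lie_gens_rot.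
- by rewrite qDr qNr qZr a01 a02 mulr0 subr0.
by rewrite qDr qNr qZr /c; field.
Qed.

Lemma diag3_pivot L (x0 x1 x2 : L) :
  lie_gens [:: x0; x1; x2] -> qform (lie_br x1 x2) (lie_br x1 x2) != 0 ->
  exists y0 y1 y2 e0 e1 e2, @diag3 L y0 y1 y2 e0 e1 e2.
Proof.
move=> gX n00.
(* Adding multiples of x_1 and x_2 to x_0 keeps w_0 and subtracts multiples of w_0 from w_1 and
   w_2. *)
pose y0 := (x0 + (qform (lie_br x1 x2) (lie_br x2 x0) / qform (lie_br x1 x2) (lie_br x1 x2)) *: x1)
  + (qform (lie_br x1 x2) (lie_br x0 x1) / qform (lie_br x1 x2) (lie_br x1 x2)) *: x2.
have gY : lie_gens [:: y0; x1; x2].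
  apply/lie_gens_rot/lie_gens_swap/lie_gensD.
  by apply/lie_gens_swap/lie_gens_rot/lie_gens_rot/lie_gensD.
have a01 : qform (lie_br x1 x2) (lie_br x2 y0) = 0.
  by rewrite /y0 !brDr !brZr lie_brxx (br_anti x2 x1); bilin; field.
have a02 : qform (lie_br x1 x2) (lie_br y0 x1) = 0.
  by rewrite /y0 !brDl !brZl lie_brxx (br_anti x2 x1); bilin; field.
clearbody y0; set w1 := lie_br x2 y0; set w2 := lie_br y0 x1.
have [n11|] := eqVneq (qform w1 w1) 0; last exact: (@diag3_pivot2 _ y0 x1 x2).
have [n12|n12] := eqVneq (qform w1 w2) 0.
  by exists y0, x1, x2, (qform (lie_br x1 x2) (lie_br x1 x2)), (qform w1 w1),
    (qform w2 w2).
have [n22|n22] := eqVneq (qform w2 w2) 0; last first.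
  apply: (@diag3_pivot2 _ y0 x2 x1).
  - by apply/lie_gens_rot/lie_gens_swap.
  - by rewrite (br_anti x2 x1) (br_anti x1 y0); bilin; rewrite opprK.
  - by rewrite (br_anti x2 x1) (br_anti y0 x2); bilin; rewrite opprK.
  - by rewrite (br_anti x1 y0); bilin; rewrite opprK.
(* Here w_1 and w_2 are isotropic but not orthogonal. Replacing x_2 by x_2 + x_1 turns w_1 into w_1
   - w_2, whose square is -2 B(w_1, w_2). *)
apply: (@diag3_pivot2 _ y0 x1 (x2 + 1 *: x1)).
- apply/lie_gens_rot/lie_gens_swap/lie_gens_rot/lie_gens_rot/lie_gensD.
  exact/lie_gens_rot/lie_gens_rot/lie_gens_swap.
- rewrite scale1r; bilin; rewrite (br_anti x1 y0); bilin.
  by rewrite -/w1 -/w2 a01 a02; ring.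
- by rewrite scale1r; bilin; rewrite -/w2 a02; ring.
rewrite scale1r brDl (br_anti x1 y0) -/w1 -/w2; bilin.
rewrite n11 n22 (qformC w2) (_ : _ + _ = - 2 * qform w1 w2); last by ring.
by rewrite mulf_neq0 // oppr_eq0 pnatr_eq0.
Qed.

Lemma diag3_exists L (x0 x1 x2 : L) :
  lie_gens [:: x0; x1; x2] ->
  exists y0 y1 y2 e0 e1 e2, @diag3 L y0 y1 y2 e0 e1 e2.
Proof.
(* If w_0 and w_1 are isotropic but not orthogonal, replacing y_0 by y_0 + y_1 yields the
   anisotropic bracket w_1 - w_0. *)
have pivot01 (y0 y1 y2 : L) : lie_gens [:: y0; y1; y2] ->
    qform (lie_br y1 y2) (lie_br y1 y2) = 0 ->
    qform (lie_br y2 y0) (lie_br y2 y0) = 0 ->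
    qform (lie_br y1 y2) (lie_br y2 y0) != 0 ->
    exists y0 y1 y2 e0 e1 e2, @diag3 L y0 y1 y2 e0 e1 e2.
  move=> gY a00 a11 n01.
  apply: (@diag3_pivot _ y1 y2 (y0 + 1 *: y1)).
    by apply/lie_gens_rot/lie_gensD.
  rewrite scale1r brDr (br_anti y2 y1); bilin.
  rewrite a00 a11 (qformC (lie_br y2 y0)).
  rewrite (_ : _ + _ = - 2 * qform (lie_br y1 y2) (lie_br y2 y0)); last by ring.
  by rewrite mulf_neq0 // oppr_eq0 pnatr_eq0.
move=> gX; set w0 := lie_br x1 x2; set w1 := lie_br x2 x0; set w2 := lie_br x0 x1.
have gX1 := lie_gens_rot gX; have gX2 := lie_gens_rot gX1.
have [a00|] := eqVneq (qform w0 w0) 0; last exact: (@diag3_pivot _ x0 x1 x2).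
have [a11|] := eqVneq (qform w1 w1) 0; last exact: (@diag3_pivot _ x1 x2 x0).
have [a22|] := eqVneq (qform w2 w2) 0; last exact: (@diag3_pivot _ x2 x0 x1).
have [a01|n01] := eqVneq (qform w0 w1) 0; last exact: (pivot01 x0 x1 x2).
have [a12|n12] := eqVneq (qform w1 w2) 0; last exact: (pivot01 x1 x2 x0).
have [a20|n20] := eqVneq (qform w2 w0) 0; last exact: (pivot01 x2 x0 x1).
exists x0, x1, x2, 0, 0, 0; split=> //; split=> //; split=> //.
by rewrite qformC.
Qed.

Lemma diag3_sign L (x0 x1 x2 : L) e0 e1 e2 : diag3 x0 x1 x2 e0 e1 e2 ->
  exists y0 y1 y2 : L, diag3 y0 y1 y2 (Num.sg e0) (Num.sg e1) (Num.sg e2).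
Proof.
move=> d.
have unit (e : R) : exists2 s, 0 < s & s ^+ 2 * e = Num.sg e.
  have [->|n0] := eqVneq e 0; first by exists 1; rewrite ?ltr01 // sgr0 mulr0.
  exists (Num.sqrt `|e|^-1); first by rewrite sqrtr_gt0 invr_gt0 normr_gt0.
  rewrite sqr_sqrtr ?invr_ge0 // {2}[e]numEsg mulrCA mulVf ?mulr1 //.
  by rewrite normr_eq0.
have [s0 p0 E0] := unit e0; have [s1 p1 E1] := unit e1.
have [s2 p2 E2] := unit e2.
(* The conditions t_1 t_2 = s_0, t_2 t_0 = s_1, t_0 t_1 = s_2 are solved by t_0 = sqrt (s_1 s_2 /
   s_0) and its cyclic shifts. *)
have sq (a b c : R) : 0 < a -> 0 < b -> 0 < c ->
  Num.sqrt (a * b / c) != 0 /\ Num.sqrt (a * b / c) ^+ 2 = a * b / c.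
  move=> a0 b0 c0; have abc : 0 < a * b / c by rewrite divr_gt0 ?mulr_gt0.
  by rewrite sqr_sqrtr ?ltW // gt_eqF // sqrtr_gt0.
have [t00 T0] := sq _ _ _ p1 p2 p0; have [t10 T1] := sq _ _ _ p2 p0 p1.
have [t20 T2] := sq _ _ _ p0 p1 p2.
have := diag3_scale t00 t10 t20 d; rewrite !exprMn T0 T1 T2.
rewrite (_ : s2 * s0 / s1 * (s0 * s1 / s2) * e0 = Num.sg e0); last first.
  by rewrite -E0; field; rewrite !gt_eqF.
rewrite (_ : s0 * s1 / s2 * (s1 * s2 / s0) * e1 = Num.sg e1); last first.
  by rewrite -E1; field; rewrite !gt_eqF.
rewrite (_ : s1 * s2 / s0 * (s2 * s0 / s1) * e2 = Num.sg e2); last first.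
  by rewrite -E2; field; rewrite !gt_eqF.
by move=> {}d; do 3! eexists; exact: d.
Qed.

(* Adding a multiple of [x_1, x_2] to x_0 changes the volume and, up to n^3,
   none of the three brackets. *)
Lemma omega3_zero L (x0 x1 x2 : L) e0 e1 e2 :
  lcs L 4 = 0%VS -> e0 != 0 -> diag3 x0 x1 x2 e0 e1 e2 ->
  exists2 y0 : L, diag3 y0 x1 x2 e0 e1 e2 & qform (lie_br x1 x2) y0 = 0.
Proof.
move=> L4 n0 [gX [a00 a11 a22 [a01 a02 a12]]].
set w0 := lie_br x1 x2 in a00 a01 a02.
set w1 := lie_br x2 x0 in a01 a11 a12.
set w2 := lie_br x0 x1 in a02 a12 a22.
pose t := - (qform w0 x0 / e0); pose y0 := x0 + t *: w0.
have m2 (u v : L) : lie_br u v \in lcs L 2 by apply/mem_lcs/memvf.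
have e1' : lie_br x2 y0 = w1 + t *: lie_br x2 w0 by rewrite brDr brZr.
have e2' : lie_br y0 x1 = w2 + t *: lie_br w0 x1 by rewrite brDl brZl.
have r1 : t *: lie_br x2 w0 \in lcs L 3 by apply/memvZ/mem_lcs_r/m2.
have r2 : t *: lie_br w0 x1 \in lcs L 3 by apply/memvZ/mem_lcs/m2.
have L4' : lcs L (1 + 1).+2 = 0%VS by [].
have q0 v s : v \in lcs L 2 -> s \in lcs L 3 -> qform w0 (v + s) = qform w0 v.
  by move=> v2 s3; rewrite -{1}[w0]addr0 (qformDlcs L4') ?mem0v ?m2.
exists y0; last by rewrite qDr qZr a00 /t; field.
split; last first.
  rewrite -/w0 e1' e2'; split; rewrite ?(qformDlcs L4') ?m2 //; split;
  by rewrite ?q0 ?(qformDlcs L4') ?m2.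
apply: (lie_gens_shift gX) => // -[|[|[|i]]] /=; rewrite ?nth_nil ?subrr ?mem0v //.
by rewrite /y0 addrC addKr memvZ ?m2.
Qed.

(** The z_i are dual to the x_i and, being central and in n^2, orthogonal to each other. A mixed
    product is removed by correcting the earlier of the two generators only, a square by half of
    itself; brackets and volume are unaffected. *)
Lemma isotropic3 L (x0 x1 x2 z0 z1 z2 : L) e0 e1 e2 :
  diag3 x0 x1 x2 e0 e1 e2 ->
  [/\ lie_central z0, lie_central z1 & lie_central z2] ->
  [/\ z0 \in lcs L 2, z1 \in lcs L 2 & z2 \in lcs L 2] ->
  [/\ qform z0 x0 = 1, qform z0 x1 = 0 & qform z0 x2 = 0] ->
  [/\ qform z1 x0 = 0, qform z1 x1 = 1 & qform z1 x2 = 0] ->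
  [/\ qform z2 x0 = 0, qform z2 x1 = 0 & qform z2 x2 = 1] ->
  normal3 L 0 (qform (lie_br x1 x2) x0) e0 e1 e2.
Proof.
move=> [gX d] [c0 c1 c2] [m0 m1 m2] [Z00 Z01 Z02] [Z10 Z11 Z12] [Z20 Z21 Z22].
pose s0 := (qform x0 x0 / 2) *: z0 + qform x0 x1 *: z1 + qform x0 x2 *: z2.
pose s1 := (qform x1 x1 / 2) *: z1 + qform x1 x2 *: z2.
pose s2 := (qform x2 x2 / 2) *: z2.
have cD (u v : L) a b : lie_central u -> lie_central v -> lie_central (a *: u + b *: v).
  by move=> cu cv w; rewrite brDl !brZl cu cv !scaler0 addr0.
have cen2 : lie_central s2 by rewrite -[s2]addr0 -[0](scale0r z2); apply: cD.
have cen1 : lie_central s1 by apply: cD.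
have cen0 : lie_central s0.
  move=> u; rewrite /s0 -[X in X + _]scale1r.
  exact: (cD _ _ 1 (qform x0 x2) (cD _ _ _ _ c0 c1) c2).
have sE (x y u v : L) : lie_central u -> lie_central v ->
    lie_br (x - u) (y - v) = lie_br x y.
  move=> cu cv; rewrite brDl brNl cu oppr0 addr0 brDr brNr (br_anti x v) cv.
  by rewrite !oppr0 addr0.
have zz u v : lie_central u -> v \in lcs L 2 -> qform u v = 0.
  exact: central_orth.
exists (x0 - s0), (x1 - s1), (x2 - s2); rewrite /diag3 !sE //; split.
- split=> //; apply: (lie_gens_shift gX) => // -[|[|[|i]]] /=.
  + by rewrite addrC addKr memvN !memvD ?memvZ.
  + by rewrite addrC addKr memvN !memvD ?memvZ.
  + by rewrite addrC addKr memvN memvZ.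
  + by rewrite subrr mem0v.
- rewrite qDr qNr [qform _ s0]qformC (zz s0) ?subr0 //.
  exact/mem_lcs/memvf.
- split; rewrite /s0 /s1 /s2; bilin;
    rewrite ?(qformC x0 z0) ?(qformC x0 z1) ?(qformC x0 z2)
      ?(qformC x1 z0) ?(qformC x1 z1) ?(qformC x1 z2)
      ?(qformC x2 z0) ?(qformC x2 z1) ?(qformC x2 z2)
      ?Z00 ?Z01 ?Z02 ?Z10 ?Z11 ?Z12 ?Z20 ?Z21 ?Z22
      ?(zz _ _ c0 m0) ?(zz _ _ c0 m1) ?(zz _ _ c0 m2)
      ?(zz _ _ c1 m0) ?(zz _ _ c1 m1) ?(zz _ _ c1 m2)
      ?(zz _ _ c2 m0) ?(zz _ _ c2 m1) ?(zz _ _ c2 m2); by field.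
- split; rewrite /s0 /s1 /s2; bilin;
    rewrite ?(qformC x0 z0) ?(qformC x0 z1) ?(qformC x0 z2)
      ?(qformC x1 z0) ?(qformC x1 z1) ?(qformC x1 z2)
      ?(qformC x2 z0) ?(qformC x2 z1) ?(qformC x2 z2)
      ?Z00 ?Z01 ?Z02 ?Z10 ?Z11 ?Z12 ?Z20 ?Z21 ?Z22
      ?(zz _ _ c0 m0) ?(zz _ _ c0 m1) ?(zz _ _ c0 m2)
      ?(zz _ _ c1 m0) ?(zz _ _ c1 m1) ?(zz _ _ c1 m2)
      ?(zz _ _ c2 m0) ?(zz _ _ c2 m1) ?(zz _ _ c2 m2); by ring.
Qed.

End RankThree.

(** * Normal forms for three generators *)

Section RankThreeNormal.
Local Open Scope ring_scope.
Variable R : realType.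
Implicit Types L M : quadLie R.

(** The elements [w_1, x_2], [w_0, x_2], [w_0, x_1] are central because n^4 = 0, and up to the
    factors e1, - e0, e0 they are dual to x_0, x_1, x_2. *)
Lemma normal3_nondegenerate L (x0 x1 x2 : L) e0 e1 e2 :
  lcs L 4 = 0%VS -> e0 != 0 -> e1 != 0 -> diag3 x0 x1 x2 e0 e1 e2 ->
  normal3 L 0 0 e0 e1 e2.
Proof.
move=> L4 n0 n1 /(omega3_zero L4 n0)[y0 d o0].
have [_ [a00 a11 _ [a01 a02 _]]] := d.
have cen (u v w : L) : lie_central (lie_br (lie_br u v) w).
  by move=> x; apply/eqP; rewrite -memv0 -L4; do 3 apply: mem_lcs; apply: memvf.
have m2 (u v : L) : lie_br u v \in lcs L 2 by apply/mem_lcs/memvf.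
have := isotropic3 (z0 := e1^-1 *: lie_br (lie_br x2 y0) x2)
  (z1 := - e0^-1 *: lie_br (lie_br x1 x2) x2)
  (z2 := e0^-1 *: lie_br (lie_br x1 x2) x1) d.
rewrite o0; apply; first 1 last.
- by split; apply: memvZ.
- split; rewrite qZl ?q_brx ?mulr0 // qform_invariant ?a11 ?mulVf //.
  by rewrite (br_anti x2 x1) qNr qformC a01 oppr0 mulr0.
- split; rewrite qZl ?q_brx ?mulr0 // qform_invariant ?a01 ?mulr0 //.
  by rewrite (br_anti x2 x1) qNr a00 mulrNN mulVf.
- split; rewrite qZl ?q_brx ?mulr0 // qform_invariant ?a00 ?mulVf //.
  by rewrite (br_anti x1 y0) qNr a02 oppr0 mulr0.
by split=> u; rewrite brZl cen scaler0.
Qed.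

(** Each [w, x_i] lies in n^3, so it is central, and B([w, x_i], x_j) = B(w, [x_i, x_j]) = 0 makes
    it vanish. *)
Lemma diag3_radical L (x0 x1 x2 w : L) :
  lcs L 4 = 0%VS -> lie_gens [:: x0; x1; x2] -> w \in lcs L 2 ->
  [/\ qform w (lie_br x1 x2) = 0, qform w (lie_br x2 x0) = 0
    & qform w (lie_br x0 x1) = 0] -> lie_central w.
Proof.
move=> L4 gX w2 [a0 a1 a2]; have nilL : lie_nilpotent L by exists 3.
apply: (central_gens nilL gX) => x xX.
apply: (central_orth0 gX) => [u|y yX].
  by apply/eqP; rewrite -memv0 -L4; do 2 apply: mem_lcs.
rewrite -(nth_index 0 xX) -(nth_index 0 yX) qform_invariant br_eps3.
by rewrite !qDr !qZr a0 a1 a2 !mulr0 !addr0.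
Qed.

Lemma lie_abelian_gens3 L (x0 x1 x2 : L) :
  lie_nilpotent L -> lie_gens [:: x0; x1; x2] ->
  lie_br x1 x2 = 0 -> lie_br x2 x0 = 0 -> lie_br x0 x1 = 0 -> lie_abelian L.
Proof.
move=> nilL gX w0 w1 w2 u; rewrite -/(lie_central u).
apply: (central_gens nilL gX) => x xX; rewrite br_anti.
suff -> : lie_br x u = 0 by rewrite oppr0.
move: u; apply: (central_gens nilL gX) => y yX.
rewrite -(nth_index 0 xX) -(nth_index 0 yX) br_eps3 w0 w1 w2.
by rewrite !scaler0 !addr0.
Qed.

(** All w_i are central, and the volume o is nonzero, since otherwise they would vanish. Scaling x_0
    by o^-1 normalises the volume together with its sign, which is why n_{3,2} is listed with one
    sign only. The w_i themselves supply the dual central elements. *)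
Lemma normal3_zero L (x0 x1 x2 : L) :
  lcs L 4 = 0%VS -> ~ lie_abelian L -> diag3 x0 x1 x2 0 0 0 ->
  normal3 L 0 1 0 0 0.
Proof.
move=> L4 nab d; have [gX [a00 a11 a22 [a01 a02 a12]]] := d.
have m2 (u v : L) : lie_br u v \in lcs L 2 by apply/mem_lcs/memvf.
have c0 : lie_central (lie_br x1 x2) by apply: diag3_radical gX _ _.
have c1 : lie_central (lie_br x2 x0).
  by apply: diag3_radical gX _ _ => //; split=> //; rewrite qformC.
have c2 : lie_central (lie_br x0 x1).
  by apply: diag3_radical gX _ _ => //; split=> //; rewrite qformC.
have wx1 (a b : L) : qform (lie_br a b) a = 0.
  by rewrite br_anti qNl q_brx oppr0.
have wxC (a b c : L) : qform (lie_br a b) c = qform (lie_br b c) a.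
  by rewrite qform_invariant qformC.
pose o := qform (lie_br x1 x2) x0.
have on0 : o != 0.
  apply/eqP => o0; apply: nab; have nilL : lie_nilpotent L by exists 3.
  have orth w : lie_central w -> qform w x0 = 0 -> qform w x1 = 0 ->
      qform w x2 = 0 -> w = 0.
    move=> cw ? ? ?; apply: (central_orth0 gX cw) => x; rewrite !inE.
    by case/or3P=> /eqP->.
  apply: (lie_abelian_gens3 nilL gX); apply: orth; rewrite ?q_brx ?wx1 //.
    by rewrite wxC wxC.
  by rewrite wxC.
pose y0 := o^-1 *: x0.
have dy : diag3 y0 x1 x2 0 0 0.
  have := @diag3_scale _ _ _ _ _ _ _ _ o^-1 1 1 _ _ _ d.
  by rewrite !scale1r !mulr0; apply; rewrite ?invr_eq0 ?oner_eq0.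
have y0w : qform (lie_br x1 x2) y0 = 1 by rewrite qZr mulVf.
have := isotropic3 (z0 := lie_br x1 x2) (z1 := o^-1 *: lie_br x2 x0)
  (z2 := o^-1 *: lie_br x0 x1) dy.
rewrite y0w; apply; split; rewrite ?memvZ ?m2 //.
- by move=> u; rewrite brZl c1 scaler0.
- by move=> u; rewrite brZl c2 scaler0.
- exact: q_brx.
- by rewrite qZl qZr q_brx !mulr0.
- by rewrite qZl wxC wxC mulVf.
- by rewrite qZl wx1 mulr0.
- by rewrite qZl qZr wx1 !mulr0.
- by rewrite qZl q_brx mulr0.
- by rewrite qZl wxC mulVf.
Qed.

(* Here x_0 becomes central; were it isotropic it would vanish, and two
   generators would suffice. *)
Lemma normal3_rank1 L (x0 x1 x2 : L) e0 :
  lcs L 4 = 0%VS -> lie_type L = 3%N -> e0 != 0 -> diag3 x0 x1 x2 e0 0 0 ->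
  exists s : bool, normal3 L ((-1) ^+ s) 0 e0 0 0.
Proof.
move=> L4 type3 n0 /(omega3_zero L4 n0)[{}x0 d o0].
have [gX [a00 a11 a22 [a01 a02 a12]]] := d.
have nilL : lie_nilpotent L by exists 3.
have m2 (u v : L) : lie_br u v \in lcs L 2 by apply/mem_lcs/memvf.
have wx1 (a b : L) : qform (lie_br a b) a = 0.
  by rewrite br_anti qNl q_brx oppr0.
have wxC (a b c : L) : qform (lie_br a b) c = qform (lie_br b c) a.
  by rewrite qform_invariant qformC.
have orth (Y : seq L) w : lie_gens Y -> lie_central w ->
    {in Y, forall y, qform w y = 0} -> w = 0.
  by move=> gY cw; apply: central_orth0.
(* This bracket lies in the radical of the Gram matrix, so it is central; the volume is zero, so it
   is orthogonal to the generators. *)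
have w1 : lie_br x2 x0 = 0.
  apply: (orth _ _ gX).
    by apply: diag3_radical gX _ _ => //; split=> //; rewrite qformC.
  move=> x; rewrite !inE => /or3P[] /eqP->; rewrite ?q_brx ?wx1 //.
  by rewrite wxC wxC.
have w2 : lie_br x0 x1 = 0.
  apply: (orth _ _ gX).
    by apply: diag3_radical gX _ _ => //; split=> //; rewrite qformC.
  move=> x; rewrite !inE => /or3P[] /eqP->; rewrite ?q_brx ?wx1 //.
  by rewrite wxC.
pose z1 := - e0^-1 *: lie_br (lie_br x1 x2) x2.
pose z2 := e0^-1 *: lie_br (lie_br x1 x2) x1.
have cen (a : R) (u v w : L) : lie_central (a *: lie_br (lie_br u v) w).
  move=> x; rewrite brZl; apply/eqP; rewrite scaler_eq0; apply/orP; right.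
  by rewrite -memv0 -L4; do 3 apply: mem_lcs; apply: memvf.
have c1 : lie_central z1 by apply: cen.
have c2 : lie_central z2 by apply: cen.
have z1m : z1 \in lcs L 2 by apply/memvZ/m2.
have z2m : z2 \in lcs L 2 by apply/memvZ/m2.
have cx0 : lie_central x0.
  apply: (central_gens nilL gX) => x; rewrite !inE => /or3P[] /eqP->.
  - exact: lie_brxx.
  - exact: w2.
  - by rewrite br_anti w1 oppr0.
have Z10 : qform z1 x0 = 0 by rewrite qZl qform_invariant a01 mulr0.
have Z11 : qform z1 x1 = 1.
  by rewrite qZl qform_invariant (br_anti x2 x1) qNr a00 mulrNN mulVf.
have Z12 : qform z1 x2 = 0 by rewrite qZl q_brx mulr0.
have Z20 : qform z2 x0 = 0.
  by rewrite qZl qform_invariant (br_anti x1 x0) qNr a02 oppr0 mulr0.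
have Z21 : qform z2 x1 = 0 by rewrite qZl q_brx mulr0.
have Z22 : qform z2 x2 = 1 by rewrite qZl qform_invariant a00 mulVf.
have zz u v : lie_central u -> v \in lcs L 2 -> qform u v = 0.
  exact: central_orth.
clearbody z1 z2.
(* As x_0 is central it is orthogonal to n^2, so nothing in n^2 is dual to it: only its products
   with x_1 and x_2 are removed, and its square survives as g. *)
pose y0 := x0 - (qform x0 x1 *: z1 + qform x0 x2 *: z2).
pose y1 := x1 - ((qform x1 x1 / 2) *: z1 + qform x1 x2 *: z2).
pose y2 := x2 - (qform x2 x2 / 2) *: z2.
have cD (u v : L) a b : lie_central u -> lie_central v -> lie_central (a *: u + b *: v).
  by move=> cu cv w; rewrite brDl !brZl cu cv !scaler0 addr0.
have cy0 : lie_central y0.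
  move=> u; rewrite /y0 -scaleN1r -[x0]scale1r; move: u.
  by apply: (cD) => //; apply: (cD).
have gY : lie_gens [:: y0; y1; y2].
  apply: (lie_gens_shift gX) => // -[|[|[|i]]] /=.
  - by rewrite addrC addKr memvN !memvD ?memvZ.
  - by rewrite addrC addKr memvN !memvD ?memvZ.
  - by rewrite addrC addKr memvN memvZ.
  - by rewrite subrr mem0v.
have sE (x y u v : L) : lie_central u -> lie_central v ->
    lie_br (x - u) (y - v) = lie_br x y.
  move=> cu cv; rewrite brDl brNl cu oppr0 addr0 brDr brNr (br_anti x v) cv.
  by rewrite !oppr0 addr0.
have yw : lie_br y1 y2 = lie_br x1 x2.
  apply: sE; first exact: (cD).
  by move=> u; rewrite brZl c2 scaler0.
have eval := (qformC x0 z1, qformC x0 z2, qformC x1 z1, qformC x1 z2,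
  qformC x2 z1, qformC x2 z2, qformC x1 x0, qformC x2 x0, qformC x2 x1,
  (Z10, Z11, Z12, Z20, Z21, Z22),
  (zz _ _ c1 z1m, zz _ _ c1 z2m, zz _ _ c2 z1m, zz _ _ c2 z2m)).
have G01 : qform y0 y1 = 0 by rewrite /y0 /y1; bilin; rewrite !eval; field.
have G02 : qform y0 y2 = 0 by rewrite /y0 /y2; bilin; rewrite !eval; field.
have G11 : qform y1 y1 = 0 by rewrite /y1; bilin; rewrite !eval; field.
have G12 : qform y1 y2 = 0 by rewrite /y1 /y2; bilin; rewrite !eval; field.
have G22 : qform y2 y2 = 0 by rewrite /y2; bilin; rewrite !eval; field.
clearbody y0 y1 y2.
pose g := qform y0 y0.
have gn0 : g != 0.
  apply/eqP => g0; have y00 : y0 = 0.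
    by apply: (orth _ _ gY) => // y; rewrite !inE => /or3P[] /eqP->.
  have : lie_gens [:: y1; y2].
    apply: (lie_gens_sub gY) => y; rewrite inE => /orP[/eqP->|yY].
      by rewrite y00 mem0v.
    by apply: subvP (addvSl _ _) _ _; apply: memv_span.
  by move/lie_gens_type; rewrite type3.
pose t := Num.sqrt `|g|^-1.
have tn0 : t != 0 by rewrite gt_eqF // sqrtr_gt0 invr_gt0 normr_gt0.
have tg : t ^+ 2 * g = Num.sg g.
  rewrite sqr_sqrtr ?invr_ge0 // {2}[g]numEsg mulrCA mulVf ?mulr1 //.
  by rewrite normr_eq0.
exists (g < 0); exists (t *: y0), y1, y2; split.
- split; first exact: lie_gensZ.
  by rewrite yw brZl cy0 brZr (br_anti y2) cy0 oppr0 !scaler0 !q0l !q0r; split.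
- by rewrite qformC yw qZl zz ?mulr0 ?m2.
- split=> //; rewrite qZl qZr -/g mulrA -expr2 tg neqr0_sign //.
- by split; rewrite ?qZl ?G01 ?G02 ?mulr0.
Qed.

Definition has_diag3 L e0 e1 e2 := exists x0 x1 x2 : L, diag3 x0 x1 x2 e0 e1 e2.

Lemma has_diag3_sign L : lie_type L = 3%N ->
  [\/ has_diag3 L 0 0 0, exists s : bool, has_diag3 L ((-1) ^+ s) 0 0,
      (exists s : bool, has_diag3 L ((-1) ^+ s) ((-1) ^+ s) 0) \/
      has_diag3 L 1 (-1) 0
    | (exists s : bool, has_diag3 L ((-1) ^+ s) ((-1) ^+ s) ((-1) ^+ s)) \/
      (exists s : bool, has_diag3 L ((-1) ^+ s) ((-1) ^+ s) (- (-1) ^+ s))].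
Proof.
case/lie_gens_exists => -[|x0 [|x1 [|x2 [|]]]] //= _ gX.
have [y0 [y1 [y2 [e0 [e1 [e2 /diag3_sign d]]]]]] := diag3_exists gX.
have {d} D : has_diag3 L (Num.sg e0) (Num.sg e1) (Num.sg e2) by [].
have rot a b c : has_diag3 L a b c -> has_diag3 L b c a.
  by move=> [u [v [w d]]]; exists v, w, u; apply: diag3_rot.
have swap a b c : has_diag3 L a b c -> has_diag3 L b a c.
  by move=> [u [v [w d]]]; exists v, u, w; apply: diag3_swap.
(* [D] to [D5] are the six orderings of the three signs, one of which has the required shape. *)
have [D1 D2] := (rot _ _ _ D, rot _ _ _ (rot _ _ _ D)).
have [D3 D4 D5] := And3 (swap _ _ _ D) (swap _ _ _ D1) (swap _ _ _ D2).
clear gX; move: D D1 D2 D3 D4 D5.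
case: (sgrP e0) => _; case: (sgrP e1) => _; case: (sgrP e2) => _ *;
  solve [ by constructor 1
        | by constructor 2; exists false | by constructor 2; exists true
        | by constructor 3; left; exists false
        | by constructor 3; left; exists true | by constructor 3; right
        | by constructor 4; left; exists false
        | by constructor 4; left; exists true
        | by constructor 4; right; exists false
        | by constructor 4; right; exists true; rewrite expr1 opprK ].
Qed.

Theorem rank3_normal_form L :
  lcs L 4 = 0%VS -> lie_type L = 3%N -> ~ lie_abelian L ->
  [\/ normal3 L 0 1 0 0 0,
      exists s s' : bool, normal3 L ((-1) ^+ s) 0 ((-1) ^+ s') 0 0,
      (exists s : bool, normal3 L 0 0 ((-1) ^+ s) ((-1) ^+ s) 0) \/
      normal3 L 0 0 1 (-1) 0
    | (exists s : bool, normal3 L 0 0 ((-1) ^+ s) ((-1) ^+ s) ((-1) ^+ s)) \/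
      (exists s : bool, normal3 L 0 0 ((-1) ^+ s) ((-1) ^+ s) (- (-1) ^+ s))].
Proof.
move=> L4 type3 nab; have sn0 (s : bool) : (-1) ^+ s != 0 :> R by rewrite signr_eq0.
case: (has_diag3_sign type3) => [|[s]|[[s]|]|[[s]|[s]]] [x0 [x1 [x2 d]]].
- by constructor 1; apply: normal3_zero d.
- by constructor 2; have [s' N] := normal3_rank1 L4 type3 (sn0 s) d; exists s', s.
- by constructor 3; left; exists s; apply: normal3_nondegenerate d.
- constructor 3; right; apply: normal3_nondegenerate d => //.
    exact: oner_neq0.
  by rewrite oppr_eq0 oner_neq0.
- by constructor 4; left; exists s; apply: normal3_nondegenerate d.
- by constructor 4; right; exists s; apply: normal3_nondegenerate d.
Qed.

End RankThreeNormal.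

(** * Decomposability *)

Section Decomposition.
Local Open Scope ring_scope.
Variable F : fieldType.

Section OneAlgebra.
Variable L : quadLie F.
Implicit Types (u v z : L) (I S T : {vspace L}).

(** The span of such a z is an ideal on which the form is nondegenerate, that is, an orthogonal
    summand of dimension one. *)
Definition splits_line := exists2 z : L, lie_central z & qform z z != 0.

Definition pairing I u : 'rV[F]_(\dim I) :=
  \row_i qform u (vbasis I)`_i.

Fact pairing_linear I : linear (pairing I).
Proof. by move=> a u v; apply/rowP => i; rewrite !mxE qDl qZl. Qed.

HB.instance Definition _ I :=
  GRing.isLinear.Build F L 'rV[F]_(\dim I) *:%R (pairing I) (pairing_linear I).

Definition orthogonal I : {vspace L} := lker (linfun (pairing I)).

Lemma orthogonalP I u :
  reflect (forall v, v \in I -> qform u v = 0) (u \in orthogonal I).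
Proof.
rewrite memv_ker lfunE /=; apply: (iffP eqP) => [u0 v Iv|u0].
  rewrite (coord_vbasis Iv) linear_sumr big1 // => i _.
  by rewrite [LHS]qZr; move/rowP/(_ i): u0; rewrite !mxE => ->; rewrite mulr0.
by apply/rowP => i; rewrite !mxE u0 // vbasis_mem // mem_nth ?size_tuple.
Qed.

(** Rank-nullity for u |-> B(u, -) restricted to I bounds the codimension of the orthogonal by dim
    I. *)
Lemma orthogonal_complement I : nondegenerate_on (@qform F L) I ->
  (I :&: orthogonal I = 0)%VS /\ (I + orthogonal I = fullv)%VS.
Proof.
move=> ndg; have I0 : (I :&: orthogonal I = 0)%VS.
  apply/eqP; rewrite -subv0; apply/subvP => u; rewrite memv_cap memv0.
  by case/andP=> Iu /orthogonalP uI; apply/eqP/ndg.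
split=> //; apply/eqP; rewrite eqEdim subvf dimv_disjoint_sum //.
rewrite -(limg_ker_dim (linfun (pairing I)) fullv).
rewrite capfv addnC leq_add2r.
by apply: leq_trans (dimvS (subvf _)) _; rewrite dimvf /dim /= mul1n.
Qed.

(** S = [S, S] would place S in every term of the lower central series. *)
Lemma ideal_prod_proper S : lie_nilpotent L -> S <> 0%VS ->
  (lie_prod S S <= S)%VS -> (\dim (lie_prod S S) < \dim S)%N.
Proof.
move=> [t t0] S0 sub; rewrite ltn_neqAle dimvS // andbT.
apply/negP => eqd; have {eqd sub} e : lie_prod S S = S.
  by apply/eqP; rewrite eqEdim sub (eqP eqd) leqnn.
suff /(_ t) : forall k, (S <= lcs L k.+1)%VS.
  by rewrite t0 subv0 => /eqP.
elim=> [|k IH]; first exact: subvf.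
by rewrite -e; apply: lie_prodS; rewrite ?subvf.
Qed.

(** S is the sum of a line spanned by v and of T = [S, S]. As [v, v] = 0, every bracket in S
    involves a factor from T, so T sinks one step in the lower central series at a time and
    vanishes. *)
Lemma ideal_line S : lie_nilpotent L -> (lie_prod S S <= S)%VS ->
  \dim S = (\dim (lie_prod S S)).+1 -> exists v : L, S = <[v]>%VS.
Proof.
move=> [t t0] sub dimS; pose T := lie_prod S S.
have /subvPn[v Sv Tv] : ~~ (S <= T)%VS.
  by apply/negP => /dimvS; rewrite dimS ltnn.
have SE : S = (<[v]> + T)%VS.
  apply/eqP; rewrite eq_sym eqEdim subv_add -memvE Sv sub dimS.
  have vT : (<[v]> :&: T = 0)%VS.
    apply/eqP; rewrite -subv0; apply/subvP => u; rewrite memv_cap memv0.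
    case/andP=> /vlineP[a ->]; have [-> //|a0] := eqVneq a 0.
      by rewrite scale0r.
    by move=> aT; case/negP: Tv; rewrite -[v](scalerK a0) memvZ.
  rewrite dimv_disjoint_sum // dim_vline.
  suff -> : v != 0 by rewrite add1n /=.
  by apply: contraNneq Tv => ->; apply: mem0v.
exists v; rewrite SE.
suff /(_ t) : forall k, (T <= lcs L k.+1)%VS.
  by rewrite t0 subv0 => /eqP->; rewrite addv0.
elim=> [|k IH]; first exact: subvf.
have Tk u : u \in T -> u \in lcs L k.+1 by apply/subvP.
apply/lie_prodP => u w; rewrite SE.
move=> /memv_addP[_ /vlineP[a ->] [u' /Tk uk ->]].
move=> /memv_addP[_ /vlineP[b ->] [w' /Tk wk ->]].
rewrite brDl !brDr !brZl !brZr lie_brxx !scaler0 add0r.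
apply: memvD; first by apply/memvZ/mem_lcs_r.
by apply: memvD; [apply: memvZ|]; apply: mem_lcs.
Qed.

(* An orthogonal sum has the sum of the two types as its type, and a nilpotent
   algebra of type one is a line; so one of the two summands is a line. *)
Lemma decomposable_splits_line :
  lie_nilpotent L -> (lie_type L <= 3)%N -> decomposable L -> splits_line.
Proof.
move=> nilL type3 [I [idI I0 In ndg]]; pose J := orthogonal I.
have [IJ0 IJ] := orthogonal_complement ndg; rewrite -/J in IJ0 IJ.
have idJ : lie_ideal J.
  move=> u v /orthogonalP uI; apply/orthogonalP => w Iw.
  by rewrite qform_invariant (br_anti v w) qNr uI ?oppr0 ?idI.
have J0 : J <> 0%VS by move=> e; rewrite e addv0 in IJ.
have sub S : lie_ideal S -> (lie_prod S S <= S)%VS.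
  by move=> idS; apply/lie_prodP => u v Su _; apply: idS.
have IJbr u v : u \in I -> v \in J -> lie_br u v = 0.
  move=> Iu Jv; apply/eqP; rewrite -memv0 -IJ0 memv_cap idI //=.
  by rewrite br_anti memvN idJ.
have lcs2 : (lcs L 2 <= lie_prod I I + lie_prod J J)%VS.
  apply/lie_prodP => u v _ _.
  have /memv_addP[u1 Iu1 [u2 Ju2 ->]] : u \in (I + J)%VS by rewrite IJ memvf.
  have /memv_addP[v1 Iv1 [v2 Jv2 ->]] : v \in (I + J)%VS by rewrite IJ memvf.
  rewrite brDl !brDr (IJbr u1 v2) // (br_anti u2 v1) (IJbr v1 u2) // oppr0 addr0 add0r.
  by rewrite memv_add ?mem_lie_prod.
have line S T : lie_ideal S -> (S + T = fullv)%VS ->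
    (forall u v, u \in S -> v \in T -> qform u v = 0) -> S <> 0%VS ->
    (forall u v, u \in S -> v \in T -> lie_br u v = 0) ->
    (\dim S <= (\dim (lie_prod S S)).+1)%N -> splits_line.
  move=> idS ST oST S0 ST0 dimS.
  have [v vE] : exists v : L, S = <[v]>%VS.
    apply: ideal_line => //; first exact: sub.
    apply/eqP; rewrite eqn_leq dimS ideal_prod_proper //; exact: sub.
  have Sv : v \in S by rewrite vE memv_line.
  have vv u : u \in S -> lie_br v u = 0.
    by rewrite vE => /vlineP[a ->]; rewrite brZr lie_brxx scaler0.
  exists v => [u|].
    have /memv_addP[u1 Su1 [u2 Tu2 ->]] : u \in (S + T)%VS by rewrite ST memvf.
    by rewrite brDr vv // ST0 // addr0.
  apply/eqP => v0; apply: S0; rewrite vE; apply/eqP; rewrite -subv0 -memvE memv0.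
  apply/eqP/qform_ndg => u.
  have /memv_addP[u1 Su1 [u2 Tu2 ->]] : u \in (S + T)%VS by rewrite ST memvf.
  rewrite qDr (oST v u2) // addr0; move: Su1; rewrite vE => /vlineP[a ->].
  by rewrite qZr v0 mulr0.
have JI u v : u \in J -> v \in I -> qform u v = 0.
  by move=> /orthogonalP uI; apply: uI.
(* If I has type above one, the bound 3 on the total type leaves at most one for J. *)
have [dI|dI] := leqP (\dim I) (\dim (lie_prod I I)).+1.
  by apply: (line I J) => // u v Iu Jv; rewrite qformC JI.
apply: (line J I) => //; first by rewrite addvC.
  by move=> u v Ju Iv; rewrite br_anti IJbr ?oppr0.
have dim2 : (\dim (lcs L 2) <= \dim (lie_prod I I) + \dim (lie_prod J J))%N.
  by apply: leq_trans (dimvS lcs2) (dimv_add_leqif _ _).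
have dimL : \dim {:L} = (\dim I + \dim J)%N by rewrite -IJ dimv_disjoint_sum.
by move: type3; rewrite /lie_type dimL; lia.
Qed.

Lemma splits_line_decomposable :
  (1 < \dim {:L})%N -> splits_line -> decomposable L.
Proof.
move=> dimL [z cz z0]; exists <[z]>%VS; split.
- by move=> u v /vlineP[a ->]; rewrite brZl cz scaler0 mem0v.
- move=> e; case/eqP: z0; have := memv_line z; rewrite e memv0 => /eqP->.
  exact: q0l.
- by move=> e; move: dimL; rewrite -e dim_vline; case: (z != 0).
move=> u /vlineP[a ->] /(_ z (memv_line z))/eqP.
by rewrite qZl mulf_eq0 (negPf z0) orbF => /eqP->; rewrite scale0r.
Qed.

(** By polarisation, a form without anisotropic vectors vanishes when 2 is invertible. *)
Lemma abelian_splits_line : (2 : F) != 0 ->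
  (0 < \dim {:L})%N -> lie_abelian L -> splits_line.
Proof.
move=> two0 dimL ab; suff [z z0] : exists z : L, qform z z != 0.
  by exists z => // u; apply: ab.
apply: contrapT => no; have q0 u : qform u u = 0.
  by apply/eqP/negPn/negP => u0; apply: no; exists u.
suff e : fullv = 0%VS :> {vspace L} by move: dimL; rewrite e dimv0.
apply/eqP; rewrite -subv0; apply/subvP => u _; rewrite memv0.
apply/eqP/qform_ndg => v; have /eqP := q0 (u + v).
rewrite qDl !qDr !q0 (qformC v) add0r addr0 -mulr2n -mulr_natr mulf_eq0.
by rewrite (negPf two0) orbF => /eqP.
Qed.

End OneAlgebra.

(** * Invariance under isometry *)

Section Transfer.
Variables L M : quadLie F.

Lemma isometric_sym : isometric L M -> isometric M L.
Proof.
move=> [f [bf fbr fq]]; have [g fK gK] := bf.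
have fi := can_inj fK.
have lin : linear g by move=> a u v; apply: fi; rewrite linearP !gK.
pose gm := GRing.isLinear.Build F M L *:%R g lin.
pose gl : {linear M -> L} := HB.pack g gm.
exists gl; split; first by exists f.
- by move=> u v; apply: fi; rewrite fbr /= !gK.
- by move=> u v; rewrite -fq /= !gK.
Qed.

Section Map.
Variable f : {linear L -> M}.
Hypothesis bf : bijective f.
Hypothesis fbr : forall x y, f (lie_br x y) = lie_br (f x) (f y).

Lemma limg_lie_prod U W :
  (linfun f @: lie_prod U W = lie_prod (linfun f @: U) (linfun f @: W))%VS.
Proof.
apply/eqP; rewrite eqEsubv; apply/andP; split.
  apply/subvP => _ /memv_imgP[u uUW ->]; rewrite lfunE /=; move: u uUW.
  apply: lie_prod_ind => [|a u v fu fv|u w Uu Ww].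
  - by rewrite linear0 mem0v.
  - by rewrite linearP memvD ?memvZ.
  by rewrite fbr mem_lie_prod // -lfunE; apply: memv_img.
apply/lie_prodP => _ _ /memv_imgP[u Uu ->] /memv_imgP[w Ww ->].
by rewrite !lfunE /= -fbr -lfunE memv_img ?mem_lie_prod.
Qed.

Lemma limg_fullv : (linfun f @: fullv = fullv)%VS.
Proof.
apply/vspaceP => v; rewrite memvf; have [g fK gK] := bf.
by rewrite -(gK v) -lfunE memv_img ?memvf.
Qed.

Lemma limg_lcs k : (linfun f @: lcs L k = lcs M k)%VS.
Proof.
case: k => [|k]; first exact: limg_fullv.
elim: k => [|k IH]; first exact: limg_fullv.
by rewrite !lcsS limg_lie_prod IH limg_fullv.
Qed.

Lemma dim_limg_bij U : \dim (linfun f @: U) = \dim U.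
Proof.
apply: limg_dim_eq; apply/eqP; rewrite -subv0; apply/subvP => u.
rewrite memv_cap memv_ker lfunE memv0 /= => /andP[_ /eqP fu].
by apply/eqP/(bij_inj bf); rewrite fu linear0.
Qed.

End Map.

Hypothesis LM : isometric L M.

Lemma isometric_dim : \dim {:L} = \dim {:M}.
Proof.
by case: LM => f [bf fbr _]; rewrite -(dim_limg_bij bf) limg_fullv.
Qed.

Lemma isometric_dim_lcs k : \dim (lcs L k) = \dim (lcs M k).
Proof.
by case: LM => f [bf fbr _]; rewrite -(dim_limg_bij bf) (limg_lcs bf fbr).
Qed.

Lemma isometric_lcs0 k : lcs M k = 0%VS -> lcs L k = 0%VS.
Proof. by move=> M0; apply/eqP; rewrite -dimv_eq0 isometric_dim_lcs M0 dimv0. Qed.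

Lemma isometric_type : lie_type L = lie_type M.
Proof. by rewrite /lie_type isometric_dim isometric_dim_lcs. Qed.

Lemma isometric_abelian : lie_abelian L -> lie_abelian M.
Proof.
case: LM => f [[g fK gK] fbr _] ab u v.
by rewrite -(gK u) -(gK v) -fbr ab linear0.
Qed.

Lemma isometric_splits_line : splits_line L -> splits_line M.
Proof.
case: LM => f [[g fK gK] fbr fq] [z cz z0]; exists (f z); last by rewrite fq.
by move=> u; rewrite -(gK u) -fbr cz linear0.
Qed.

End Transfer.

Lemma nilindex_le (L : lieAlgebra F) t : (0 < \dim {:L})%N ->
  lcs L t.+1 = 0%VS -> exists2 t', (t' <= t)%N & nilindex L t'.
Proof.
move=> dimL; elim: t => [|t IH] L0.
  by move: dimL; rewrite (L0 : fullv = 0%VS) dimv0.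
have [/IH[t' le' nil']|/eqP n0] := eqVneq (lcs L t.+1) 0%VS.
  by exists t' => //; apply: leqW.
by exists t.+1.
Qed.

Lemma nilindex_lcs0 (L : lieAlgebra F) n t : (t <= n)%N -> nilindex L t ->
  lcs L n.+1 = 0%VS.
Proof. by move=> tn [t0 _]; apply: lcs0_ge t0 _. Qed.

End Decomposition.

(** * Algebras given by tables *)

Section TableTheory.
Local Open Scope ring_scope.
Variables (F : fieldType) (n : nat) (T : prod_table).
Hypothesis jac : forall x y z : 'rV[F]_n.+1, table_jacobi_at T x y z.
Local Notation L := (table_lie jac).
Implicit Types (x y z : 'rV[F]_n.+1) (D : seq nat).

Lemma avec_sum x : x = \sum_(i < n.+1) acoord x i.+1 *: avec F n i.+1.
Proof.
rewrite [LHS]row_sum_delta; apply: eq_bigr => i _.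
by rewrite /acoord /avec /= inord_val.
Qed.

Definition table_brackets (i j : nat) : seq (int * nat) :=
  [seq (if (e.1.1.1 == i) && (e.1.1.2 == j) then e.1.2 else - e.1.2, e.2)
  | e <- T & ((e.1.1.1 == i) && (e.1.1.2 == j)) || ((e.1.1.1 == j) && (e.1.1.2 == i))].

Lemma table_br_avec i j :
  all (fun e => (0 < e.1.1.1 <= n.+1) && (0 < e.1.1.2 <= n.+1))%N T ->
  (0 < i <= n.+1)%N -> (0 < j <= n.+1)%N -> i != j ->
  table_br T (avec F n i) (avec F n j) =
    \sum_(p <- table_brackets i j) p.1%:~R *: avec F n p.2.
Proof.
move=> + lei lej neq_ij; rewrite /table_br /table_brackets big_map big_filter.
have avecE k l : (0 < k <= n.+1)%N -> (0 < l <= n.+1)%N ->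
    acoord (avec F n k) l = (l == k)%:R.
  by case: k l => [|k] [|l] // ? ?; rewrite acoord_avec //= eqSS eq_sym.
elim: T => [|[[[k l] c] m] T' IH] /=; first by rewrite !big_nil.
case/andP=> /andP[lek lel] /IH {}IH; rewrite !big_cons IH /= !avecE //.
have nji : (j == i) = false by rewrite eq_sym (negPf neq_ij).
case: (eqVneq k i) => [->|ki]; case: (eqVneq l j) => [->|lj];
  rewrite ?(negPf neq_ij) ?nji ?eqxx /= ?big_cons /= ?eqxx /=;
  try case: (eqVneq k j) => [->|kj]; try case: (eqVneq l i) => [->|li];
  rewrite ?nji ?eqxx /= ?big_cons /= ?eqxx /= ?(negPf ki) ?(negPf lj) ?andbF /=
    ?(mulr1, mulr0, mul0r, mul1r, subr0, sub0r, oppr0, mulrN1, mulrNz, scale0r, add0r) //.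
by case: (k == j); case: (l == i); rewrite /= ?(mulr1, mulr0, oppr0, mulrN1, scale0r, add0r).
Qed.

(* D assigns a positive degree to each basis vector. *)
Definition table_graded D : bool :=
  all (fun e => [&& e.2.-1 < n.+1, 0 < e.1.1.1 <= n.+1, 0 < e.1.1.2 <= n.+1
    & nth 0 D e.1.1.1.-1 + nth 0 D e.1.1.2.-1 <= nth 0 D e.2.-1])%N T
  && all (leq 1) D && (size D == n.+1).

(** Degrees are positive and brackets add them, so each step down the series raises the least degree
    that occurs. [D] is indexed from zero, coordinates from one. *)
Lemma mem_lcs_table D k (x : L) : table_graded D -> x \in lcs L k.+1 ->
  forall i, (i < n.+1)%N -> (nth 0 D i <= k)%N -> acoord x i.+1 = 0.
Proof.
case/andP=> /andP[/allP TD /allP D1] /eqP sD.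
have Dpos i : (i < n.+1)%N -> (0 < nth 0 D i)%N.
  by move=> ltin; apply/D1/mem_nth; rewrite sD.
elim: k x => [|k IH] x xk i ltin lek.
  by move: lek; rewrite leqn0 => /eqP D0; have := Dpos i ltin; rewrite D0.
move: x xk; apply: lie_prod_ind => [|a x y x0 y0|x y xk _].
- exact: acoord0.
- by rewrite acoordP x0 y0 mulr0 addr0.
rewrite acoord_table_br //; last by apply/allP => e /TD /and4P[].
apply: big1_seq => -[[[p q] c] l] /= eT; case: eqP => // il; subst.
have /and4P /= [_ lep leq lepq] := TD _ eT.
case: p lep lepq eT => // p lep lepq eT; case: q leq lepq eT => // q leq lepq eT.
rewrite (IH x xk p) ?(IH x xk q) ?mul0r ?subr0 ?mulr0 //.
  by have := Dpos p lep; move: lek lepq => /=; lia.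
by have := Dpos q leq; move: lek lepq => /=; lia.
Qed.

Lemma table_lcs0 D N : table_graded D -> all (fun d => d <= N)%N D ->
  lcs L N.+1 = 0%VS.
Proof.
move=> gD /allP DN; apply/eqP; rewrite -subv0; apply/subvP => x xN.
rewrite memv0; apply/eqP/(@acoord_inj F n) => i ltin; rewrite acoord0.
apply: (mem_lcs_table gD xN) => //; apply/DN/mem_nth.
by case/andP: gD => _ /eqP->.
Qed.

(** A computable certificate that a_1, ..., a_d generate: each later basis vector is, up to sign, a
    single bracket of basis vectors. *)
Definition table_generated (d : nat) : bool :=
  all (fun e => (0 < e.1.1.1 <= n.+1) && (0 < e.1.1.2 <= n.+1))%N T
  && all (fun k => has (fun e => [&& e.1.1.1 != e.1.1.2,
      0 < e.1.1.1 <= n.+1, 0 < e.1.1.2 <= n.+1 &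
      table_brackets e.1.1.1 e.1.1.2 \in [:: [:: (1%R, k)]; [:: ((-1)%R, k)]]]) T)%N
    (iota d.+1 (n.+1 - d)).

Lemma avec_lcs2 d k : table_generated d -> (d < k <= n.+1)%N ->
  (avec F n k : L) \in lcs L 2.
Proof.
case/andP=> rT /allP gT /andP[ltdk lekn].
have /gT/hasP[e _ /and4P[neq le1 lej le2]] : k \in iota d.+1 (n.+1 - d).
  by rewrite mem_iota ltdk; lia.
have m2 (u v : L) : lie_br u v \in lcs L 2 by apply/mem_lcs/memvf.
have := m2 (avec F n e.1.1.1) (avec F n e.1.1.2); rewrite /= table_br_avec //.
move: le2; rewrite !inE => /orP[]/eqP->; rewrite big_seq1 /=.
  by rewrite scale1r.
by rewrite scaleN1r memvN.
Qed.

Lemma table_gens d : (d <= n.+1)%N -> table_generated d ->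
  lie_gens [seq avec F n i : L | i <- iota 1 d].
Proof.
move=> led gT; apply/lie_gensP => x; rewrite [x]avec_sum.
apply: memv_suml => i _; apply: memvZ.
have [ltdi|leid] := ltnP d i.+1.
  apply: subvP (addvSr _ _) _ _; apply: avec_lcs2 gT _.
  by rewrite ltdi ltn_ord.
apply: subvP (addvSl _ _) _ _; apply/memv_span/mapP; exists i.+1 => //.
by rewrite mem_iota add1n ltnS.
Qed.

(** The generators bound the type from above; the grading bounds it from below, as n^2 has no
    component of degree one. *)
Lemma table_type D d : (d <= n.+1)%N -> table_graded D -> table_generated d ->
  all (fun k => nth 0 D k <= 1)%N (iota 0 d) -> lie_type L = d.
Proof.
move=> led gD gT /allP D1; apply/eqP; rewrite eqn_leq.
have := lie_gens_type (table_gens led gT); rewrite size_map size_iota => ->.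
have sub : (lcs L 2 <= <<[seq (avec F n i : L) | i <- iota d.+1 (n.+1 - d)]>>)%VS.
  apply/subvP => x x2; rewrite [x]avec_sum; apply: memv_suml => i _.
  have [ltid|leid] := ltnP i d.
    rewrite (mem_lcs_table gD x2) ?scale0r ?mem0v //.
    by apply: D1; rewrite mem_iota.
  apply/memvZ/memv_span/mapP; exists i.+1 => //.
  by rewrite mem_iota ltnS leid; have := ltn_ord i; lia.
have := leq_trans (dimvS sub) (dim_span _).
by rewrite size_map size_iota /lie_type dimvf /dim /= mul1n; lia.
Qed.

End TableTheory.

(** * Computing in tables with integer coefficients *)

Section IntegerEvaluation.
Local Open Scope ring_scope.
Variables (F : fieldType) (n : nat) (T : prod_table) (S : form_table).
Implicit Types u v : seq (int * nat).

Definition interp u : 'rV[F]_n.+1 := \sum_(p <- u) p.1%:~R *: avec F n p.2.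

Definition zcoord u (i : nat) : int :=
  foldr (fun p s => (if p.2 == i then p.1 else 0) + s) 0 u.

(* Integral combinations of basis vectors are lists of pairs (coefficient,
   index), on which brackets and forms of a table can be computed. *)
Definition zbr u v : seq (int * nat) :=
  [seq let: (i, j, c, k) := e in
    (c * (zcoord u i * zcoord v j - zcoord u j * zcoord v i), k) | e <- T].

Definition zform u v : int :=
  foldr (fun e s => (let: (i, j, c) := e in
    c * (if i == j then zcoord u i * zcoord v i
         else zcoord u i * zcoord v j + zcoord u j * zcoord v i)) + s) 0 S.

Definition in_range (i : nat) : bool := (0 < i <= n.+1)%N.

Hypothesis rT : all (fun e : nat * nat * int * nat =>
  [&& in_range e.1.1.1, in_range e.1.1.2 & in_range e.2]) T.
Hypothesis rS : all (fun e : nat * nat * int =>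
  in_range e.1.1 && in_range e.1.2) S.

Lemma acoord_interp u i : all (fun p => in_range p.2) u -> in_range i ->
  acoord (interp u) i = (zcoord u i)%:~R.
Proof.
move=> + ri; rewrite /interp; elim: u => [|[c k] u IH] /=.
  by rewrite big_nil acoord0.
case/andP=> rk /IH {}IH; rewrite big_cons acoordP IH rmorphD /=; congr (_ + _).
case: k i ri rk {IH} => [|k] [|i] // ri rk.
by rewrite acoord_avec //= eqSS; case: eqP => _; rewrite ?mulr1 ?mulr0.
Qed.

Lemma range_zbr u v : all (fun p => in_range p.2) (zbr u v).
Proof.
rewrite /zbr all_map; apply: sub_all rT => -[[[i j] c] k].
by case/and3P.
Qed.

Lemma table_br_interp u v :
  all (fun p => in_range p.2) u -> all (fun p => in_range p.2) v ->
  table_br T (interp u) (interp v) = interp (zbr u v).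
Proof.
move=> ru rv; rewrite /table_br [RHS]/interp /zbr big_map.
apply: eq_big_seq => -[[[i j] c] k] /(allP rT) /and3P[/= ri rj rk].
rewrite !acoord_interp //; congr (_ *: _).
by rewrite rmorphM rmorphB !rmorphM.
Qed.

Lemma table_form_interp u v :
  all (fun p => in_range p.2) u -> all (fun p => in_range p.2) v ->
  table_form S (interp u) (interp v) = (zform u v)%:~R.
Proof.
move=> ru rv; rewrite /table_form /zform.
elim: S rS => [|[[i j] c] S' IH] /=; first by rewrite big_nil.
case/andP=> /andP[ri rj] /IH {}IH; rewrite big_cons IH rmorphD /=; congr (_ + _).
rewrite !acoord_interp //; case: ifP => _; first by rewrite !rmorphM.
by rewrite rmorphM rmorphD !rmorphM.
Qed.

Lemma interp_avec i : interp [:: (1, i)] = avec F n i.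
Proof. by rewrite /interp big_seq1 scale1r. Qed.

End IntegerEvaluation.

Section TableNormalForms.
Local Open Scope ring_scope.
Variables (R : realType) (n : nat) (T : prod_table) (S : form_table).
Hypothesis jac : forall x y z : 'rV[R]_n.+1, table_jacobi_at T x y z.
Hypothesis inv : forall x y z : 'rV[R]_n.+1,
  table_form S (table_br T x y) z = table_form S x (table_br T y z).
Hypothesis ndg : nondegenerate_on (@table_form R n S) fullv.
Local Notation M := (table_quad jac inv ndg).
Local Notation a i := [:: (1 : int, i)].
Local Notation br := (zbr T).
Local Notation form := (zform S).

Definition table_range : bool :=
  all (fun e : nat * nat * int * nat =>
    [&& in_range n e.1.1.1, in_range n e.1.1.2 & in_range n e.2]) T
  && all (fun e : nat * nat * int => in_range n e.1.1 && in_range n e.1.2) S.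

Lemma table_normal2 (c e0 e1 : int) :
  let w := br (a 2) (a 1) in
  table_range -> (2 <= n.+1)%N -> table_generated n T 2 ->
  [&& form w w == c, form (br w (a 1)) (br w (a 1)) == e0,
      form (br w (a 1)) (br w (a 2)) == 0,
      form (br w (a 2)) (br w (a 2)) == e1,
      form (a 1) (a 1) == 0, form (a 1) (a 2) == 0 & form (a 2) (a 2) == 0] ->
  normal2 M c%:~R e0%:~R e1%:~R.
Proof.
move=> w /andP[rT rS] n2 gT /and5P[/eqP C /eqP Q0 /eqP Q01 /eqP Q1].
case/and3P=> /eqP G0 /eqP G01 /eqP G1.
have r1 : all (fun p => in_range n p.2) (a 1) by [].
have r2 : all (fun p => in_range n p.2) (a 2) by rewrite /= /in_range n2.
have rw := @range_zbr n T rT; have brE := table_br_interp R rT.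
have qE := table_form_interp R rS.
exists (interp R n (a 1)), (interp R n (a 2)); split; [split| | | |];
  rewrite /= ?brE ?qE ?rw ?C ?Q0 ?Q01 ?Q1 ?G0 ?G01 ?G1 //.
by have := table_gens jac n2 gT; rewrite /= !interp_avec.
Qed.

(** The generators are taken as a_3, a_2, a_1: this puts [a_2, a_1] and [a_1, a_3], anisotropic in
    every n_{3,3}^i, in first and second place, and gives n_{3,2} the volume 1. *)
Lemma table_normal3 (o e0 e1 e2 : int) :
  let x0 := a 3 in let x1 := a 2 in let x2 := a 1 in
  let w0 := br x1 x2 in let w1 := br x2 x0 in let w2 := br x0 x1 in
  table_range -> (3 <= n.+1)%N -> table_generated n T 3 ->
  [&& form w0 x0 == o, form w0 w0 == e0, form w1 w1 == e1, form w2 w2 == e2,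
      form w0 w1 == 0, form w0 w2 == 0 & form w1 w2 == 0] ->
  [&& form x0 x0 == 0, form x1 x1 == 0, form x2 x2 == 0,
      form x0 x1 == 0, form x0 x2 == 0 & form x1 x2 == 0] ->
  normal3 M 0 o%:~R e0%:~R e1%:~R e2%:~R.
Proof.
move=> x0 x1 x2 w0 w1 w2 /andP[rT rS] n3 gT /and5P[/eqP O /eqP B0 /eqP B1 /eqP B2].
case/and3P=> /eqP B01 /eqP B02 /eqP B12.
case/and5P=> /eqP G0 /eqP G1 /eqP G2 /eqP G01 /andP[/eqP G02 /eqP G12].
have r0 : all (fun p => in_range n p.2) x0 by rewrite /= /in_range n3.
have r1 : all (fun p => in_range n p.2) x1 by rewrite /= /in_range (ltnW n3).
have r2 : all (fun p => in_range n p.2) x2 by [].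
have rw := @range_zbr n T rT; have brE := table_br_interp R rT.
have qE := table_form_interp R rS.
exists (interp R n x0), (interp R n x1), (interp R n x2).
split; [split; [|split; [| | |split]] | | split | split];
  rewrite /= ?brE ?qE ?rw ?O ?B0 ?B1 ?B2 ?B01 ?B02 ?B12 ?G0 ?G1 ?G2 ?G01 ?G02 ?G12 //.
apply: lie_gens_mem (table_gens jac n3 gT) _ => v /=.
by rewrite !interp_avec !inE => /or3P[]->; rewrite ?orbT.
Qed.

End TableNormalForms.

(** * Absence of anisotropic central lines *)

Section Splitting.
Local Open Scope ring_scope.

Lemma lie_gens2_coord (F : fieldType) (L : lieAlgebra F) (x0 x1 z : L) :
  lie_gens [:: x0; x1] -> exists c0 c1, exists2 u : L, u \in lcs L 2 &
    z = c0 *: x0 + c1 *: x1 + u.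
Proof.
move/lie_gensP/(_ z); rewrite span_cons span_seq1.
case/memv_addP=> _ /memv_addP[_ /vlineP[c0 ->] [_ /vlineP[c1 ->] ->]] [u u2 ->].
by exists c0, c1, u.
Qed.

Lemma lie_gens3_coord (F : fieldType) (L : lieAlgebra F) (x0 x1 x2 z : L) :
  lie_gens [:: x0; x1; x2] -> exists c0 c1 c2, exists2 u : L, u \in lcs L 2 &
    z = c0 *: x0 + c1 *: x1 + c2 *: x2 + u.
Proof.
move/lie_gensP/(_ z); rewrite !span_cons span_nil addv0.
case/memv_addP=> v /memv_addP[_ /vlineP[c0 ->] [w]].
case/memv_addP=> _ /vlineP[c1 ->] [_ /vlineP[c2 ->] -> ->] [u u2 ->].
by exists c0, c1, c2, u; rewrite // !addrA.
Qed.

(** An anisotropic central z lies outside n^2, so it can replace one of two generators. As z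
    commutes with the other one, the algebra would be abelian. *)
Lemma type2_not_splits_line (F : fieldType) (L : quadLie F) :
  lie_nilpotent L -> (lie_type L <= 2)%N -> ~ lie_abelian L -> ~ splits_line L.
Proof.
move=> nilL type2 nab [z cz z0].
(* Fewer than two generators are padded with 0. *)
have [x0 [x1 gX]] : exists x0 x1 : L, lie_gens [:: x0; x1].
  have [X sX gX] := lie_gens_exists (erefl (lie_type L)).
  move: type2; rewrite -sX; case: X gX {sX} => [|x0 [|x1 [|x2 X]]] gX //= _.
  - by exists 0, 0; apply: lie_gens_mem gX _.
  - by exists x0, 0; apply: lie_gens_mem gX _ => v; rewrite !inE => ->.
  - by exists x0, x1.
have ab (x : L) : lie_gens [:: z; x] -> False.
  move=> gZ; apply: nab => u; rewrite -/(lie_central u).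
  apply: (central_gens nilL gZ) => y; rewrite !inE => /orP[]/eqP->.
    by rewrite br_anti cz oppr0.
  rewrite br_anti; suff -> : lie_br x u = 0 by rewrite oppr0.
  move: u; apply: (central_gens nilL gZ) => y'; rewrite !inE => /orP[]/eqP->.
    by rewrite br_anti cz oppr0.
  exact: lie_brxx.
have gens c (a b u : L) : c != 0 -> lie_gens [:: a; b] -> u \in lcs L 2 ->
    forall d, lie_gens [:: c *: a + d *: b + u; b].
  move=> cn0 gab u2 d; have := lie_gensD (d) (lie_gensZ cn0 gab) => g.
  apply: (lie_gens_shift g) => // -[|[|i]] /=; rewrite ?subrr ?mem0v //.
  by rewrite addrC addKr.
have [c0 [c1 [u u2 zE]]] := lie_gens2_coord z gX.
have [c00|n0] := eqVneq c0 0; last first.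
  by apply: (ab x1); rewrite zE; apply: (gens _ _ _ _ n0 gX u2).
have [c10|n1] := eqVneq c1 0.
  case/eqP: z0; apply: central_orth => //.
  by rewrite zE c00 c10 !scale0r !add0r.
apply: (ab x0); rewrite zE (addrC (c0 *: x0)); apply: (gens _ _ _ _ n1 _ u2).
by apply: lie_gens_mem gX _ => v; rewrite !inE orbC.
Qed.

Variable R : realType.

(** Write z = c_0 x_0 + c_1 x_1 + c_2 x_2 + u with u in n^2. Modulo n^3, which is orthogonal to n^2,
    [z, x_i] is a combination of the w_j; pairing it with w_0 and w_1 forces all c_i = 0, so z lies
    in n^2 and is isotropic. *)
Lemma diag3_not_splits_line (L : quadLie R) (x0 x1 x2 : L) e0 e1 e2 :
  lcs L 4 = 0%VS -> e0 != 0 -> e1 != 0 -> diag3 x0 x1 x2 e0 e1 e2 ->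
  ~ splits_line L.
Proof.
move=> L4 n0 n1 [gX [a00 a11 a22 [a01 a02 a12]]] [z cz z0].
have [c0 [c1 [c2 [u u2 zE]]]] := lie_gens3_coord z gX.
have m2 (a b : L) : lie_br a b \in lcs L 2 by apply/mem_lcs/memvf.
have ortho (x a b : L) : qform (c0 *: lie_br x0 x + c1 *: lie_br x1 x
    + c2 *: lie_br x2 x) (lie_br a b) = 0.
  have := congr1 (fun v => qform v (lie_br a b)) (cz x).
  rewrite zE q0l 3!brDl !brZl qDl (@qform_lcs _ L 2 1 _ _ _ (mem_lcs x u2)) ?m2 //.
  by rewrite addr0.
have c20 : c2 = 0.
  have /eqP := ortho x1 x1 x2; rewrite lie_brxx scaler0 addr0 qDl !qZl.
  rewrite (qformC (lie_br x0 x1)) a02 (br_anti x2 x1) qNl a00 mulr0 add0r.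
  by rewrite mulrN oppr_eq0 mulf_eq0 (negPf n0) orbF => /eqP.
have c10 : c1 = 0.
  have /eqP := ortho x2 x1 x2; rewrite lie_brxx scaler0 addr0 qDl !qZl a00.
  rewrite (br_anti x0 x2) qNl qformC a01 oppr0 mulr0 add0r.
  by rewrite mulf_eq0 (negPf n0) orbF => /eqP.
have c00 : c0 = 0.
  have /eqP := ortho x2 x2 x0; rewrite lie_brxx scaler0 addr0 qDl !qZl a01.
  rewrite (br_anti x0 x2) qNl a11 mulr0 addr0 mulrN oppr_eq0 mulf_eq0.
  by rewrite (negPf n1) orbF => /eqP.
case/eqP: z0; apply: central_orth => //.
by rewrite zE c00 c10 c20 !scale0r !add0r.
Qed.

(** The same argument with the alternating form B([x, y], z) instead of the Gram matrix of the w_i,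
    which is zero in n_{3,2}. *)
Lemma volume_not_splits_line (L : quadLie R) (x0 x1 x2 : L) :
  lcs L 3 = 0%VS -> lie_gens [:: x0; x1; x2] ->
  qform (lie_br x1 x2) x0 != 0 -> ~ splits_line L.
Proof.
move=> L3 gX n0 [z cz z0].
have [c0 [c1 [c2 [u u2 zE]]]] := lie_gens3_coord z gX.
have ortho (x y : L) : c0 * qform (lie_br x0 x) y + c1 * qform (lie_br x1 x) y
    + c2 * qform (lie_br x2 x) y = 0.
  have := congr1 (fun v => qform v y) (cz x).
  have -> : lie_br z x = c0 *: lie_br x0 x + c1 *: lie_br x1 x + c2 *: lie_br x2 x.
    suff -> : lie_br z x = lie_br (z - u) x by rewrite zE addrK 2!brDl !brZl.
    have /eqP ux : lie_br u x == 0 by rewrite -memv0 -L3 mem_lcs.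
    by rewrite brDl brNl ux subr0.
  by rewrite q0l 2!qDl !qZl.
have wx1 (a b : L) : qform (lie_br a b) a = 0.
  by rewrite br_anti qNl q_brx oppr0.
have wxC (a b c : L) : qform (lie_br a b) c = qform (lie_br b c) a.
  by rewrite qform_invariant qformC.
have c20 : c2 = 0.
  have /eqP := ortho x1 x0; rewrite lie_brxx q0l wx1 (br_anti x2 x1) qNl.
  by rewrite !mulr0 !add0r mulrN oppr_eq0 mulf_eq0 (negPf n0) orbF => /eqP.
have c10 : c1 = 0.
  have /eqP := ortho x2 x0; rewrite lie_brxx q0l wx1 !mulr0 add0r addr0.
  by rewrite mulf_eq0 (negPf n0) orbF => /eqP.
have c00 : c0 = 0.
  have /eqP := ortho x1 x2; rewrite lie_brxx q0l wx1 !mulr0 !addr0 wxC.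
  by rewrite mulf_eq0 (negPf n0) orbF => /eqP.
case/eqP: z0; apply: central_orth => //.
by rewrite zE c00 c10 c20 !scale0r !add0r.
Qed.

Lemma normal2_sign (L : quadLie R) c e0 e1 s : normal2 L c e0 e1 ->
  normal2 (quad_sign L s) ((-1) ^+ s * c) ((-1) ^+ s * e0) ((-1) ^+ s * e1).
Proof.
case: s; last by rewrite !mul1r.
move=> [x0 [x1 [[gX a00 a01 a11] ac A00 A01 A11]]].
rewrite expr1 !mulN1r; exists x0, x1.
by split; [split| | | |]; rewrite //= /opp_form ?a00 ?a01 ?a11 ?ac ?A00 ?A01 ?A11 ?oppr0.
Qed.

Lemma normal3_sign (L : quadLie R) g o e0 e1 e2 s : normal3 L g o e0 e1 e2 ->
  normal3 (quad_sign L s) ((-1) ^+ s * g) ((-1) ^+ s * o)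
    ((-1) ^+ s * e0) ((-1) ^+ s * e1) ((-1) ^+ s * e2).
Proof.
case: s; last by rewrite !mul1r.
move=> [x0 [x1 [x2 [[gX [a00 a11 a22 [a01 a02 a12]]] ao [A00 A11 A22] [A01 A02 A12]]]]].
rewrite expr1 !mulN1r; exists x0, x1, x2.
split; [split; [|split; [| | |split]] | | split | split]; rewrite //= /opp_form
  ?a00 ?a01 ?a02 ?a11 ?a12 ?a22 ?ao ?A00 ?A01 ?A02 ?A11 ?A12 ?A22 ?oppr0 //.
Qed.

End Splitting.

(** * Normal forms, dimensions and types of the listed algebras *)

Section Concrete.
Local Open Scope ring_scope.
Variable R : realType.

Definition grading23 : seq nat := [:: 1; 1; 2; 3; 3]%N.
Definition grading25_1 : seq nat := [:: 1; 1; 2; 3; 4; 5; 5]%N.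
Definition grading25 : seq nat := [:: 1; 1; 2; 3; 3; 4; 5; 5]%N.
Definition grading32 : seq nat := [:: 1; 1; 1; 2; 2; 2]%N.
Definition grading33_8 : seq nat := [:: 1; 1; 1; 2; 2; 3; 3; 3]%N.
Definition grading33_9 : seq nat := [:: 1; 1; 1; 2; 2; 2; 3; 3; 3]%N.

(** The tables are closed terms, so the conditions of [table_normal2] are settled by computation. *)
Lemma normal2_n23 : normal2 (n23 R) 1 0 0.
Proof. exact: (@table_normal2 _ _ _ _ _ _ _ 1 0 0). Qed.

Lemma normal2_n25_1 : normal2 (n25_1 R) 0 1 0.
Proof. exact: (@table_normal2 _ _ _ _ _ _ _ 0 1 0). Qed.

Lemma normal2_n25_2 : normal2 (n25_2 R) 0 1 1.
Proof. exact: (@table_normal2 _ _ _ _ _ _ _ 0 1 1). Qed.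

Lemma normal2_n25_3 : normal2 (n25_3 R) 0 1 (-1).
Proof. exact: (@table_normal2 _ _ _ _ _ _ _ 0 1 (-1)). Qed.

Lemma normal3_n32 : normal3 (n32 R) 0 1 0 0 0.
Proof. exact: (@table_normal3 _ _ _ _ _ _ _ 1 0 0 0). Qed.

Lemma normal3_n33_1 : normal3 (n33_1 R) 0 0 1 1 0.
Proof. exact: (@table_normal3 _ _ _ _ _ _ _ 0 1 1 0). Qed.

Lemma normal3_n33_2 : normal3 (n33_2 R) 0 0 1 1 1.
Proof. exact: (@table_normal3 _ _ _ _ _ _ _ 0 1 1 1). Qed.

Lemma normal3_n33_3 : normal3 (n33_3 R) 0 0 1 (-1) 0.
Proof. exact: (@table_normal3 _ _ _ _ _ _ _ 0 1 (-1) 0). Qed.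

Lemma normal3_n33_4 : normal3 (n33_4 R) 0 0 1 1 (-1).
Proof. exact: (@table_normal3 _ _ _ _ _ _ _ 0 1 1 (-1)). Qed.

Lemma n11_abelian : lie_abelian (n11 R).
Proof. by move=> x y; rewrite /= /table_br big_nil. Qed.

Lemma abelian_lcs2 (L : lieAlgebra R) : lie_abelian L -> lcs L 2 = 0%VS.
Proof.
by move=> ab; apply/eqP; rewrite -subv0; apply/lie_prodP => u v _ _; rewrite ab mem0v.
Qed.

Definition indec_dim (i : indec_index) : nat :=
  match i with
  | I11 _ => 1 | I23 _ => 5 | I25_1 _ => 7 | I25_2 _ => 8 | I33_1 _ => 8
  | I33_2 _ => 9 | I32 => 6 | I25_3 => 8 | I33_3 => 8 | I33_4 _ => 9
  end.

Definition indec_type (i : indec_index) : nat :=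
  match i with
  | I11 _ => 1 | I23 _ | I25_1 _ | I25_2 _ | I25_3 => 2 | _ => 3
  end.

Local Notation listed := (indecomposable_list R).

Lemma listed_dim i : \dim {: listed i} = indec_dim i.
Proof. by case: i => [s|s|s|s|s|s||||s]; rewrite ?[LHS]dimvf; try case: s. Qed.

Lemma listed_type i : lie_type (listed i) = indec_type i.
Proof.
case: i => [s|s|s|s|s|s||||s]; try case: s; rewrite /listed /quad_sign.
1,2: by apply: (@table_type R 0 n11_br (@n11_jacobi R) [:: 1%N] 1).
1,2: by apply: (@table_type R 4 n23_br (@n23_jacobi R) grading23 2).
1,2: by apply: (@table_type R 6 n25_1_br (@n25_1_jacobi R) grading25_1 2).
1,2: by apply: (@table_type R 7 n25_2_br (@n25_2_jacobi R) grading25 2).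
1,2: by apply: (@table_type R 7 n33_1_br (@n33_1_jacobi R) grading33_8 3).
1,2: by apply: (@table_type R 8 n33_2_br (@n33_2_jacobi R) grading33_9 3).
1: by apply: (@table_type R 5 n32_br (@n32_jacobi R) grading32 3).
1: by apply: (@table_type R 7 n25_3_br (@n25_3_jacobi R) grading25 2).
1: by apply: (@table_type R 7 n33_3_br (@n33_3_jacobi R) grading33_8 3).
1,2: by apply: (@table_type R 8 n33_4_br (@n33_4_jacobi R) grading33_9 3).
Qed.

Lemma listed_lcs6 i : lcs (listed i) 6 = 0%VS.
Proof.
case: i => [s|s|s|s|s|s||||s]; try case: s; rewrite /listed /quad_sign.
1,2: by apply: (@table_lcs0 R 0 n11_br (@n11_jacobi R) [:: 1%N]).
1,2: by apply: (@table_lcs0 R 4 n23_br (@n23_jacobi R) grading23).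
1,2: by apply: (@table_lcs0 R 6 n25_1_br (@n25_1_jacobi R) grading25_1).
1,2: by apply: (@table_lcs0 R 7 n25_2_br (@n25_2_jacobi R) grading25).
1,2: by apply: (@table_lcs0 R 7 n33_1_br (@n33_1_jacobi R) grading33_8).
1,2: by apply: (@table_lcs0 R 8 n33_2_br (@n33_2_jacobi R) grading33_9).
1: by apply: (@table_lcs0 R 5 n32_br (@n32_jacobi R) grading32).
1: by apply: (@table_lcs0 R 7 n25_3_br (@n25_3_jacobi R) grading25).
1: by apply: (@table_lcs0 R 7 n33_3_br (@n33_3_jacobi R) grading33_8).
1,2: by apply: (@table_lcs0 R 8 n33_4_br (@n33_4_jacobi R) grading33_9).
Qed.

Lemma listed_lcs4 i : indec_type i = 3%N -> lcs (listed i) 4 = 0%VS.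
Proof.
case: i => [s|s|s|s|s|s||||s] // _; try case: s; rewrite /listed /quad_sign.
1,2: by apply: (@table_lcs0 R 7 n33_1_br (@n33_1_jacobi R) grading33_8).
1,2: by apply: (@table_lcs0 R 8 n33_2_br (@n33_2_jacobi R) grading33_9).
1: by apply: (@table_lcs0 R 5 n32_br (@n32_jacobi R) grading32).
1: by apply: (@table_lcs0 R 7 n33_3_br (@n33_3_jacobi R) grading33_8).
1,2: by apply: (@table_lcs0 R 8 n33_4_br (@n33_4_jacobi R) grading33_9).
Qed.

Lemma n23_lcs4 : lcs (n23 R) 4 = 0%VS.
Proof. by apply: (@table_lcs0 R 4 n23_br (@n23_jacobi R) grading23). Qed.

Lemma n32_lcs3 : lcs (n32 R) 3 = 0%VS.
Proof. by apply: (@table_lcs0 R 5 n32_br (@n32_jacobi R) grading32). Qed.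

End Concrete.

(** * Classification *)

Section OrthogonalSumTheory.
Local Open Scope ring_scope.
Variables (F : fieldType) (A B : quadLie F).
Local Notation AB := (quad_sum A B).

Lemma mem_lcs_sum k (x : AB) :
  x \in lcs AB k.+1 -> x.1 \in lcs A k.+1 /\ x.2 \in lcs B k.+1.
Proof.
elim: k x => [|k IH] x; first by rewrite !memvf.
move: x; apply: lie_prod_ind => [|a u v [? ?] [? ?]|u v /IH[u1 u2] _].
- by rewrite !mem0v.
- by rewrite /= !memvD ?memvZ.
by rewrite !mem_lcs.
Qed.

Lemma lcs_sum0 k :
  lcs A k.+1 = 0%VS -> lcs B k.+1 = 0%VS -> lcs AB k.+1 = 0%VS.
Proof.
move=> A0 B0; apply/eqP; rewrite -subv0; apply/subvP => -[a b] /mem_lcs_sum.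
by rewrite A0 B0 !memv0 => -[/eqP /= -> /eqP /= ->].
Qed.

Lemma lie_gens_sum (X : seq A) (Y : seq B) : lie_gens X -> lie_gens Y ->
  lie_gens ([seq ((x, 0) : AB) | x <- X] ++ [seq ((0, y) : AB) | y <- Y]).
Proof.
move=> gX gY; set Z := _ ++ _; apply/lie_gensP => -[a b].
suff [Ha Hb] : ((a, 0) : AB) \in (<<Z>> + lcs AB 2)%VS /\
    ((0, b) : AB) \in (<<Z>> + lcs AB 2)%VS.
  have -> : ((a, b) : AB) = ((a, 0) : AB) + ((0, b) : AB).
    by congr (_, _); rewrite /= ?addr0 ?add0r.
  exact: memvD.
split.
- have /memv_addP[x Xx [u u2 ->]] : a \in (<<X>> + lcs A 2)%VS.
    by rewrite (gX : _ = _) memvf.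
  have -> : ((x + u, 0) : AB) = ((x, 0) : AB) + ((u, 0) : AB).
    by congr (_, _); rewrite /= addr0.
  apply: memv_add.
    move: x Xx; apply: span_ind => [|c v w vZ wZ|x Xx]; first exact: mem0v.
      have -> : ((c *: v + w, 0) : AB) = c *: ((v, 0) : AB) + ((w, 0) : AB).
        by congr (_, _); rewrite /= scaler0 addr0.
      by rewrite memvD ?memvZ.
    by apply: memv_span; rewrite mem_cat map_f.
  move: u u2; apply: lie_prod_ind => [|c v w vZ wZ|v w _ _]; first exact: mem0v.
    have -> : ((c *: v + w, 0) : AB) = c *: ((v, 0) : AB) + ((w, 0) : AB).
      by congr (_, _); rewrite /= scaler0 addr0.
    by rewrite memvD ?memvZ.
  have -> : ((lie_br v w, 0) : AB) = lie_br ((v, 0) : AB) ((w, 0) : AB).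
    by congr (_, _); rewrite /= br0l.
  exact/mem_lcs/memvf.
have /memv_addP[x Yx [u u2 ->]] : b \in (<<Y>> + lcs B 2)%VS.
  by rewrite (gY : _ = _) memvf.
have -> : ((0, x + u) : AB) = ((0, x) : AB) + ((0, u) : AB).
  by congr (_, _); rewrite /= addr0.
apply: memv_add.
  move: x Yx; apply: span_ind => [|c v w vZ wZ|x Yx]; first exact: mem0v.
    have -> : ((0, c *: v + w) : AB) = c *: ((0, v) : AB) + ((0, w) : AB).
      by congr (_, _); rewrite /= scaler0 addr0.
    by rewrite memvD ?memvZ.
  by apply: memv_span; rewrite mem_cat (map_f (fun y => (0, y) : AB)) ?orbT.
move: u u2; apply: lie_prod_ind => [|c v w vZ wZ|v w _ _]; first exact: mem0v.
  have -> : ((0, c *: v + w) : AB) = c *: ((0, v) : AB) + ((0, w) : AB).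
    by congr (_, _); rewrite /= scaler0 addr0.
  by rewrite memvD ?memvZ.
have -> : ((0, lie_br v w) : AB) = lie_br ((0, v) : AB) ((0, w) : AB).
  by congr (_, _); rewrite /= br0l.
exact/mem_lcs/memvf.
Qed.

(** The projection to [B] is injective on n^2, whose component in [A] lies in [A, A] = 0. *)
Lemma dim_lcs2_sum : lcs A 2 = 0%VS -> (\dim (lcs AB 2) <= \dim (lcs B 2))%N.
Proof.
move=> A0; pose p : AB -> B := snd.
have lp : linear p by [].
pose pm := GRing.isLinear.Build F AB B *:%R p lp.
pose pl : {linear AB -> B} := HB.pack p pm.
have <- : \dim (linfun pl @: lcs AB 2) = \dim (lcs AB 2).
  apply: limg_dim_eq; apply/eqP; rewrite -subv0; apply/subvP => -[a b].
  rewrite memv_cap memv_ker lfunE memv0 /= => /andP[/mem_lcs_sum[/= a0 _]].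
  by rewrite /p /= => /eqP->; move: a0; rewrite A0 memv0 => /eqP->.
apply/dimvS/subvP => _ /memv_imgP[u /mem_lcs_sum[_ u2] ->].
by rewrite lfunE.
Qed.

End OrthogonalSumTheory.

(** * Matching normal forms with the listed algebras and the line sums *)

Section Classification.
Local Open Scope ring_scope.
Variable R : realType.
Local Notation listed := (indecomposable_list R).
Implicit Types L M : quadLie R.

Definition line_sum (s1 s2 : bool) : quadLie R :=
  quad_sum (quad_sign (n11 R) s1) (quad_sign (n23 R) s2).

Lemma n11_gens s : exists2 a : quad_sign (n11 R) s,
  lie_gens [:: a] & qform a a = (-1) ^+ s.
Proof.
have rS : all (fun e : nat * nat * int => in_range 0 e.1.1 && in_range 0 e.1.2) n11_form.
  by [].
have g : lie_gens [:: (avec R 0 1 : n11 R)] by exact: (@table_gens R 0 n11_br (@n11_jacobi R) 1).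
have q1 : table_form n11_form (avec R 0 1) (avec R 0 1) = 1.
  by rewrite -interp_avec (table_form_interp R rS).
by case: s; exists (avec R 0 1); rewrite //= /opp_form /= q1.
Qed.

Lemma quad_sign_abelian L s : lie_abelian L -> lie_abelian (quad_sign L s).
Proof. by case: s. Qed.

Lemma line_sum_gens s1 s2 : exists X : seq (line_sum s1 s2),
  size X = 3%N /\ lie_gens X.
Proof.
have [a ga _] := n11_gens s1.
have [y0 [y1 [[gY _ _ _] _ _ _ _]]] := normal2_sign s2 (normal2_n23 R).
by eexists; split; last exact: (lie_gens_sum ga gY).
Qed.

(** The generator of the line comes first, so w_1 and w_2 vanish and w_0 is the bracket of the two
    generators of n_{2,3}. *)
Lemma normal3_line_sum s1 s2 :
  normal3 (line_sum s1 s2) ((-1) ^+ s1) 0 ((-1) ^+ s2) 0 0.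
Proof.
have [a ga aa] := n11_gens s1.
have [y0 [y1 [[gY _ _ _] w G00 G01 G11]]] := normal2_sign s2 (normal2_n23 R).
rewrite mulr1 in w.
exists (a, 0), (0, y1), (0, y0).
have w1 : lie_br ((0, y0) : line_sum s1 s2) (a, 0) = 0.
  by congr (_, _); rewrite /= ?br0l ?br0r.
have w2 : lie_br ((a, 0) : line_sum s1 s2) (0, y1) = 0.
  by congr (_, _); rewrite /= ?br0l ?br0r.
rewrite /diag3 w1 w2 !q0l !q0r; split.
- split; first apply: lie_gens_mem (lie_gens_sum ga gY) _ => v /=.
    by rewrite !inE => /or3P[]->; rewrite ?orbT.
  by split=> //; rewrite /= /sum_form /= w br0l q0l add0r.
- by rewrite /= /sum_form /= br0l q0l q0r addr0.
- by split; rewrite /= /sum_form /= ?q0l ?aa ?G00 ?G11 ?addr0 ?add0r.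
- by split; rewrite /= /sum_form /= ?q0l ?q0r ?addr0 ?add0r // qformC.
Qed.

Lemma line_sum_lcs4 s1 s2 : lcs (line_sum s1 s2) 4 = 0%VS.
Proof.
apply: lcs_sum0; last by case: s2; apply: n23_lcs4.
apply: (@lcs0_ge _ _ 2) => //; apply/abelian_lcs2/quad_sign_abelian.
exact: n11_abelian.
Qed.

Lemma line_sum_dim s1 s2 : \dim {: line_sum s1 s2} = 6%N.
Proof. by rewrite [LHS]dimvf; case: s1; case: s2. Qed.

Lemma line_sum_type s1 s2 : lie_type (line_sum s1 s2) = 3%N.
Proof.
have [X [sX /lie_gens_type]] := line_sum_gens s1 s2; rewrite sX => le3.
have le2 : (\dim (lcs (line_sum s1 s2) 2) <= \dim (lcs (quad_sign (n23 R) s2) 2))%N.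
  exact/dim_lcs2_sum/abelian_lcs2/quad_sign_abelian/n11_abelian.
have d5 : \dim {: quad_sign (n23 R) s2} = 5%N := listed_dim R (I23 s2).
have t2 : lie_type (quad_sign (n23 R) s2) = 2%N := listed_type R (I23 s2).
by move: le3 t2; rewrite /lie_type (line_sum_dim s1 s2) d5; lia.
Qed.

Lemma line_sum_splits s1 s2 : splits_line (line_sum s1 s2).
Proof.
have [a _ aa] := n11_gens s1.
exists (a, 0) => [[b c]|].
  congr (_, _); last exact: br0l.
  exact: (quad_sign_abelian (@n11_abelian R)) _ _.
by rewrite /= /sum_form /= aa q0l addr0 signr_eq0.
Qed.

Lemma line_sum_nonabelian s1 s2 : ~ lie_abelian (line_sum s1 s2).
Proof.
move=> ab; have [x0 [x1 [x2 [[_ [+ _ _ _]] _ _ _]]]] := normal3_line_sum s1 s2.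
by rewrite ab q0l => /esym/eqP; rewrite signr_eq0.
Qed.

(** One generator commutes with itself, so the algebra is abelian. The generator is anisotropic,
    since otherwise it would be orthogonal to everything, and is rescaled to square 1 or -1. *)
Lemma classify_type1 L : lie_nilpotent L -> lie_type L = 1%N ->
  exists s, isometric L (listed (I11 s)).
Proof.
move=> nilL type1; have [[|x [|]] //= _ gX] := lie_gens_exists type1.
have ab : lie_abelian L.
  move=> u; apply: (central_gens nilL gX) => y; rewrite inE => /eqP->.
  rewrite br_anti; suff -> : lie_br x u = 0 by rewrite oppr0.
  move: u; apply: (central_gens nilL gX) => y'; rewrite inE => /eqP->.
  exact: lie_brxx.
have n0 : qform x x != 0.
  apply/eqP => x0; suff x00 : x = 0.
    suff : lie_gens ([::] : seq L) by move/lie_gens_type; rewrite type1.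
    apply: (lie_gens_sub gX) => y; rewrite inE => /eqP->.
    by rewrite x00 mem0v.
  by apply: (central_orth0 gX) => [u|y]; rewrite ?ab // inE => /eqP->.
pose t := Num.sqrt `|qform x x|^-1.
have tn0 : t != 0 by rewrite gt_eqF // sqrtr_gt0 invr_gt0 normr_gt0.
have tq : t ^+ 2 * qform x x = (-1) ^+ (qform x x < 0)%R.
  rewrite sqr_sqrtr ?invr_ge0 // {2}[qform x x]numEsg mulrCA mulVf ?mulr1.
    by rewrite neqr0_sign.
  by rewrite normr_eq0.
exists (qform x x < 0); have [a ga aa] := n11_gens (qform x x < 0).
have abM : lie_abelian (listed (I11 (qform x x < 0))).
  exact/quad_sign_abelian/n11_abelian.
apply: (isometric_words (X := [:: t *: x]) (Y := [:: a])) => //.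
- by exists 1; apply: abelian_lcs2.
- exact: lie_gensZ.
have nth1 (N : quadLie R) (y : N) i j : qform [:: y]`_i [:: y]`_j =
    if (i == 0%N) && (j == 0%N) then qform y y else 0.
  by case: i => [|i]; case: j => [|j]; rewrite /= ?nth_nil ?q0l ?q0r.
move=> i s k; case/lastP: s => [|s j]; last by rewrite !word_rcons ab abM !q0l.
by rewrite /word /= !nth1 qZl qZr mulrA -expr2 tq aa.
Qed.

Lemma classify_type2 L : lcs L 6 = 0%VS -> lie_type L = 2%N ->
  ~ lie_abelian L -> exists i, isometric L (listed i).
Proof.
move=> L6 type2 nab.
have iso i c e0 e1 : normal2 L c e0 e1 -> normal2 (listed i) c e0 e1 ->
    exists i, isometric L (listed i).
  by move=> NL NM; exists i; apply: normal2_isometric NL NM => //; apply: listed_lcs6.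
have sgn M c e0 e1 : normal2 M c e0 e1 -> normal2 (quad_opp M) (- c) (- e0) (- e1).
  by move/(normal2_sign true); rewrite /= expr1 !mulN1r.
have N1 := sgn _ _ _ _ (normal2_n23 R); have N2 := sgn _ _ _ _ (normal2_n25_1 R).
have N3 := sgn _ _ _ _ (normal2_n25_2 R); rewrite !oppr0 in N1 N2 N3.
case: (rank2_normal_form L6 type2 nab) => [[]|[]|[]|] N.
- exact: (iso (I23 false) _ _ _ N (normal2_n23 R)).
- exact: (iso (I23 true) _ _ _ N N1).
- exact: (iso (I25_1 false) _ _ _ N (normal2_n25_1 R)).
- exact: (iso (I25_1 true) _ _ _ N N2).
- exact: (iso (I25_2 false) _ _ _ N (normal2_n25_2 R)).
- exact: (iso (I25_2 true) _ _ _ N N3).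
- exact: (iso I25_3 _ _ _ N (normal2_n25_3 R)).
Qed.

Lemma classify_type3 L : lcs L 4 = 0%VS -> lie_type L = 3%N ->
  ~ lie_abelian L ->
  (exists2 i, indec_type i = 3%N & isometric L (listed i)) \/
  (exists s1 s2, isometric L (line_sum s1 s2)).
Proof.
move=> L4 type3 nab.
have iso i g o e0 e1 e2 : indec_type i = 3%N -> normal3 L g o e0 e1 e2 ->
    normal3 (listed i) g o e0 e1 e2 ->
    (exists2 i, indec_type i = 3%N & isometric L (listed i)) \/
    (exists s1 s2, isometric L (line_sum s1 s2)).
  move=> i3 NL NM; left; exists i => //; apply: normal3_isometric NL NM => //.
  exact: listed_lcs4.
have sgn M e0 e1 e2 s : normal3 M 0 0 e0 e1 e2 ->
    normal3 (quad_sign M s) 0 0 ((-1) ^+ s * e0) ((-1) ^+ s * e1) ((-1) ^+ s * e2).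
  by move/(normal3_sign s); rewrite !mulr0.
case: (rank3_normal_form L4 type3 nab) => [N|[s [s' N]]|[[s]|]|[[s]|[s]]] => [||N|N|N|N].
- exact: (iso I32 _ _ _ _ _ _ N (normal3_n32 R)).
- right; exists s, s'; apply: normal3_isometric N (normal3_line_sum s s') => //.
  exact: line_sum_lcs4.
- apply: (iso (I33_1 s) _ _ _ _ _ _ N) => //.
  by have := sgn _ _ _ _ s (normal3_n33_1 R); rewrite mulr1 mulr0.
- exact: (iso I33_3 _ _ _ _ _ _ N (normal3_n33_3 R)).
- apply: (iso (I33_2 s) _ _ _ _ _ _ N) => //.
  by have := sgn _ _ _ _ s (normal3_n33_2 R); rewrite mulr1.
- apply: (iso (I33_4 s) _ _ _ _ _ _ N) => //.
  by have := sgn _ _ _ _ s (normal3_n33_4 R); rewrite mulr1 mulrN1.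
Qed.

Lemma splits_line_sign L s : splits_line (quad_sign L s) -> splits_line L.
Proof.
case: s => // -[z cz z0]; exists z => //.
by move: z0; rewrite /= /opp_form oppr_eq0.
Qed.

Lemma normal2_nonabelian L c e0 e1 :
  c != 0 \/ e0 != 0 -> normal2 L c e0 e1 -> ~ lie_abelian L.
Proof.
move=> n0 [x0 [x1 [[_ q0 _ _] qc _ _ _]]] ab; move: q0 qc.
by rewrite !ab !q0l => E0 C0; case: n0; rewrite -?E0 -?C0 eqxx.
Qed.

Lemma listed_not_splits i : indec_type i <> 1%N -> ~ splits_line (listed i).
Proof.
have nil2 j c e0 e1 : indec_type j = 2%N -> normal2 (listed j) c e0 e1 ->
    c != 0 \/ e0 != 0 -> ~ splits_line (listed j).
  move=> j2 N n0; apply: type2_not_splits_line.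
  - by exists 5; apply: listed_lcs6.
  - by rewrite listed_type j2.
  - exact: normal2_nonabelian n0 N.
have nil3 j o e0 e1 e2 : indec_type j = 3%N -> normal3 (listed j) 0 o e0 e1 e2 ->
    e0 != 0 -> e1 != 0 -> ~ splits_line (listed j).
  move=> /(@listed_lcs4 R) j4 [x0 [x1 [x2 [d _ _ _]]]] n0 n1.
  exact: diag3_not_splits_line d.
have u : (1 : R) != 0 := oner_neq0 R.
have v : (-1 : R) != 0 by rewrite oppr_eq0.
case: i => [s|s|s|s|s|s||||s] // _.
- move/splits_line_sign; apply: (nil2 (I23 false)) (normal2_n23 R) _ => //.
  by left.
- move/splits_line_sign; apply: (nil2 (I25_1 false)) (normal2_n25_1 R) _ => //.
  by right.
- move/splits_line_sign; apply: (nil2 (I25_2 false)) (normal2_n25_2 R) _ => //.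
  by right.
- by move/splits_line_sign; apply: (nil3 (I33_1 false)) (normal3_n33_1 R) _ _.
- by move/splits_line_sign; apply: (nil3 (I33_2 false)) (normal3_n33_2 R) _ _.
- have [x0 [x1 [x2 [[gX _] o _ _]]]] := normal3_n32 R.
  by apply: volume_not_splits_line gX _ => //; [exact: n32_lcs3 | rewrite o].
- by apply: (nil2 I25_3) (normal2_n25_3 R) _ => //; right.
- by apply: (nil3 I33_3) (normal3_n33_3 R) _ _.
- by move/splits_line_sign; apply: (nil3 (I33_4 false)) (normal3_n33_4 R) _ _.
Qed.

Lemma line_indecomposable L : (\dim {:L} <= 1)%N -> indecomposable L.
Proof.
move=> dimL [I [_ I0 In _]]; apply: In; apply/eqP; rewrite eqEdim subvf.
apply: leq_trans dimL _; rewrite lt0n dimv_eq0; exact/eqP.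
Qed.

End Classification.

(** * Distinguishing the listed algebras *)

Section Invariants.
Local Open Scope ring_scope.
Variable R : realType.
Local Notation listed := (indecomposable_list R).
Implicit Types L M N : quadLie R.

(** The set of such c is an isometry invariant, and it changes sign with the form. *)
Definition lcs_value L k (c : R) := exists2 x : L, x \in lcs L k & qform x x = c.

Lemma isometric_value L M k c : isometric L M -> lcs_value L k c -> lcs_value M k c.
Proof.
move=> [f [bf fbr fq]] [x xk qx]; exists (f x); last by rewrite fq.
by rewrite -(limg_lcs bf fbr) -lfunE memv_img.
Qed.

Lemma lcs_value_sign L s k c :
  lcs_value L k c -> lcs_value (quad_sign L s) k ((-1) ^+ s * c).
Proof.
case: s; last by rewrite mul1r.
by move=> [x xk qx]; exists x; rewrite // expr1 mulN1r /= /opp_form qx.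
Qed.

Lemma lcs_value_signK L s k c :
  lcs_value (quad_sign L s) k c -> lcs_value L k ((-1) ^+ s * c).
Proof.
case: s; last by rewrite mul1r.
by move=> [x xk qx]; exists x; rewrite // expr1 mulN1r -qx /= /opp_form opprK.
Qed.

(** The value 1 excludes the zero form, so the opposite algebra does not share the property. *)
Definition semipositive L k :=
  (forall c, lcs_value L k c -> 0 <= c) /\ lcs_value L k 1.

Definition indefinite L k := lcs_value L k 1 /\ lcs_value L k (-1).

Lemma semipositive_sign L k s s' : semipositive L k ->
  isometric (quad_sign L s) (quad_sign L s') -> s = s'.
Proof.
move=> [pos one] /isometric_value iso; have := lcs_value_sign s one.
move=> /iso /lcs_value_signK /pos; rewrite mulr1.
by case: s {iso}; case: s' => //=;
  rewrite ?(expr1, expr0, mul1r, mulr1) oppr_ge0 ler10.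
Qed.

Lemma semipositive_indefinite L M k s s' : semipositive L k -> indefinite M k ->
  ~ isometric (quad_sign L s) (quad_sign M s').
Proof.
move=> [pos one] [p m] /isometric_sym /isometric_value iso.
have := lcs_value_sign s' p; have := lcs_value_sign s' m.
move=> /iso /lcs_value_signK /pos + /iso /lcs_value_signK /pos.
by case: s {iso}; case: s' => //=;
  rewrite ?(expr1, expr0, mul1r, mulr1, mulrN, opprK, oppr_ge0, ler10).
Qed.

Lemma normal2_value2 L c e0 e1 : normal2 L c e0 e1 -> lcs_value L 2 c.
Proof.
by move=> [x0 [x1 [_ qc _ _ _]]]; exists (lie_br x1 x0) => //; apply/mem_lcs/memvf.
Qed.

Lemma normal2_value3 L c e0 e1 : normal2 L c e0 e1 ->
  lcs_value L 3 e0 /\ lcs_value L 3 e1.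
Proof.
move=> [x0 [x1 [[_ q0 _ q1] _ _ _ _]]]; split.
  by exists (lie_br (lie_br x1 x0) x0) => //; apply/mem_lcs/mem_lcs/memvf.
by exists (lie_br (lie_br x1 x0) x1) => //; apply/mem_lcs/mem_lcs/memvf.
Qed.

Lemma normal3_value2 L g o e0 e1 e2 : normal3 L g o e0 e1 e2 ->
  [/\ lcs_value L 2 e0, lcs_value L 2 e1 & lcs_value L 2 e2].
Proof.
move=> [x0 [x1 [x2 [[_ [q0 q1 q2 _]] _ _ _]]]]; split.
- by exists (lie_br x1 x2) => //; apply/mem_lcs/memvf.
- by exists (lie_br x2 x0) => //; apply/mem_lcs/memvf.
- by exists (lie_br x0 x1) => //; apply/mem_lcs/memvf.
Qed.

Lemma semipositive_n11 : semipositive (n11 R) 1.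
Proof.
split=> [_ [x _ <-]|].
  by rewrite /= /table_form unlock /= mul1r addr0 -expr2 sqr_ge0.
have [a _ aa] := n11_gens R false; exists a; [exact: memvf | exact: aa].
Qed.

(** The level is chosen so that one coordinate of each off-diagonal pair of the form vanishes and
    only squares remain: n^2 here and for n_{3,3}^1, n_{3,3}^2, but n^3 for n_{2,5}^1, n_{2,5}^2. *)
Lemma semipositive_n23 : semipositive (n23 R) 2.
Proof.
split; last exact: normal2_value2 (normal2_n23 R).
move=> _ [x x2 <-].
have x0 := @mem_lcs_table R 4 n23_br (@n23_jacobi R) grading23 1 x isT x2.
rewrite /= /table_form unlock /= (x0 0%N) // (x0 1%N) //.
by rewrite !mul0r !mulr0 !addr0 !mulr0 !add0r mul1r -expr2 sqr_ge0.
Qed.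

Lemma semipositive_n25_1 : semipositive (n25_1 R) 3.
Proof.
split; last by have [] := normal2_value3 (normal2_n25_1 R).
move=> _ [x x3 <-].
have x0 := @mem_lcs_table R 6 n25_1_br (@n25_1_jacobi R) grading25_1 2 x isT x3.
rewrite /= /table_form unlock /= (x0 0%N) // (x0 1%N) // (x0 2%N) //.
by rewrite !mul0r !mulr0 !addr0 !mulr0 !add0r mul1r -expr2 sqr_ge0.
Qed.

Lemma semipositive_n25_2 : semipositive (n25_2 R) 3.
Proof.
split; last by have [] := normal2_value3 (normal2_n25_2 R).
move=> _ [x x3 <-].
have x0 := @mem_lcs_table R 7 n25_2_br (@n25_2_jacobi R) grading25 2 x isT x3.
rewrite /= /table_form unlock /= (x0 0%N) // (x0 1%N) // (x0 2%N) //.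
by rewrite !mul0r !mulr0 !addr0 !mulr0 !add0r !mul1r -!expr2 addr_ge0 ?sqr_ge0.
Qed.

Lemma semipositive_n33_1 : semipositive (n33_1 R) 2.
Proof.
split; last by have [] := normal3_value2 (normal3_n33_1 R).
move=> _ [x x2 <-].
have x0 := @mem_lcs_table R 7 n33_1_br (@n33_1_jacobi R) grading33_8 1 x isT x2.
rewrite /= /table_form unlock /= (x0 0%N) // (x0 1%N) // (x0 2%N) //.
by rewrite !mul0r !mulr0 !addr0 !mulr0 !addr0 !mul1r -!expr2 addr_ge0 ?sqr_ge0.
Qed.

Lemma semipositive_n33_2 : semipositive (n33_2 R) 2.
Proof.
split; last by have [] := normal3_value2 (normal3_n33_2 R).
move=> _ [x x2 <-].
have x0 := @mem_lcs_table R 8 n33_2_br (@n33_2_jacobi R) grading33_9 1 x isT x2.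
rewrite /= /table_form unlock /= (x0 0%N) // (x0 1%N) // (x0 2%N) //.
rewrite !mul0r !mulr0 !addr0 !mulr0 !addr0 !mul1r -!expr2.
by rewrite !addr_ge0 ?sqr_ge0.
Qed.

Lemma indefinite_n25_3 : indefinite (n25_3 R) 3.
Proof. exact: normal2_value3 (normal2_n25_3 R). Qed.

Lemma indefinite_n33_3 : indefinite (n33_3 R) 2.
Proof. by have [] := normal3_value2 (normal3_n33_3 R). Qed.

Lemma indefinite_n33_4 : indefinite (n33_4 R) 2.
Proof. by have [] := normal3_value2 (normal3_n33_4 R). Qed.

(* On n^2 the form has only one negative square, read off by the sixth
   coordinate, so there is no plane in n^2 on which it is negative definite. *)
Lemma n33_4_not_opp : ~ isometric (n33_4 R) (quad_opp (n33_4 R)).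
Proof.
move=> [f [bf fbr fq]].
have [x0 [x1 [x2 [[_ [q0 q1 _ [q01 _ _]]] _ _ _]]]] := normal3_n33_4 R.
have pos (x : n33_4 R) : x \in lcs (n33_4 R) 2 -> acoord x 6 = 0 -> 0 <= qform x x.
  move=> x2' x6.
  have x0' := @mem_lcs_table R 8 n33_4_br (@n33_4_jacobi R) grading33_9 1 x isT x2'.
  rewrite /= /table_form unlock /= (x0' 0%N) // (x0' 1%N) // (x0' 2%N) // x6.
  rewrite !mul0r !mulr0 !addr0 !mulr0 !addr0 !mul1r -!expr2.
  by rewrite !addr_ge0 ?sqr_ge0.
have fqE x y : qform (f x : n33_4 R) (f y : n33_4 R) = - qform x y.
  by rewrite -(fq x y) /= /opp_form opprK.
pose u : n33_4 R := f (lie_br x1 x2); pose v : n33_4 R := f (lie_br x2 x0).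
have u2 : u \in lcs (n33_4 R) 2 by rewrite /u fbr; apply/mem_lcs/memvf.
have v2 : v \in lcs (n33_4 R) 2 by rewrite /v fbr; apply/mem_lcs/memvf.
have uu : qform u u = -1 by rewrite /u fqE q0.
have vv : qform v v = -1 by rewrite /v fqE q1.
have uv : qform u v = 0 by rewrite /u /v fqE q01 oppr0.
clearbody u v.
have [u6|u6] := eqVneq (acoord u 6) 0.
  by have := pos u u2 u6; rewrite uu oppr_ge0 ler10.
(* This combination has sixth coordinate zero, but its square is -(u_6^2 + v_6^2) < 0. *)
have := pos (acoord v 6 *: u + (- acoord u 6) *: v); rewrite memvD ?memvZ //.
rewrite acoordP /acoord mxE -/(acoord v 6) -/(acoord u 6) mulNr mulrC subrr.
move=> /(_ isT erefl); rewrite !qDl !qDr !qZl !qZr uu vv (qformC v u) uv.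
rewrite !mulr0 addr0 add0r mulrA mulrA -!expr2 sqrrN -mulrDl mulrN1 oppr_ge0.
apply/negP; rewrite -ltNge ltr_wpDl ?sqr_ge0 // lt_neqAle sqr_ge0 andbT.
by rewrite eq_sym sqrf_eq0.
Qed.

(** Dimension and type leave only changes of sign and the pairs n_{2,5}^2 and n_{2,5}^3, n_{3,3}^1
    and n_{3,3}^3, n_{3,3}^2 and n_{3,3}^4; in each pair the form is semipositive, up to sign, on
    one side and indefinite on the other. *)
Lemma listed_inj i j : isometric (listed i) (listed j) -> i = j.
Proof.
move=> iso; have := isometric_dim iso; have := isometric_type iso.
rewrite !listed_dim !listed_type; move: iso.
case: i => [s|s|s|s|s|s||||s]; case: j => [s'|s'|s'|s'|s'|s'||||s'] //= iso _ _.
- by congr I11; apply: semipositive_sign semipositive_n11 iso.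
- by congr I23; apply: semipositive_sign semipositive_n23 iso.
- by congr I25_1; apply: semipositive_sign semipositive_n25_1 iso.
- by congr I25_2; apply: semipositive_sign semipositive_n25_2 iso.
- by case: (semipositive_indefinite (s' := false) semipositive_n25_2 indefinite_n25_3 iso).
- by congr I33_1; apply: semipositive_sign semipositive_n33_1 iso.
- by case: (semipositive_indefinite (s' := false) semipositive_n33_1 indefinite_n33_3 iso).
- by congr I33_2; apply: semipositive_sign semipositive_n33_2 iso.
- by case: (semipositive_indefinite semipositive_n33_2 indefinite_n33_4 iso).
- by case: (semipositive_indefinite (s' := false) semipositive_n25_2 indefinite_n25_3
    (isometric_sym iso)).
- by case: (semipositive_indefinite (s' := false) semipositive_n33_1 indefinite_n33_3
    (isometric_sym iso)).
- by case: (semipositive_indefinite semipositive_n33_2 indefinite_n33_4 (isometric_sym iso)).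
case: s iso; case: s' => // iso; last by case: (n33_4_not_opp iso).
by case: (n33_4_not_opp (isometric_sym iso)).
Qed.

End Invariants.

(* The source describes the decomposable algebras of the last clause as the   *)
(* sums n11 + L with L isometric to n25_3, n33_3 or (n33_4, +-). That is a    *)
(* misprint: such sums have dimension 9 or 10, nilindex 5 or type 4, whereas  *)
(* (n11, +-) + (n23, +-) has dimension 6, type 3 and nilindex 3. The clause   *)
(* below is the corrected one.                                                *)
Theorem theorem6p2 (R : realType) :
  [/\ forall L : quadLie R,
        [/\ indecomposable L, lie_nilpotent L
          & [\/ lie_type L = 1,
                lie_type L = 2 /\ (exists2 t, t <= 5 & nilindex L t)
              | lie_type L = 3 /\ (exists2 t, t <= 3 & nilindex L t)]] <->
        exists i : indec_index, isometric L (indecomposable_list R i),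
      forall i j : indec_index,
        isometric (indecomposable_list R i) (indecomposable_list R j) -> i = j,
      forall L : quadLie R,
        ~ lie_abelian L -> lie_nilpotent L -> lie_type L <= 2 ->
        indecomposable L
    & forall L : quadLie R,
        [/\ ~ lie_abelian L, decomposable L, lie_nilpotent L
          & lie_type L = 3 /\ (exists2 t, t <= 3 & nilindex L t)] <->
        exists s1 s2 : bool,
          isometric L (quad_sum (quad_sign (n11 R) s1) (quad_sign (n23 R) s2))].
Proof.
have type_dim (L : quadLie R) : lie_type L <= \dim {:L} by apply: leq_subr.
have two0 : (2 != 0 :> R)%R by rewrite pnatr_eq0.
(* A nonzero abelian quadratic algebra has an anisotropic vector; its line is a nondegenerate ideal,
   proper in dimension above one. *)
have nab (L : quadLie R) : indecomposable L -> 1 < lie_type L -> ~ lie_abelian L.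
  move=> ind type1 ab; have dim1 := leq_trans type1 (type_dim L).
  apply: ind; apply: splits_line_decomposable => //.
  by apply: abelian_splits_line => //; apply: ltnW.
have sum_dec (L : quadLie R) s1 s2 : isometric L (line_sum R s1 s2) -> decomposable L.
  move=> iso; apply: splits_line_decomposable.
    by rewrite (isometric_dim iso) line_sum_dim.
  exact: isometric_splits_line (isometric_sym iso) (line_sum_splits R s1 s2).
split.
- move=> L; split=> [[ind nilL [type1|[type2 [t t5 nilt]]|[type3 [t t3 nilt]]]]|[i iso]].
  + by have [s iso] := classify_type1 nilL type1; exists (I11 s).
  + apply: classify_type2 => //; first exact: nilindex_lcs0 nilt.
    by apply: nab; rewrite ?type2.
  + case: (@classify_type3 R L) => //; first exact: nilindex_lcs0 nilt.
    * by apply: nab; rewrite ?type3.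
    * by move=> [i _ iso]; exists i.
    (* The line sums left over by [classify_type3] contradict indecomposability. *)
    by move=> [s1 [s2 /sum_dec]].
  have typeL : lie_type L = indec_type i by rewrite (isometric_type iso) listed_type.
  have L6 : lcs L 6 = 0%VS by apply: isometric_lcs0 iso _ (listed_lcs6 R i).
  have nilL : lie_nilpotent L by exists 5.
  have dimL : 0 < \dim {:L} by rewrite (isometric_dim iso) listed_dim; case: (i).
  split=> //.
  + have [i1|/eqP i1] := eqVneq (indec_type i) 1.
      apply: line_indecomposable; rewrite (isometric_dim iso) listed_dim.
      by case: (i) i1.
    move=> dec; apply: (@listed_not_splits R i i1).
    apply: isometric_splits_line iso _; apply: decomposable_splits_line => //.
    by rewrite typeL; case: (i).
  have [i1|i2|i3] : [\/ indec_type i = 1, indec_type i = 2 | indec_type i = 3].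
    by case: (i) => *; [constructor 1|constructor 2|constructor 2|constructor 2|
      constructor 3|constructor 3|constructor 3|constructor 2|constructor 3|constructor 3].
  + by constructor 1; rewrite typeL.
  + by constructor 2; rewrite typeL; split=> //; apply: nilindex_le.
  constructor 3; rewrite typeL; split=> //; apply: nilindex_le => //.
  exact: isometric_lcs0 iso _ (listed_lcs4 R i3).
- exact: listed_inj.
- move=> L nabL nilL type2 dec; apply: (type2_not_splits_line nilL type2 nabL).
  by apply: decomposable_splits_line => //; apply: leqW.
move=> L; split=> [[nabL dec nilL [type3 [t t3 nilt]]]|[s1 [s2 iso]]].
  have L4 := nilindex_lcs0 t3 nilt.
  have [[i i3 iso]|//] := classify_type3 L4 type3 nabL.
  case: (@listed_not_splits R i); first by rewrite i3.
  apply: isometric_splits_line iso _.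
  by apply: decomposable_splits_line; rewrite ?type3.
have L4 : lcs L 4 = 0%VS by apply: isometric_lcs0 iso _ (line_sum_lcs4 R s1 s2).
split; last split.
- by move/(isometric_abelian iso); apply: line_sum_nonabelian.
- exact: sum_dec iso.
- by exists 3.
- by rewrite (isometric_type iso) line_sum_type.
- apply: nilindex_le => //.
  by rewrite (isometric_dim iso) (line_sum_dim R s1 s2).
Qed.
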